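(* For each of the tree families (ordered trees, unordered trees, $d$-ary trees, $d$-bundled trees, $d\ge 1$ an integer) the generating functions $G(z)=\sum_{n\ge1}G_n\frac{z^n}{(n!)^2}$, $P(z)=\sum_{n\ge1}P_n\frac{z^n}{(n!)^2}$, $\tilde G(z)=\sum_{n\ge1}\tilde G_n\frac{z^n}{n!}$, $\tilde P(z)=\sum_{n\ge1}\tilde P_n\frac{z^n}{n!}$ are given as follows, where in each case $Q=Q(z)$ denotes the unique formal power series with $Q(0)=0$ satisfying the stated functional equation $Q=z\varphi(Q)$: Tree parking functions $G$: - ordered trees: $G=1-\frac{1}{(1-Q)(1+Q)e^{Q}}$, $Q=z(1+Q)^2e^{Q}$; - unordered trees: $G=2Q+\ln(1-Q)$, $Q=ze^{2Q}$; - $d$-ary trees: $G=\frac{(1-dQ)^{1/d}e^{Q}}{1-Q}-1$, $Q=z\frac{e^{dQ}}{(1-Q)^{d-1}}$; - $d$-bundled trees: $G=1-\frac{1}{(1-dQ)^{1/d}(1+Q)e^{Q}}$, $Q=z(1+Q)^{d+1}e^{dQ}$. Prime tree parking functions $P$: - ordered trees: $P=(1+Q)(1-Q)e^{Q}-1$, $Q=\frac{z}{(1-Q)^2e^{Q}}$; - unordered trees: $P=2Q+\ln(1-Q)$, $Q=\frac{z}{1-Q}$; - $d$-ary trees: $P=1-\frac{1-Q}{(1-dQ)^{1/d}e^{Q}}$, $Q=z\frac{e^{Q}}{(1-dQ)^{(d-1)/d}}$; - $d$-bundled trees: $P=(1-dQ)^{1/d}(1+Q)e^{Q}-1$, $Q=\frac{z}{(1-dQ)^{(d+1)/d}e^{Q}}$.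 Tree parking distributions $\tilde G$: - ordered trees: $\tilde G=1-\frac{1}{(1+Q)^2(1-Q)}$, $Q=z(1+Q)^4$; - unordered trees: $\tilde G=Q+\ln(1+Q)+\ln(1-Q)$, $Q=z(1+Q)^2e^{Q}$; - $d$-ary trees: $\tilde G=\frac{(1-Q^2)^{1/d}}{1-\frac{Q}{d}}-1$, $Q=\frac{dz(1+Q)^2}{(1-\frac{Q}{d})^{d-1}}$; - $d$-bundled trees: $\tilde G=1-\frac{1}{(1+\frac{Q}{d})(1-Q^2)^{1/d}}$, $Q=dz(1+Q)^2(1+\frac{Q}{d})^{d+1}$. Prime tree parking distributions $\tilde P$: - ordered trees: $\tilde P=(1+Q)^2(1-Q)-1$, $Q=\frac{z}{(1-Q)^2}$; - unordered trees: $\tilde P=Q+\ln(1+Q)+\ln(1-Q)$, $Q=\frac{z(1+Q)}{1-Q}$; - $d$-ary trees: $\tilde P=1-\frac{1-\frac{Q}{d}}{(1-Q^2)^{1/d}}$, $Q=\frac{dz(1+Q)^{(d+1)/d}}{(1-Q)^{(d-1)/d}}$; - $d$-bundled trees: $\tilde P=(1+\frac{Q}{d})(1-Q^2)^{1/d}-1$, $Q=\frac{dz(1+Q)^{(d-1)/d}}{(1-Q)^{(d+1)/d}}$.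
   Context: All trees are rooted, and a tree with $n$ nodes has its nodes labelled by distinct elements of $[n]=\{1,\dots,n\}$; trees are counted as distinct labelled objects. Edges are oriented towards the root. Tree families: ordered trees (the children of each node form an ordered sequence); unordered (Cayley) trees (no order among children); $d$-ary trees (each node has $d$ distinguishable positions, each either empty or occupied by a child); $d$-bundled trees (each node has $d$ distinguishable positions, at each of which an ordered, possibly empty, sequence of children is attached). Parking procedure: given a tree $T$ with $n$ nodes and a sequence $s=(s_1,\dots,s_n)\in[n]^n$, drivers $1,\dots,n$ arrive in order; driver $i$ goes to node $s_i$ and follows the unique path towards the root, parking at the first unoccupied node on that path (including $s_i$ itself); if there is none he leaves without parking. $(T,s)$ is a tree parking function of size $n$ if all $n$ drivers park. It is a tree parking distribution if moreover $s_1\le s_2\le\dots\le s_n$ (equivalently, $s$ is a multiset of size $n$ of elements of $[n]$). A tree parking function (distribution) is prime if every edge of $T$ is crossed by at least one driver during the procedure. For a fixed tree family, $G_n$, $P_n$, $\tilde G_n$, $\tilde P_n$ denote the total numbers of pairs $(T,s)$ with $T$ a size-$n$ tree of the family which are tree parking functions, prime tree parking functions, tree parking distributions, prime tree parking distributions, respectively. *)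

(* Defs.v *)
From HB Require Import structures.
From mathcomp Require Import all_boot all_order all_algebra.
From mathcomp Require Import boolp.

Set Implicit Arguments.
Unset Strict Implicit.
Unset Printing Implicit Defensive.

Import Order.TTheory GRing.Theory Num.Theory.
Local Open Scope ring_scope.

Record fps := Fps { fcoef : nat -> rat }.

HB.instance Definition _ := gen_eqMixin fps.
HB.instance Definition _ := gen_choiceMixin fps.

Lemma fpsP (f g : fps) : (forall n, fcoef f n = fcoef g n) -> f = g.
Proof. by case: f g => [f] [g] /= fg; congr Fps; apply: funext. Qed.

Definition fps_const (a : rat) : fps := Fps (fun n => if n == 0%N then a else 0).
Definition fps_add (f g : fps) := Fps (fun n => fcoef f n + fcoef g n).
Definition fps_opp (f : fps) := Fps (fun n => - fcoef f n).
Definition fps_mul (f g : fps) :=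
  Fps (fun n => \sum_(i < n.+1) fcoef f i * fcoef g (n - i)).

Fact fps_addA : associative fps_add.
Proof. by move=> f g h; apply: fpsP => n /=; rewrite addrA. Qed.
Fact fps_addC : commutative fps_add.
Proof. by move=> f g; apply: fpsP => n /=; rewrite addrC. Qed.
Fact fps_add0 : left_id (fps_const 0) fps_add.
Proof. by move=> f; apply: fpsP => n /=; rewrite if_same add0r. Qed.
Fact fps_addN : left_inverse (fps_const 0) fps_opp fps_add.
Proof. by move=> f; apply: fpsP => n /=; rewrite if_same addNr. Qed.

HB.instance Definition _ :=
  GRing.isZmodule.Build fps fps_addA fps_addC fps_add0 fps_addN.

Definition fps_trunc (N : nat) (f : fps) : {poly rat} :=
  \poly_(i < N.+1) fcoef f i.

Lemma coef_fps_trunc N f n : (n <= N)%N -> (fps_trunc N f)`_n = fcoef f n.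
Proof. by move=> nN; rewrite coef_poly ltnS nN. Qed.

Lemma fcoef_mul_trunc N f g n : (n <= N)%N ->
  fcoef (fps_mul f g) n = (fps_trunc N f * fps_trunc N g)`_n.
Proof.
move=> nN; rewrite coefM /=; apply: eq_bigr => i _.
rewrite !coef_fps_trunc //; first exact: leq_trans (leq_subr _ _) nN.
by apply: leq_trans nN; rewrite -ltnS.
Qed.

Fact fps_mulC : commutative fps_mul.
Proof.
by move=> f g; apply: fpsP => n; rewrite !(@fcoef_mul_trunc n) // mulrC.
Qed.

Fact fps_mulA : associative fps_mul.
Proof.
move=> f g h; apply: fpsP => n.
transitivity ((fps_trunc n f * (fps_trunc n g * fps_trunc n h))`_n).
  rewrite coefM [LHS]/=; apply: eq_bigr => i _.
  rewrite coef_fps_trunc; last by rewrite -ltnS.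
  by rewrite -(@fcoef_mul_trunc n) ?leq_subr.
rewrite mulrA coefM [RHS]/=; apply: eq_bigr => i _.
rewrite (@coef_fps_trunc n h) ?leq_subr //.
by rewrite -(@fcoef_mul_trunc n) // -ltnS.
Qed.

Fact fps_mul1 : left_id (fps_const 1) fps_mul.
Proof.
move=> f; apply: fpsP => n /=; rewrite big_ord_recl /= mul1r subn0.
by rewrite big1 ?addr0 // => i _; rewrite mul0r.
Qed.

Fact fps_mulDl : left_distributive fps_mul fps_add.
Proof.
move=> f g h; apply: fpsP => n /=; rewrite -big_split /=.
by apply: eq_bigr => i _; rewrite mulrDl.
Qed.

Fact fps_1neq0 : fps_const 1 != fps_const 0.
Proof. by apply/eqP => /(congr1 (fun f => fcoef f 0%N)) /= /eqP; rewrite oner_eq0. Qed.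

HB.instance Definition _ := GRing.Zmodule_isComNzRing.Build fps
  fps_mulA fps_mulC fps_mul1 fps_mulDl fps_1neq0.

Lemma fcoef0 n : fcoef 0 n = 0. Proof. exact: if_same. Qed.
Lemma fcoef1 n : fcoef 1 n = (n == 0%N)%:R. Proof. by rewrite /=; case: eqP. Qed.
Lemma fcoefD f g n : fcoef (f + g) n = fcoef f n + fcoef g n.
Proof. by []. Qed.
Lemma fcoefN f n : fcoef (- f) n = - fcoef f n. Proof. by []. Qed.
Lemma fcoefM f g n :
  fcoef (f * g) n = \sum_(i < n.+1) fcoef f i * fcoef g (n - i).
Proof. by []. Qed.
Lemma fcoef_sum (I : Type) (r : seq I) (P : pred I) (F : I -> fps) n :
  fcoef (\sum_(i <- r | P i) F i) n = \sum_(i <- r | P i) fcoef (F i) n.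
Proof.
by apply: (big_morph (fun f => fcoef f n)) => [f g|]; rewrite ?fcoefD ?fcoef0.
Qed.

Definition fpsX : fps := Fps (fun n => (n == 1%N)%:R).

(* Substitution f(g). It is meaningful only when g has zero constant term,    *)
(* in which case g ^+ k does not contribute to the coefficients below k.      *)
Definition fps_comp (f g : fps) : fps :=
  Fps (fun n => \sum_(k < n.+1) fcoef f k * fcoef (g ^+ k) n).

Lemma fcoefX_small g k n :
  fcoef g 0 = 0 -> (n < k)%N -> fcoef (g ^+ k) n = 0.
Proof.
move=> g0; elim: k n => // k IHk n; rewrite ltnS => nk.
rewrite exprS fcoefM big_ord_recl g0 mul0r add0r big1 // => i _.
rewrite IHk ?mulr0 //; apply: leq_trans nk.
by rewrite lift0 ltn_subrL /= (leq_ltn_trans (leq0n i)).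
Qed.

Definition fps_geom : fps := Fps (fun=> 1).

Definition fps_unit : {pred fps} := fun f => fcoef f 0 != 0.

(* f^-1 = c^-1 / (1 - (1 - c^-1 f)), with c the constant term of f. *)
Definition fps_inv (f : fps) : fps :=
  if fcoef f 0 == 0 then f
  else let a := fps_const (fcoef f 0)^-1 in a * fps_comp fps_geom (1 - a * f).

Lemma fps_geomM g : fcoef g 0 = 0 -> fps_comp fps_geom g * (1 - g) = 1.
Proof.
move=> g0; apply: fpsP => n.
transitivity (fcoef ((\sum_(k < n.+1) g ^+ k) * (1 - g)) n).
  rewrite !fcoefM; apply: eq_bigr => i _; congr (_ * _).
  rewrite fcoef_sum [LHS]/= (big_ord_widen n.+1 (fun k => 1 * fcoef (g ^+ k) i) (ltn_ord i)).
  rewrite big_mkcond /=; apply: eq_bigr => k _; case: ifP => [_|]; rewrite ?mul1r //.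
  by move/negbT; rewrite -leqNgt => ik; rewrite fcoefX_small.
rewrite mulrC -opprB mulNr -subrX1 opprB fcoefD fcoefN fcoefX_small //.
by rewrite subr0.
Qed.

Fact fps_mulVx : {in fps_unit, left_inverse 1 fps_inv *%R}.
Proof.
move=> f; rewrite unfold_in => f0; rewrite /fps_inv (negbTE f0) /=.
set a := fps_const _; rewrite -mulrA mulrCA.
have -> : a * f = 1 - (1 - a * f) by rewrite subKr.
by rewrite subKr fps_geomM // fcoefD fcoefN fcoefM big_ord1 /= mulVf // subrr.
Qed.

Fact fps_unitPl (f g : fps) : g * f = 1 -> fps_unit f.
Proof.
move=> /(congr1 (fun h => fcoef h 0%N)); rewrite fcoefM big_ord1 /= => gf.
by apply/eqP => f0; move/eqP: gf; rewrite f0 mulr0 eq_sym oner_eq0.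
Qed.

Fact fps_inv_out : {in [predC fps_unit], fps_inv =1 id}.
Proof. by move=> f; rewrite inE unfold_in negbK /fps_inv => ->. Qed.

HB.instance Definition _ := GRing.ComNzRing_hasMulInverse.Build fps
  fps_mulVx fps_unitPl fps_inv_out.

(* Meaningful only when fcoef f 0 = 0 for fps_exp, and when fcoef f 0 = 1 for *)
(* fps_ln and fps_pow (the binomial series).                                  *)
Definition fps_exp (f : fps) : fps :=
  fps_comp (Fps (fun k => (k`!%:R)^-1)) f.

Definition fps_ln (f : fps) : fps :=
  fps_comp (Fps (fun k => if k == 0%N then 0 else (-1) ^+ k.-1 / k%:R)) (f - 1).

Definition rat_binomial (a : rat) (k : nat) : rat :=
  (\prod_(i < k) (a - i%:R)) / k`!%:R.

Definition fps_pow (f : fps) (a : rat) : fps :=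
  fps_comp (Fps (rat_binomial a)) (f - 1).

Declare Scope fps_scope.
Delimit Scope fps_scope with fps.
Notation "f `^ a" := (fps_pow f a%R) (at level 11) : fps_scope.

(* The label set {1, ..., n} is represented by 'I_n.                          *)
(* A family is given by the possible arrangements of children below a node,   *)
(* with labels in 'I_n, and by the list of the children in an arrangement.    *)
Record tree_family := TreeFamily {
  arrangement : nat -> finType;
  children : forall n, arrangement n -> seq 'I_n
}.

(* Children are pairwise distinct in a tree, so that bounding the lengths of  *)
(* the sequences by n loses nothing and makes the types finite.               *)
Definition ordered : tree_family :=
  @TreeFamily (fun n => n.-bseq 'I_n : finType) (fun n s => s).

Definition unordered : tree_family :=
  @TreeFamily (fun n => {set 'I_n} : finType) (fun n A => enum A).

Definition dary (d : nat) : tree_family :=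
  @TreeFamily (fun n => {ffun 'I_d -> option 'I_n} : finType)
    (fun n a => pmap a (enum 'I_d)).

Definition bundled (d : nat) : tree_family :=
  @TreeFamily (fun n => {ffun 'I_d -> n.-bseq 'I_n} : finType)
    (fun n a => flatten [seq (a i : seq 'I_n) | i <- enum 'I_d]).

Section Trees.
Variables (F : tree_family) (n : nat).

Definition pretree := {ffun 'I_n -> arrangement F n}.

Implicit Types (T : pretree) (u v : 'I_n) (s : seq 'I_n) (occ : {set 'I_n}).

Definition is_child T v u : bool := u \in children (T v).

Definition all_children T : seq 'I_n :=
  flatten [seq children (T v) | v <- enum 'I_n].

Definition is_tree T : bool :=
  uniq (all_children T) &&
  [exists r, (r \notin all_children T) && [forall v, connect (is_child T) r v]].

Definition parent T u : option 'I_n := [pick v | is_child T v u].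

Fixpoint ascend (T : pretree) (k : nat) (v : 'I_n) : seq 'I_n :=
  v :: match k, parent T v with
       | k'.+1, Some u => ascend T k' u
       | _, _ => [::]
       end.

(* In a tree, n steps up from v always suffice to get to the root. *)
Definition path_to_root T v : seq 'I_n := ascend T n v.

Definition parking_spot T occ v : option 'I_n :=
  ohead [seq u <- path_to_root T v | u \notin occ].

Definition park T occ v : {set 'I_n} :=
  if parking_spot T occ v is Some u then u |: occ else occ.

Definition occupied T s : {set 'I_n} := foldl (park T) set0 s.

Definition all_park T (s : n.-tuple 'I_n) : bool :=
  [forall i : 'I_n, parking_spot T (occupied T (take i s)) (tnth s i)].

(* A driver preferring v crosses the edge from u to its parent when he passes *)
(* u, i.e. when u lies on his path strictly before the node where he parks.   *)
Definition crosses T occ v u : bool :=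
  u \in take (find (fun w => w \notin occ) (path_to_root T v)) (path_to_root T v).

Definition all_crossed T (s : n.-tuple 'I_n) : bool :=
  [forall u, parent T u ==>
     [exists i : 'I_n, crosses T (occupied T (take i s)) (tnth s i) u]].

Definition parking_fun (p : pretree * n.-tuple 'I_n) : bool :=
  is_tree p.1 && all_park p.1 p.2.

Definition prime_parking_fun (p : pretree * n.-tuple 'I_n) : bool :=
  parking_fun p && all_crossed p.1 p.2.

Definition weakly_increasing (s : n.-tuple 'I_n) : bool :=
  sorted leq [seq val i | i <- s].

Definition parking_dist (p : pretree * n.-tuple 'I_n) : bool :=
  parking_fun p && weakly_increasing p.2.

Definition prime_parking_dist (p : pretree * n.-tuple 'I_n) : bool :=
  prime_parking_fun p && weakly_increasing p.2.

End Trees.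

Definition egf (a : nat -> nat) : fps :=
  Fps (fun n => if n == 0%N then 0 else (a n)%:R / n`!%:R).
Definition egf2 (a : nat -> nat) : fps :=
  Fps (fun n => if n == 0%N then 0 else (a n)%:R / (n`!%:R ^+ 2)).

Definition G (F : tree_family) : fps :=
  egf2 (fun n => #|[set p | @parking_fun F n p]|).
Definition P (F : tree_family) : fps :=
  egf2 (fun n => #|[set p | @prime_parking_fun F n p]|).
Definition Gtilde (F : tree_family) : fps :=
  egf (fun n => #|[set p | @parking_dist F n p]|).
Definition Ptilde (F : tree_family) : fps :=
  egf (fun n => #|[set p | @prime_parking_dist F n p]|).

(* A = H(Q), where Q is the unique series with Q(0) = 0 and Q = E(Q). *)
Definition given_by (A : fps) (H E : fps -> fps) : Prop :=
  exists Q : fps,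
    unique (fun Q => fcoef Q 0 = 0 /\ Q = E Q) Q /\ A = H Q.

(* Main.v *)
(* A pair (T, s) is a parking function iff every subtree with k nodes contains *)
(* the preferences of at least k drivers, and it is prime iff every proper     *)
(* subtree contains at least k + 1. Only the numbers of drivers at the nodes   *)
(* matter, with weight W = e^u for functions and W = 1/(1-u) for               *)
(* distributions. If u records the excess of drivers over nodes, removing the  *)
(* root shows that the trees are counted by a series A(z,u) with               *)
(*       u A = z (W(u) phi(A) - W(0) phi(A(z,0))),                             *)
(* where phi is the series of the arrangements of children; for prime          *)
(* functions phi is applied to A(z,u) - A(z,0) instead. The series U(z) that   *)
(* annihilates the derivative of this equation along A also annihilates the    *)
(* derivative along u (kernel method). The resulting system for U,             *)
(* Phi = A(z,U) and A(z,0) is solved explicitly with Q = U, or Q = U/(1-U) for *)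
(* distributions, up to a factor d.                                            *)
Require Import Defs.
From HB Require Import structures.
From mathcomp Require Import all_boot all_order all_algebra.
From mathcomp Require Import boolp ring zify.

Set Implicit Arguments.
Unset Strict Implicit.
Unset Printing Implicit Defensive.

Import Order.TTheory GRing.Theory Num.Theory.

(** * Parking as a condition on subtrees *)

(** Drivers are conserved: of those who prefer a node of the subtree at v, each parks in that
    subtree or passes v ([count_descendants]). A node that stays empty is never passed, so its
    subtree received fewer drivers than it has nodes. Hence all drivers park iff every subtree
    receives at least as many drivers as it has nodes; the surplus at v is then the number of
    drivers passing v, and primality asks that it be positive at every non-root ([parking_counts]).
    Only the child relation and the number of drivers at each node matter.

    The count therefore factors. With m_u drivers prescribed at each u, there are n! / prod m_u!
    sequences, or a single increasing one, which gives the weights W = e^u and W = 1/(1-u)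
    ([tuple_weight_all], [tuple_weight_sorted]). A node with child set A has |A|! phi_|A|
    arrangements, with phi = 1/(1-x), e^x, (1+x)^d or (1-x)^(-d), so that each family reduces to
    ordered trees weighted by phi_k at a node with k children ([sum_family_ordered]). Splitting off
    the first tree of an ordered labelled forest ([sum_forests]) leads to the series B(z,u) of the
    trees that may hang below a node, u marking the surplus, and to u (B + tau P) = z (W(u) phi(B) -
    C), where P is the wanted series, tau is 1 for prime and 0 otherwise, and C is 1 for prime and
    phi(P) otherwise ([count_pairs]).

    The u-derivative of this equation contains the derivative of B with the coefficient u - z W(u)
    phi'(B). Let U(z) be the series at which it vanishes and Phi = B(z,U); what remains is Phi + tau
    P = z W'(U) phi(Phi) ([kernel_system]). Put Q = U W'(U) / W(U), M = W'(U) and K = W(U) - U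
    W'(U). Then Q = z M phi'(Phi), Phi + tau P = z M phi(Phi) and K phi(Phi) = C ([kernel_exp],
    [kernel_geom]). For each of the four phi the derivative phi' is a simple expression in phi, so
    Phi can be eliminated and P becomes explicit in Q. The equation for Q is z times an expression
    in Q, hence a z-adic contraction, and its solution is unique. *)

Definition descendants (n : nat) (e : rel 'I_n) (v : 'I_n) : {set 'I_n} :=
  [set u | connect e v u].

(* tau distinguishes prime parking functions (true) from all of them (false): *)
(* a prime one needs one more driver below every non-root v, to cross the     *)
(* edge above v.                                                              *)
Definition enough_drivers (n : nat) (e : rel 'I_n) (tau : bool) (m : 'I_n -> nat) : bool :=
  [forall v, #|descendants e v| + (tau && [exists u, e u v]) <= \sum_(u in descendants e v) m u].

Lemma uniq_flatten_inj (I J : eqType) (f : I -> seq J) (s : seq I) i j x :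
  uniq (flatten [seq f i | i <- s]) -> i \in s -> j \in s ->
  x \in f i -> x \in f j -> i = j.
Proof.
elim: s => //= k s IHs; rewrite cat_uniq => /and3P[_ /hasPn disj uq].
have notk l : l \in s -> x \in f l -> x \notin f k.
  by move=> ls xl; apply: disj; apply/flatten_mapP; exists l.
rewrite !inE => /orP[/eqP->|si] /orP[/eqP->|sj] xi xj //.
- by case/negP: (notk _ sj xj).
- by case/negP: (notk _ si xi).
exact: IHs.
Qed.

Section Parking.
Variables (F : tree_family) (n : nat) (T : pretree F n).
Hypothesis treeT : is_tree T.
Implicit Types (u v w x : 'I_n) (s : seq 'I_n) (occ : {set 'I_n}).

Let e := is_child T.
Let p := path_to_root T.

Lemma all_children_mem u : (u \in all_children T) = [exists v, e v u].
Proof.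
apply/flatten_mapP/existsP => [[v _ vu]|[v vu]]; first by exists v.
by exists v => //; rewrite mem_enum.
Qed.

Lemma is_child_inj u v w : e u w -> e v w -> u = v.
Proof.
have [uq _] := andP treeT.
by move=> uw vw; apply: (uniq_flatten_inj uq _ _ uw vw); rewrite mem_enum.
Qed.

Lemma parentE u v : (parent T v == Some u) = e u v.
Proof.
rewrite /parent; case: pickP => [w wv|none]; last by rewrite [e u v]none.
by apply/eqP/idP => [[<-]//|uv]; rewrite (is_child_inj wv uv).
Qed.

Lemma parent_ex v : parent T v = [exists u, e u v] :> bool.
Proof.
rewrite /parent; case: pickP => [w wv|none]; first by symmetry; apply/existsP; exists w.
by symmetry; apply/existsP => -[u]; rewrite [e u v]none.
Qed.

Lemma tree_root : exists r, parent T r = None /\ forall v, connect e r v.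
Proof.
have [_ /existsP[r /andP[rN /forallP rC]]] := andP treeT; exists r; split=> //.
by move: rN; rewrite all_children_mem -parent_ex; case: (parent T r).
Qed.

Lemma ascend_path r q k : parent T r = None -> path e r q -> size q <= k ->
  ascend T k (last r q) = rev (r :: q).
Proof.
move=> rN; elim/last_ind: q k => [|q v IHq] k.
  by case: k => [|k] _ _ //=; rewrite rN.
rewrite rcons_path size_rcons last_rcons => /andP[rq qv].
case: k => //= k qk; have /eqP-> : parent T v == Some (last r q) by rewrite parentE.
by rewrite IHq // -rcons_cons rev_rcons.
Qed.

(** Once a descending path from the root to v is made free of repetitions it has at most n nodes, so
    the fuel [n] in [path_to_root] never runs out and the way up is the reversed path. *)
Lemma path_rootP v : exists r q, [/\ parent T r = None, path e r q,
  last r q = v, uniq (r :: q) & p v = rev (r :: q)].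
Proof.
have [r [rN /(_ v)/connectP[q' rq' vE]]] := tree_root; exists r.
case: (shortenP rq') vE => q rq uq _ ->; exists q; split=> //; apply: ascend_path => //.
have : size (r :: q) <= #|'I_n| by rewrite -(card_uniqP uq) max_card.
by rewrite card_ord; apply: ltnW.
Qed.

Lemma path_to_root_uniq v : uniq (p v).
Proof. by have [r [q [_ _ _ uq ->]]] := path_rootP v; rewrite rev_uniq. Qed.

Lemma path_to_rootE v :
  p v = v :: (if parent T v is Some u then p u else [::]).
Proof.
have [r [q [rN rq <- uq ->]]] := path_rootP v.
elim/last_ind: q rq uq => [|q w _] rq uq; first by rewrite rN.
move: rq; rewrite last_rcons -rcons_cons rev_rcons rcons_path => /andP[rq qw].
have /eqP-> : parent T w == Some (last r q) by rewrite parentE.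
congr cons; rewrite [RHS](ascend_path rN rq) //.
have : size (r :: rcons q w) <= #|'I_n| by rewrite -(card_uniqP uq) max_card.
by rewrite card_ord /= size_rcons => qn; do 2!apply: ltnW.
Qed.

Lemma path_to_root_drop v w : w \in p v -> p w = drop (index w (p v)) (p v).
Proof.
have [k] := ubnP (size (p v)); elim: k v => // k IHk v.
rewrite (path_to_rootE v); case vN: (parent T v) => [u|] /=; last first.
  by rewrite mem_seq1 => _ /eqP->; rewrite eqxx drop0 path_to_rootE vN.
rewrite ltnS inE => vk /orP[/eqP->|wu]; first by rewrite eqxx drop0 path_to_rootE vN.
case: eqP => [<-|_]; first by rewrite drop0 path_to_rootE vN.
by rewrite /= -IHk.
Qed.

(** Ancestors of x form a chain, and their order is read off from their positions on the path of
    x. *)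
Lemma path_to_root_index v w x : v \in p x -> w \in p x ->
  (v \in p w) = (index w (p x) <= index v (p x)).
Proof.
move=> vx wx; rewrite (path_to_root_drop wx).
have := path_to_root_uniq x; rewrite -{1}(cat_take_drop (index w (p x)) (p x)).
rewrite cat_uniq => /and3P[_ /hasPn disj _].
have:= vx; rewrite -{1}(cat_take_drop (index w (p x)) (p x)) mem_cat.
case: (boolP (v \in drop _ _)) => [vd _|_].
  by rewrite leqNgt -(in_take _ vx) (negbTE (disj _ vd)).
by rewrite orbF in_take // => lt; rewrite leqNgt lt.
Qed.

Lemma mem_path_to_root_trans u v w : u \in p v -> v \in p w -> u \in p w.
Proof. by move=> uv vw; move: uv; rewrite (path_to_root_drop vw); apply: mem_drop. Qed.

Lemma mem_path_to_root v u : (v \in p u) = connect e v u.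
Proof.
apply/idP/connectP => [vu|[q vq ->]].
  have [k] := ubnP (size (p u)); elim: k u vu => // k IHk u.
  rewrite path_to_rootE inE => /orP[/eqP->|]; first by exists [::].
  case uE: (parent T u) => [w|] // vw; rewrite ltnS => wk.
  have [q vq wE] := IHk _ vw wk; exists (rcons q u); last by rewrite last_rcons.
  by rewrite rcons_path vq -wE -parentE uE /=.
elim/last_ind: q vq => [|q w IHq] /=; first by rewrite path_to_rootE mem_head.
rewrite rcons_path last_rcons => /andP[vq]; rewrite -parentE => /eqP wE.
by rewrite (path_to_rootE w) wE inE IHq ?orbT.
Qed.

Lemma descendantsE v : descendants e v = [set u | v \in p u].
Proof. by apply/setP => u; rewrite !inE mem_path_to_root. Qed.

(** The conservation law for a single driver: entering the subtree at v means that v is on the path,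
    and then the driver either fills a node of this subtree or crosses the edge above v. A driver
    who leaves the tree crosses every node of the path. *)
Lemma park_descendants occ x v :
  (v \in p x) + #|occ :&: descendants e v| =
  #|park T occ x :&: descendants e v| + crosses T occ x v.
Proof.
rewrite /park /parking_spot /crosses -/(p x).
set unocc := fun w => w \notin occ; set k := find _ _.
have spotE : ohead [seq u <- p x | unocc u] = if k < size (p x) then Some (nth v (p x) k) else None.
  by rewrite /k; elim: (p x) => //= y s IHs; case: (unocc y).
rewrite spotE descendantsE; case: ltnP => kx; last first.
  by rewrite take_oversize // addnC.
set w := nth v (p x) k.
have wx : w \in p x by apply: mem_nth.
have wk : index w (p x) = k by rewrite index_uniq ?path_to_root_uniq.
have wocc : w \notin occ by apply: (@nth_find _ v unocc); rewrite has_find.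
(* The parking node w is new, so it adds one to the occupied nodes of the subtree exactly when v is
   an ancestor of w. *)
have cardE : #|(w |: occ) :&: [set u | v \in p u]| =
    (v \in p w) + #|occ :&: [set u | v \in p u]|.
  case: (boolP (v \in p w)) => vw.
    rewrite setIUl (setIidPl _) ?sub1set ?inE // cardsU1 !inE.
    by rewrite (negbTE wocc).
  rewrite setIUl (_ : [set w] :&: _ = set0) ?set0U //.
  by apply/setP => y; rewrite !inE; case: eqP => // ->; apply/negbTE.
rewrite cardE addnAC; congr (_ + _).
case: (boolP (v \in p x)) => vx; last first.
  have -> : v \in take k (p x) = false by apply: contraNF vx => /mem_take.
  case: (boolP (v \in p w)) => // vw.
  by rewrite (mem_path_to_root_trans vw wx) in vx.
by rewrite (path_to_root_index vx wx) wk in_take //; case: ltnP.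
Qed.

Lemma occupied_rcons s x : occupied T (rcons s x) = park T (occupied T s) x.
Proof. by rewrite /occupied foldl_rcons. Qed.

Definition crossings s v : nat :=
  \sum_(i < size s) crosses T (occupied T (take i s)) (nth v s i) v.

Lemma big_rcons_prefix (f : seq 'I_n -> 'I_n -> nat) s x v :
  \sum_(i < size (rcons s x)) f (take i (rcons s x)) (nth v (rcons s x) i) =
  \sum_(i < size s) f (take i s) (nth v s i) + f s x.
Proof.
rewrite size_rcons big_ord_recr /= -cats1 take_size_cat // nth_cat ltnn subnn /=.
congr (_ + _); apply: eq_bigr => i _.
by rewrite takel_cat ?(ltnW (ltn_ord i)) // nth_cat ltn_ord.
Qed.

(* A driver starting below v either parks below v or passes v. *)
Lemma count_descendants s v : count (fun x => v \in p x) s =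
  #|occupied T s :&: descendants e v| + crossings s v.
Proof.
elim/last_ind: s => [|s x IHs].
  by rewrite /crossings big_ord0 addn0 /occupied /= set0I cards0.
rewrite /crossings (big_rcons_prefix (fun s x => crosses T (occupied T s) x v)).
rewrite -/(crossings s v) occupied_rcons addnA addnAC -park_descendants.
by rewrite -cats1 count_cat IHs /=; lia.
Qed.

Lemma card_occupied s v : #|occupied T s| =
  \sum_(i < size s) (parking_spot T (occupied T (take i s)) (nth v s i) : bool).
Proof.
elim/last_ind: s => [|s x IHs]; first by rewrite big_ord0 /occupied /= cards0.
rewrite (big_rcons_prefix (fun s x => (parking_spot T (occupied T s) x : bool) : nat)).
rewrite -IHs occupied_rcons /park; case E: parking_spot => [w|]; last by rewrite addn0.
rewrite cardsU1 addnC; congr (_ + _).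
move: E; rewrite /parking_spot; set f := [seq _ <- _ | _] => fE.
have : w \in f by case: f fE => // a f [->]; apply: mem_head.
by rewrite mem_filter => /andP[->].
Qed.

Lemma occupied_sub s i : occupied T (take i s) \subset occupied T s.
Proof.
rewrite -{2}(cat_take_drop i s) /occupied foldl_cat.
elim: (drop i s) (foldl _ _ _) => //= x s' IHs occ.
apply: subset_trans (IHs _); rewrite /park; case: parking_spot => // w.
exact: subsetUr.
Qed.

(** By [card_occupied], occupied nodes are counted by the drivers who parked; there are as many
    nodes as drivers. *)
Lemma all_parkE (s : n.-tuple 'I_n) : all_park T s = (occupied T s == setT).
Proof.
apply/forallP/eqP => [park|sT i].
  apply/setP => v; suff /eqP-> : occupied T s == setT by [].
  rewrite eqEcard subsetT cardsT card_ord (card_occupied _ v) size_tuple.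
  rewrite (eq_bigr (fun=> 1)) => [|i _]; last by rewrite -tnth_nth park.
  by rewrite sum1_card card_ord leqnn.
have := card_occupied s i; rewrite sT cardsT card_ord size_tuple => nE.
have : \sum_(j < n) ((~~ parking_spot T (occupied T (take j s)) (tnth s j)) : nat) = 0.
  apply/eqP; rewrite -(eqn_add2l n) addn0 {1}nE -big_split /=.
  rewrite (eq_bigr (fun=> 1)) ?sum1_card ?card_ord // => j _.
  by rewrite -tnth_nth; case: (parking_spot _ _ _).
by move/eqP; rewrite sum_nat_eq0 => /forallP/(_ i); case: parking_spot.
Qed.

Lemma crosses_occupied occ x v : crosses T occ x v -> v \in occ.
Proof.
rewrite /crosses -/(p x); elim: (p x) => //= y s IHs; case: (boolP (y \in occ)) => //= yo.
by rewrite inE => /orP[/eqP->|].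
Qed.

Lemma count_pathE (s : seq 'I_n) v : count (fun x => v \in p x) s =
  \sum_(u in descendants e v) count_mem u s.
Proof.
rewrite descendantsE; elim: s => [|x s IHs] /=; first by rewrite big1.
rewrite big_split /= -IHs; congr (_ + _).
case: (boolP (v \in p x)) => vx.
  rewrite (bigD1 x) ?inE //= eqxx big1 // => u /andP[_ ux].
  by rewrite eq_sym (negbTE ux).
by rewrite big1 // => u; rewrite inE => vu; case: eqP vx => // ->; rewrite vu.
Qed.

(** Once all nodes are occupied, the conservation law makes the drivers below v equal to the size of
    the subtree plus the crossings at v, which gives both conditions. That enough drivers fill the
    tree is proved by contradiction at a node left empty. *)
Lemma parking_counts (s : n.-tuple 'I_n) (tau : bool) :
  (if tau then prime_parking_fun (T, s) else parking_fun (T, s)) =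
  enough_drivers e tau (fun u => count_mem u s).
Proof.
have pE : parking_fun (T, s) = (occupied T s == setT) by rewrite /parking_fun /= treeT all_parkE.
have crossE v : occupied T s = setT ->
    \sum_(u in descendants e v) count_mem u s = #|descendants e v| + crossings s v.
  by move=> sT; rewrite -count_pathE count_descendants sT setTI.
have enough_park : enough_drivers e tau (fun u => count_mem u s) -> occupied T s = setT.
  move=> /forallP enough; apply/eqP; rewrite -subTset; apply/subsetP => v _.
  apply: contraT => vocc; have := enough v; rewrite -count_pathE count_descendants.
  (* Only occupied nodes are crossed and nodes never become free again, so a node v that is empty at
     the end is never crossed; the occupied descendants then miss v and are too few. *)
  rewrite /crossings big1 ?addn0 => [|i _]; last first.
    apply/eqP; rewrite eqb0; apply: contra vocc => /crosses_occupied.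
    exact: subsetP (occupied_sub _ _) _.
  move/(leq_trans (leq_addr _ _)); rewrite leqNgt (_ : _ < _ = true) //.
  apply: proper_card; rewrite properE subsetIr /=.
  apply: contra vocc => /subsetP/(_ v); rewrite !inE connect0 => /(_ isT).
  by case/andP.
have crossed : occupied T s = setT -> enough_drivers e tau (fun u => count_mem u s) =
    (tau ==> all_crossed T s).
  move=> sT; case: tau {enough_park} => /=; last first.
    by apply/forallP => v; rewrite crossE // leq_add2l.
  apply: eq_forallb => v; rewrite crossE // leq_add2l -parent_ex.
  case: (parent T v) => [u|] //=; rewrite lt0n sum_nat_eq0 negb_forall size_tuple.
  by apply: eq_existsb => i; rewrite -tnth_nth; case: crosses.
case: tau crossed enough_park => crossed enough_park.
  rewrite /prime_parking_fun pE /=; apply/andP/idP => [[/eqP sT]|enough].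
    by rewrite crossed.
  by have sT := enough_park enough; move: enough; rewrite (crossed sT) sT eqxx.
rewrite pE; apply/eqP/idP => [sT|]; by [rewrite crossed | apply: enough_park].
Qed.

End Parking.

(** * Plane forests with drivers *)

(* Plane forests, as binary trees: [Node v m l r] is a root labelled v, with  *)
(* m drivers, above the forest l, followed by the remaining trees r.          *)
Inductive forest (L : Type) := Leaf | Node of L & nat & forest L & forest L.
Arguments Leaf {L}.

HB.instance Definition _ (L : Type) := gen_eqMixin (forest L).

Section Forests.
Variable L : eqType.
Implicit Types (t l r : forest L) (T : L -> seq L) (D : L -> nat).

Fixpoint labels t : seq L :=
  if t is Node v _ l r then v :: labels l ++ labels r else [::].

Fixpoint roots t : seq L := if t is Node v _ _ r then v :: roots r else [::].

Fixpoint drivers t : nat := if t is Node _ m l r then m + drivers l + drivers r else 0.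

Fixpoint children_in t x : seq L :=
  if t is Node v _ l r then
    if x == v then roots l else
    if x \in labels l then children_in l x else children_in r x
  else [::].

Fixpoint drivers_at t x : nat :=
  if t is Node v m l r then
    if x == v then m else
    if x \in labels l then drivers_at l x else drivers_at r x
  else 0.

(** Rebuilds a forest from its roots [s], the child lists [T] and the driver numbers [D]; [k] is
    fuel, and the number of nodes is enough. *)
Fixpoint grow k T D s : forest L :=
  match k, s with
  | k'.+1, v :: s' => Node v (D v) (grow k' T D (T v)) (grow k' T D s')
  | _, _ => Leaf
  end.

Lemma roots_sub t : {subset roots t <= labels t}.
Proof.
elim: t => // v m l _ r IHr x /=; rewrite !inE mem_cat.
by case/orP => [->//|/IHr->]; rewrite !orbT.
Qed.

Lemma size_roots t : size (roots t) <= size (labels t).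
Proof. by elim: t => //= v m l _ r IHr; rewrite size_cat ltnS; lia. Qed.

Lemma children_in_sub t x : {subset children_in t x <= labels t}.
Proof.
elim: t => //= v m l IHl r IHr u; rewrite inE mem_cat.
case: eqP => _; first by move/roots_sub->; rewrite orbT.
by case: ifP => _ => [/IHl|/IHr] ->; rewrite !orbT.
Qed.

Lemma uniq_node v m l r : uniq (labels (Node v m l r)) ->
  [/\ v \notin labels l, v \notin labels r, uniq (labels l), uniq (labels r) &
      forall x, x \in labels r -> x \notin labels l].
Proof.
rewrite /= mem_cat negb_or cat_uniq => /andP[/andP[vl vr] /and3P[ul /hasPn d ur]].
by split.
Qed.

Lemma mem_labels_left v m l r x : x \in labels l -> x \in labels (Node v m l r).
Proof. by move=> xl; rewrite /= inE mem_cat xl orbT. Qed.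

Lemma mem_labels_right v m l r x : x \in labels r -> x \in labels (Node v m l r).
Proof. by move=> xr; rewrite /= inE mem_cat xr !orbT. Qed.

Lemma children_in_left v m l r x : uniq (labels (Node v m l r)) -> x \in labels l ->
  children_in (Node v m l r) x = children_in l x.
Proof.
move=> /uniq_node[vl _ _ _ _] xl /=; rewrite xl ifF //.
by apply: contraNF vl => /eqP<-.
Qed.

Lemma children_in_right v m l r x : uniq (labels (Node v m l r)) -> x \in labels r ->
  children_in (Node v m l r) x = children_in r x.
Proof.
move=> /uniq_node[_ vr _ _ d] xr /=; rewrite (negbTE (d x xr)) ifF //.
by apply: contraNF vr => /eqP<-.
Qed.

Lemma drivers_at_left v m l r x : uniq (labels (Node v m l r)) -> x \in labels l ->
  drivers_at (Node v m l r) x = drivers_at l x.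
Proof.
move=> /uniq_node[vl _ _ _ _] xl /=; rewrite xl ifF //.
by apply: contraNF vl => /eqP<-.
Qed.

Lemma drivers_at_right v m l r x : uniq (labels (Node v m l r)) -> x \in labels r ->
  drivers_at (Node v m l r) x = drivers_at r x.
Proof.
move=> /uniq_node[_ vr _ _ d] xr /=; rewrite (negbTE (d x xr)) ifF //.
by apply: contraNF vr => /eqP<-.
Qed.

Lemma grow_children_in k T D t : uniq (labels t) -> size (labels t) <= k ->
  (forall x, x \in labels t -> T x = children_in t x) ->
  (forall x, x \in labels t -> D x = drivers_at t x) ->
  grow k T D (roots t) = t.
Proof.
elim: t k => [|v m l IHl r IHr] [|k] // uq lk TE DE.
move: lk; rewrite /= ltnS size_cat => lk.
have [vl vr ul ur d] := uniq_node uq.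
rewrite TE ?mem_head // DE ?mem_head //= eqxx.
rewrite IHl ?IHr ?(leq_trans _ lk) ?leq_addl ?leq_addr // => x xt.
- by rewrite TE ?(children_in_right uq) ?mem_labels_right.
- by rewrite DE ?(drivers_at_right uq) ?mem_labels_right.
- by rewrite TE ?(children_in_left uq) ?mem_labels_left.
- by rewrite DE ?(drivers_at_left uq) ?mem_labels_left.
Qed.

(** The child lists and the list of roots partition the labels. This is what makes the child
    relation of a one-rooted forest satisfy [is_tree]. *)
Lemma perm_children_in t : uniq (labels t) ->
  perm_eq (labels t) (roots t ++ flatten [seq children_in t v | v <- labels t]).
Proof.
elim: t => // v m l IHl r IHr uq; have [_ _ ul ur _] := uniq_node uq.
have EL : [seq children_in (Node v m l r) x | x <- labels l] =
          [seq children_in l x | x <- labels l].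
  by apply/eq_in_map => x xl; apply: children_in_left.
have ER : [seq children_in (Node v m l r) x | x <- labels r] =
          [seq children_in r x | x <- labels r].
  by apply/eq_in_map => x xr; apply: children_in_right.
rewrite [labels (Node _ _ _ _)]/= map_cons map_cat EL ER [roots _]/= cat_cons perm_cons.
have -> : children_in (Node v m l r) v = roots l by rewrite /= eqxx.
apply/permP => a; rewrite /= flatten_cat !count_cat.
rewrite (permP (IHl ul)) (permP (IHr ur)) !count_cat; lia.
Qed.

Lemma roots_grow k T D s : size s <= k -> roots (grow k T D s) = s.
Proof. by elim: k s => [|k IHk] [|v s] //= sk; rewrite IHk. Qed.

(** The roots also carry the extra [tau]: the forest is meant to hang below a further node, where
    its roots are no roots any more. *)
Fixpoint excess_ok (tau : bool) t : bool :=
  if t is Node v m l r then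
    [&& (size (labels l)).+1 + tau <= m + drivers l, excess_ok tau l & excess_ok tau r]
  else true.

Lemma excess_ok_le tau t : excess_ok tau t -> size (labels t) <= drivers t.
Proof.
by elim: t => //= v m l IHl r IHr /and3P[h /IHl hl /IHr hr]; rewrite size_cat; lia.
Qed.

Lemma drivers_sum t : uniq (labels t) -> drivers t = \sum_(x <- labels t) drivers_at t x.
Proof.
elim: t => [|v m l IHl r IHr] uq; first by rewrite big_nil.
have [vl vr ul ur _] := uniq_node uq.
rewrite [labels _]/= [drivers _]/= big_cons big_cat [drivers_at _ v]/= eqxx IHl // IHr // addnA.
congr (_ + _ + _).
  by apply: eq_big_seq => x xl; rewrite -(drivers_at_left uq xl).
by apply: eq_big_seq => x xr; rewrite -(drivers_at_right uq xr).
Qed.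

End Forests.

Lemma forest_connect (L : finType) (e : rel L) (t : forest L) :
  uniq (labels t) ->
  (forall v u, v \in labels t -> u \in children_in t v -> e v u) ->
  forall x, x \in labels t -> exists2 r, r \in roots t & connect e r x.
Proof.
elim: t => // v m l IHl r IHr uq eP x; rewrite inE mem_cat.
have [_ _ ul ur _] := uniq_node uq.
case/or3P => [/eqP->|xl|xr].
- by exists v; rewrite ?mem_head ?connect0.
- have [|u url ux] := IHl ul _ x xl.
    move=> w u wl uw; apply: eP; first exact: mem_labels_left.
    by rewrite children_in_left.
  exists v; first exact: mem_head.
  apply: connect_trans ux; apply: connect1; apply: eP; first exact: mem_head.
  by rewrite /= eqxx.
have [|u url ux] := IHr ur _ x xr.
  move=> w u wr uw; apply: eP; first exact: mem_labels_right.
  by rewrite children_in_right.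
by exists u => //; rewrite inE url orbT.
Qed.

Section OnOrdinals.
Variable n : nat.
Implicit Types (t l r : forest 'I_n) (e : rel 'I_n).

Definition agrees e t := forall v u, v \in labels t -> e v u = (u \in children_in t v).

Lemma agrees_left e v m l r : uniq (labels (Node v m l r)) ->
  agrees e (Node v m l r) -> agrees e l.
Proof.
move=> uq et x u xl; rewrite et; first by rewrite (children_in_left uq).
exact: mem_labels_left.
Qed.

Lemma agrees_right e v m l r : uniq (labels (Node v m l r)) ->
  agrees e (Node v m l r) -> agrees e r.
Proof.
move=> uq et x u xl; rewrite et; first by rewrite (children_in_right uq).
exact: mem_labels_right.
Qed.

Lemma descendants_node e v m l r : uniq (labels (Node v m l r)) ->
  agrees e (Node v m l r) -> descendants e v =i v :: labels l.
Proof.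
move=> uq et x; rewrite inE; have [_ _ ul _ _] := uniq_node uq.
have ev u : e v u = (u \in roots l) by rewrite et ?mem_head //= eqxx.
apply/idP/idP; last first.
  rewrite inE => /orP[/eqP->|xl]; first exact: connect0.
  have [|u ur ux] := forest_connect (e := e) ul _ xl.
    by move=> w u wl; rewrite (agrees_left uq et).
  by apply: connect_trans ux; apply: connect1; rewrite ev.
case/connectP => q vq ->; elim/last_ind: q vq => [|q w IHq]; first by rewrite mem_head.
rewrite rcons_path last_rcons => /andP[/IHq]; rewrite !inE => /orP[/eqP->|ql].
  by rewrite ev => /roots_sub->; rewrite orbT.
by rewrite (agrees_left uq et) // => /children_in_sub->; rewrite orbT.
Qed.

Lemma big_descendants_node e v m l r (f : 'I_n -> nat) : uniq (labels (Node v m l r)) ->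
  agrees e (Node v m l r) -> \sum_(u in descendants e v) f u = f v + \sum_(u <- labels l) f u.
Proof.
move=> uq et; have [vl _ ul _ _] := uniq_node uq.
transitivity (\sum_(u in v :: labels l) f u).
  by apply: eq_bigl => u; rewrite (descendants_node uq et).
by rewrite -big_uniq /= ?vl // big_cons.
Qed.

(** Ties the recursive condition to the one on subtrees: the subtree of a node [Node v m l r]
    consists of v and the labels of [l], while [r] holds its right siblings. *)
Lemma excess_okP e tau t : uniq (labels t) -> agrees e t ->
  excess_ok tau t = all (fun v =>
    #|descendants e v| + tau <= \sum_(u in descendants e v) drivers_at t u) (labels t).
Proof.
elim: t => // v m l IHl r IHr uq et; have [vl _ ul ur _] := uniq_node uq.
have cardE : #|descendants e v| = (size (labels l)).+1.
  by rewrite -sum1_card (big_descendants_node _ uq et) sum1_size.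
have desc_sub s x : uniq (labels s) -> agrees e s -> x \in labels s ->
   {subset descendants e x <= labels s}.
  move=> us es xs y; rewrite inE => /connectP[q xq ->]; elim/last_ind: q xq => //= q w IHq.
  by rewrite rcons_path last_rcons => /andP[/IHq qs]; rewrite es // => /children_in_sub.
have drE : \sum_(u in descendants e v) drivers_at (Node v m l r) u = m + drivers l.
  rewrite (big_descendants_node _ uq et) [drivers_at _ v]/= eqxx drivers_sum //; congr (_ + _).
  by apply: eq_big_seq => x xl; rewrite -(drivers_at_left uq xl).
have el := agrees_left uq et; have er := agrees_right uq et.
set a := (X in all X _); rewrite /= all_cat IHl // IHr // {1}/a drE cardE.
congr [&& _, _ & _]; apply: eq_in_all => x xt; rewrite /a; congr (_ <= _); apply: eq_bigr => u.
  by move=> /(desc_sub _ _ ul el xt) ut; rewrite (drivers_at_left uq).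
by move=> /(desc_sub _ _ ur er xt) ut; rewrite (drivers_at_right uq).
Qed.

End OnOrdinals.

(** * Enumeration of ordered trees *)

Lemma flatten_map_uniq (I J : eqType) (f : I -> seq J) (s : seq I) :
  uniq s -> {in s, forall i, uniq (f i)} ->
  (forall i j x, i \in s -> j \in s -> x \in f i -> x \in f j -> i = j) ->
  uniq (flatten [seq f i | i <- s]).
Proof.
elim: s => //= k s IHs /andP[ks us] uf disj; rewrite cat_uniq uf ?mem_head //=.
apply/andP; split; last first.
  by apply: IHs => // [i si|i j x si sj]; [apply: uf | apply: disj]; rewrite inE ?si ?sj orbT.
apply/hasPn => x /flatten_mapP[i si xi]; apply: contra ks => xk.
by rewrite (disj k i x) ?mem_head // inE si orbT.
Qed.

Lemma root_unique (F : tree_family) n (T : pretree F n) v w : is_tree T ->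
  v \notin all_children T -> w \notin all_children T -> v = w.
Proof.
case/andP=> _ /existsP[r /andP[_ /forallP rC]].
suff root u : u \notin all_children T -> r = u by move=> /root<- /root<-.
move=> uN; have /connectP[q] := rC u.
case/lastP: q => // q x; rewrite rcons_path last_rcons => /andP[_ rx] ux.
case/negP: uN; rewrite all_children_mem; apply/existsP; exists (last r q).
by rewrite ux.
Qed.

(** A subtree is its root together with the disjoint subtrees of the children. They are disjoint
    because two ancestors of the same node are comparable, whereas distinct siblings are not. *)
Lemma perm_descendants (F : tree_family) n (T : pretree F n) v : is_tree T ->
  perm_eq (enum (descendants (is_child T) v))
    (v :: flatten [seq enum (descendants (is_child T) c) | c <- children (T v)]).
Proof.
move=> treeT; set e := is_child T; pose p := path_to_root T.
have mem_desc x y : (y \in descendants e x) = (x \in p y) by rewrite (descendantsE treeT) inE.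
have pE c : e v c -> p c = c :: p v.
  by rewrite /e -(parentE treeT) /p (path_to_rootE treeT) => /eqP->.
have cNv c : e v c -> c \notin p v.
  by move=> vc; have := path_to_root_uniq treeT c; rewrite -/(p c) pE // => /andP[].
have uc : uniq (children (T v)).
  have [+ _] := andP treeT; rewrite /all_children; elim: (enum _) (mem_enum 'I_n v) => //= w s IHs.
  by rewrite inE cat_uniq => /orP[/eqP->|vs] /and3P[] // _ _ us; apply: IHs.
have sib c c' x : e v c -> e v c' -> c \in p x -> c' \in p x -> c \in p c' -> c = c'.
  by move=> vc vc' _ _; rewrite (pE c' vc') inE (negbTE (cNv c vc)) orbF => /eqP.
apply: uniq_perm; first exact: enum_uniq.
  rewrite cons_uniq; apply/andP; split.
    apply/flatten_mapP => -[c vc]; rewrite mem_enum mem_desc.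
    by apply/negP; apply: cNv.
  apply: flatten_map_uniq => // [c _|c c' x vc vc']; first exact: enum_uniq.
  rewrite !mem_enum !mem_desc => cx c'x.
  have /orP[ii|ii] := leq_total (index c (p x)) (index c' (p x)).
    by symmetry; apply: (sib c' c x) => //; rewrite (path_to_root_index treeT c'x cx).
  by apply: (sib c c' x) => //; rewrite (path_to_root_index treeT cx c'x).
move=> x; rewrite mem_enum [in LHS]inE in_cons.
apply/connectP/orP => [[q]|[/eqP->|/flatten_mapP[c vc]]].
- case: q => [_ ->|c q /= /andP[vc cq] xE]; first by left.
  right; apply/flatten_mapP; exists c => //; rewrite mem_enum inE.
  by apply/connectP; exists q.
- by exists [::].
rewrite mem_enum inE => cx; apply/connectP; apply: connect_trans cx; exact: connect1.
Qed.

Section Enumeration.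
Variable n : nat.
Implicit Types (t l r : forest 'I_n) (A : {set 'I_n}).

(** With n drivers in all, no node has more than n of them; the bound makes the enumeration
    finite. *)
Fixpoint small t : bool :=
  if t is Node _ m l r then [&& m < n.+1, small l & small r] else true.

(** A nonempty forest on [A] is given by the label v of its first root, the set C of the labels
    below v, the number of drivers at v, a forest on C and a forest on the remaining labels. The
    fuel [k] has to be at least the size of [A]. *)
Fixpoint forests_on (k : nat) A : seq (forest 'I_n) :=
  if k is k'.+1 then
    if A == set0 then [:: Leaf] else
    flatten [seq [seq Node i.1.1 i.2 p.1 p.2 | p <-
        [seq (l, r) | l <- forests_on k' i.1.2, r <- forests_on k' (A :\ i.1.1 :\: i.1.2)]]
      | i : 'I_n * {set 'I_n} * 'I_n.+1 <- enum [pred i : 'I_n * {set 'I_n} * 'I_n.+1 |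
                   (i.1.1 \in A) && (i.1.2 \subset A :\ i.1.1)]]
  else [:: Leaf].

Definition trees_on_all : seq (forest 'I_n) :=
  flatten [seq [seq Node i.1 i.2 l Leaf | l <- forests_on n [set~ i.1]]
    | i : 'I_n * 'I_n.+1 <- enum {: 'I_n * 'I_n.+1}].

Lemma card_split A v (C : {set 'I_n}) k : #|A| <= k.+1 -> v \in A -> C \subset A :\ v ->
  (#|C| <= k) /\ (#|A :\ v :\: C| <= k).
Proof.
move=> Ak vA CA; move: (cardsD1 v A) (subset_leq_card CA) (subset_leq_card (subsetDl (A :\ v) C)).
by rewrite vA; lia.
Qed.

Lemma mem_forests_on k A t : #|A| <= k ->
  (t \in forests_on k A) = [&& uniq (labels t), [set x in labels t] == A & small t].
Proof.
have leafE A0 : #|A0| = 0 -> forall t, (t \in [:: Leaf]) =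
    [&& uniq (labels t), [set x in labels t] == A0 & small t].
  move=> /cards0_eq-> {}t; rewrite mem_seq1; apply/eqP/and3P => [->|[_ /eqP t0 _]].
    by split=> //; apply/eqP/setP => x; rewrite !inE.
  by case: t t0 => // v m l r /setP/(_ v); rewrite !inE eqxx.
elim: k A t => [|k IHk] A t Ak.
  by apply: leafE; apply/eqP; rewrite -leqn0.
rewrite /=; case: eqVneq => [A0|A0]; first by rewrite -(leafE A) // A0 cards0.
apply/flatten_mapP/and3P => [[[[v C] m]]|].
  rewrite mem_enum inE /= => /andP[vA CA] /mapP[[l r] /allpairsP[[l' r'] /=]].
  have [Ck Dk] := card_split Ak vA CA.
  rewrite !IHk // => -[/and3P[ul /eqP lC sl] /and3P[ur /eqP rD sr] [-> ->]] -> /=.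
  have lE x : (x \in labels l') = (x \in C) by rewrite -lC inE.
  have rE x : (x \in labels r') = (x \in A :\ v :\: C) by rewrite -rD inE.
  have vC : v \notin C by apply/negP => /(subsetP CA); rewrite !inE eqxx.
  split; last by rewrite ltn_ord sl.
    rewrite mem_cat lE rE cat_uniq ul ur (negbTE vC) !inE eqxx andbF /=.
    by rewrite andbT; apply/hasPn => x; rewrite rE inE => /andP[xC _]; rewrite /= lE.
  apply/eqP/setP => x; rewrite !inE mem_cat lE rE !inE.
  case: eqVneq => [->|xv] /=; first by rewrite vA.
  by case: (boolP (x \in C)) => //= /(subsetP CA); rewrite !inE => /andP[_ ->].
case: t => [|v m l r] [uq /eqP tA].
  by case/eqP: A0; rewrite -tA; apply/setP => x; rewrite !inE.
case/and3P => mn sl sr; have [vl vr ul ur d] := uniq_node uq.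
have vA : v \in A by rewrite -tA !inE eqxx.
have CA : [set x in labels l] \subset A :\ v.
  apply/subsetP => x; rewrite -tA !inE mem_cat => xl; rewrite xl orbT andbT.
  by apply: contraNneq vl => <-.
exists (v, [set x in labels l], Ordinal mn); first by rewrite mem_enum inE /= vA.
have [Ck Dk] := card_split Ak vA CA.
apply/mapP; exists (l, r) => //; apply/allpairsP; exists (l, r); split=> //=.
  by rewrite IHk // ul eqxx.
rewrite IHk //; apply/and3P; split=> //; apply/eqP/setP => x; rewrite -tA !inE mem_cat.
case: (boolP (x \in labels l)) => [xl|xl] /=.
  by apply/negP => /d; rewrite xl.
case: eqVneq => [->|_] //=; exact: negbTE.
Qed.

Lemma forests_on_uniq k A : #|A| <= k -> uniq (forests_on k A).
Proof.
elim: k A => // k IHk A Ak /=; case: eqP => // _.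
apply: flatten_map_uniq; first exact: enum_uniq.
  case=> [[v C] m]; rewrite mem_enum inE /= => /andP[vA CA].
  have [Ck Dk] := card_split Ak vA CA.
  rewrite map_inj_uniq; last by case=> [l r] [l' r'] [-> ->].
  by apply: allpairs_uniq; rewrite ?IHk // => -[? ?] [? ?].
case=> [[v C] m] [[v' C'] m'] t; rewrite !mem_enum !inE /= => /andP[vA CA] /andP[vA' CA'].
case/mapP => -[l r] /allpairsP[[l1 r1] [/= l1C _ [-> ->]]] ->.
case/mapP => -[l' r'] /allpairsP[[l2 r2] [/= l2C _ [-> ->]]] [-> mm ll _].
have [Ck _] := card_split Ak vA CA; have [Ck' _] := card_split Ak vA' CA'.
move: l1C l2C; rewrite !mem_forests_on // ll => /and3P[_ /eqP<- _] /and3P[_ /eqP<- _].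
by congr (_, _, _); apply: val_inj.
Qed.

Lemma mem_trees_on_all t : (t \in trees_on_all) =
  [&& uniq (labels t), [set x in labels t] == setT, size (roots t) == 1 & small t].
Proof.
have cv v : #|[set~ v] : {set 'I_n}| <= n by rewrite -[X in _ <= X]card_ord max_card.
apply/flatten_mapP/and4P => [[[v m] _ /mapP[l]]|].
  rewrite mem_forests_on //= => /and3P[ul /eqP lE sl] ->.
  have lE' x : (x \in labels l) = (x != v) by have := in_set (mem (labels l)) x; rewrite lE !inE.
  split=> //=; rewrite ?cats0 ?ul ?lE' ?eqxx ?ltn_ord ?sl //.
  by apply/eqP/setP => x; rewrite !inE lE' orbN.
case: t => [|v m l [|? ? ? ?]]; [by case | | by case].
case=> uq /eqP tT _ /= /and3P[mn sl _].
exists (v, Ordinal mn); first by rewrite mem_enum.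
have [vl _ ul _ _] := uniq_node uq.
apply/mapP; exists l => //; rewrite mem_forests_on // ul sl andbT /=.
apply/eqP/setP => x; move/setP/(_ x): tT; rewrite !inE /= cats0.
by case: eqVneq => [->|_] //=; rewrite (negbTE vl).
Qed.

Lemma trees_on_all_uniq : uniq trees_on_all.
Proof.
have cv v : #|[set~ v] : {set 'I_n}| <= n by rewrite -[X in _ <= X]card_ord max_card.
apply: flatten_map_uniq; first exact: enum_uniq.
  by move=> i _; rewrite map_inj_uniq ?forests_on_uniq // => l l' [].
move=> [v m] [v' m'] t _ _ /mapP[l _ ->] /mapP[l' _] [-> mm _].
by congr (_, _); apply: val_inj.
Qed.

Lemma labels_all t : t \in trees_on_all -> perm_eq (labels t) (enum 'I_n).
Proof.
rewrite mem_trees_on_all => /and4P[uq /eqP tT _ _].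
apply: uniq_perm; rewrite ?enum_uniq // => x; rewrite mem_enum.
by have := in_setT x; rewrite -tT inE => ->.
Qed.

Definition tree_of (t : forest 'I_n) : pretree ordered n :=
  [ffun v => insub_bseq n (children_in t v)].

Definition drivers_of (t : forest 'I_n) : {ffun 'I_n -> 'I_n.+1} :=
  [ffun v => inord (drivers_at t v)].

Lemma size_children_in t v : size (children_in t v) <= size (labels t).
Proof.
elim: t => //= w m l IHl r IHr; rewrite size_cat; case: eqP => _.
  by apply: leq_trans (size_roots l) _; rewrite leqW ?leq_addr.
by case: ifP => _; [apply: leq_trans IHl _ | apply: leq_trans IHr _]; rewrite leqW ?leq_addr ?leq_addl.
Qed.

Lemma tree_ofE t v : t \in trees_on_all -> children (tree_of t v) = children_in t v.
Proof.
move=> /labels_all/perm_size; rewrite size_enum_ord => tn.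
rewrite /= ffunE /insub_bseq /insubd insubT //; last by rewrite -[X in _ <= X]tn size_children_in.
Qed.

Lemma drivers_ofE t v : t \in trees_on_all -> drivers_of t v = drivers_at t v :> nat.
Proof.
rewrite mem_trees_on_all => /and4P[_ _ _ st]; rewrite ffunE inordK //.
elim: t st => //= w m l IHl r IHr /and3P[mn /IHl hl /IHr hr].
by case: ifP => // _; case: ifP.
Qed.

Lemma tree_of_agrees t : t \in trees_on_all -> agrees (is_child (tree_of t)) t.
Proof. by move=> tA v u _; rewrite /is_child tree_ofE. Qed.

Lemma tree_of_is_tree t : t \in trees_on_all -> is_tree (tree_of t).
Proof.
move=> tA; have := tA; rewrite mem_trees_on_all => /and4P[uq /eqP tT rt st].
have allE : all_children (tree_of t) = flatten [seq children_in t v | v <- enum 'I_n].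
  by congr flatten; apply: eq_map => v; rewrite tree_ofE.
have pE : perm_eq (labels t) (roots t ++ all_children (tree_of t)).
  rewrite allE; apply: perm_trans (perm_children_in uq) _; rewrite perm_cat2l.
  by apply: perm_flatten; apply: perm_map; apply: labels_all.
have := perm_uniq pE; rewrite uq cat_uniq => /esym/and3P[_ /hasPn d uc].
rewrite /is_tree uc /=; case: t tA tT uq {allE pE} rt d uc {st} => [|v m l [|? ? ? ?]] // tA tT uq _ d uc.
apply/existsP; exists v; apply/andP; split.
  by apply/negP => /d /=; rewrite mem_head.
apply/forallP => x; have xt : x \in labels (Node v m l Leaf).
  by have := in_setT x; rewrite -tT inE.
have [|u] := forest_connect (e := is_child (tree_of (Node v m l Leaf))) uq _ xt.
  by move=> w u wt; rewrite (tree_of_agrees tA).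
by rewrite mem_seq1 => /eqP->.
Qed.

(** The forest is recovered by [grow] from the child lists, the driver numbers and its root, and the
    root is the only node that is nobody's child. *)
Lemma tree_of_inj t t' : t \in trees_on_all -> t' \in trees_on_all ->
  (tree_of t, drivers_of t) = (tree_of t', drivers_of t') -> t = t'.
Proof.
move=> tA t'A [TE DE].
have growE s : s \in trees_on_all -> size (roots s) = 1 /\
    grow n (fun v => children (tree_of s v)) (fun v => drivers_of s v) (roots s) = s.
  move=> sA; have := sA; rewrite mem_trees_on_all => /and4P[uq _ /eqP rs _]; split=> //.
  apply: grow_children_in => //; first by rewrite (perm_size (labels_all sA)) size_enum_ord.
    by move=> x _; rewrite tree_ofE.
  by move=> x _; rewrite drivers_ofE.
have [rt gt] := growE _ tA; have [rt' gt'] := growE _ t'A.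
suff rE : roots t = roots t' by rewrite -gt -gt' TE DE rE.
have rootE s : s \in trees_on_all -> forall v, v \in roots s -> v \notin all_children (tree_of s).
  move=> sA v vs; have := sA; rewrite mem_trees_on_all => /and4P[uq _ _ _].
  have : perm_eq (labels s) (roots s ++ all_children (tree_of s)).
    apply: perm_trans (perm_children_in uq) _; rewrite perm_cat2l.
    rewrite (_ : all_children _ = flatten [seq children_in s v | v <- enum 'I_n]).
      by apply: perm_flatten; apply: perm_map; apply: labels_all.
    by congr flatten; apply: eq_map => w; rewrite tree_ofE.
  move/perm_uniq; rewrite uq cat_uniq => /esym/and3P[_ /hasPn d _].
  by apply/negP => /d /=; rewrite vs.
case: t t' rt rt' {TE DE gt gt'} tA t'A => [|v m l [|//]] [|v' m' l' [|//]] // _ _ tA t'A /= in TE *.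
congr [:: _]; apply: (root_unique (tree_of_is_tree tA)).
  by apply: rootE => //; rewrite /= mem_head.
by rewrite TE; apply: rootE => //; rewrite /= mem_head.
Qed.


Lemma labels_grow (T : pretree ordered n) D k s : is_tree T ->
  size (flatten [seq enum (descendants (is_child T) v) | v <- s]) <= k ->
  perm_eq (labels (grow k (fun v => children (T v)) D s))
    (flatten [seq enum (descendants (is_child T) v) | v <- s]).
Proof.
move=> treeT; elim: k s => [|k IHk] [|v s] //=.
  rewrite size_cat (perm_size (perm_descendants v treeT)) //.
rewrite size_cat (perm_size (perm_descendants v treeT)) /= addSn ltnS => sk.
rewrite perm_sym; apply: perm_trans (perm_cat (perm_descendants v treeT) (perm_refl _)) _.
rewrite cat_cons perm_cons perm_sym; apply: perm_cat; apply: IHk.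
  exact: leq_trans (leq_addr _ _) sk.
exact: leq_trans (leq_addl _ _) sk.
Qed.

Lemma size_le_descendants (T : pretree ordered n) s :
  size s <= size (flatten [seq enum (descendants (is_child T) v) | v <- s]).
Proof.
elim: s => //= v s IHs; rewrite size_cat -addn1 addnC leq_add // -cardE.
by apply/card_gt0P; exists v; rewrite inE connect0.
Qed.

Lemma grow_at (T : pretree ordered n) D k s x : is_tree T ->
  size (flatten [seq enum (descendants (is_child T) v) | v <- s]) <= k ->
  x \in labels (grow k (fun v => children (T v)) D s) ->
  children_in (grow k (fun v => children (T v)) D s) x = children (T x) /\
  drivers_at (grow k (fun v => children (T v)) D s) x = D x.
Proof.
move=> treeT; elim: k s => [|k IHk] [|v s] //=.
rewrite size_cat (perm_size (perm_descendants v treeT)) /= addSn ltnS => sk.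
have sk1 := leq_trans (leq_addr _ _) sk; have sk2 := leq_trans (leq_addl _ _) sk.
rewrite inE mem_cat; case: eqVneq => [-> _|xv] /=.
  by rewrite roots_grow // (leq_trans (size_le_descendants T _) sk1).
by case: ifP => [xl _|_ /= xr]; apply: IHk.
Qed.

Lemma small_grow k T (D : {ffun 'I_n -> 'I_n.+1}) s : small (grow k T (fun v => D v : nat) s).
Proof. by elim: k s => //= k IHk [|v s] //=; rewrite ltn_ord !IHk. Qed.

(** The preimage is grown from the root of [T]. All nodes descend from the root, so each appears
    exactly once. *)
Lemma tree_of_surj (T : pretree ordered n) (D : {ffun 'I_n -> 'I_n.+1}) : is_tree T ->
  exists2 t, t \in trees_on_all & (T, D) = (tree_of t, drivers_of t).
Proof.
move=> treeT; have [_ /existsP[r /andP[_ /forallP rC]]] := andP treeT.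
have dr : descendants (is_child T) r = setT by apply/setP => x; rewrite !inE rC.
have sz : size (flatten [seq enum (descendants (is_child T) v) | v <- [:: r]]) <= n.
  by rewrite /= cats0 dr -cardE cardsT card_ord.
pose t := grow n (fun v => children (T v)) (fun v => D v : nat) [:: r].
have lt : perm_eq (labels t) (enum 'I_n).
  apply: perm_trans (labels_grow _ treeT sz) _; rewrite /= cats0 dr.
  by apply: uniq_perm; rewrite ?enum_uniq // => x; rewrite !mem_enum !inE.
have lx x : x \in labels t by rewrite (perm_mem lt) mem_enum.
have tE x : children_in t x = children (T x) by have [] := grow_at treeT sz (lx x).
have DE x : drivers_at t x = D x by have [] := grow_at treeT sz (lx x).
have n0 : 0 < n := leq_ltn_trans (leq0n r) (ltn_ord r).
have tA : t \in trees_on_all.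
  rewrite mem_trees_on_all (perm_uniq lt) enum_uniq roots_grow // eqxx /=.
  apply/andP; split; first by apply/eqP/setP => x; rewrite !inE lx.
  exact: small_grow.
exists t => //; congr (_, _); apply/ffunP => v.
  by apply: val_inj; have := tree_ofE v tA; rewrite /= => ->; rewrite tE.
by apply: val_inj; rewrite /= drivers_ofE // DE.
Qed.

Lemma big_trees (R : nmodType) (g : pretree ordered n -> {ffun 'I_n -> 'I_n.+1} -> R) :
  (\sum_(T : pretree ordered n | is_tree T) \sum_D g T D =
   \sum_(t <- trees_on_all) g (tree_of t) (drivers_of t))%R.
Proof.
rewrite pair_big_dep /= -big_filter.
rewrite -(big_map (fun t => (tree_of t, drivers_of t)) xpredT (fun p => g p.1 p.2)).
apply: perm_big; apply: uniq_perm.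
- by rewrite filter_uniq ?index_enum_uniq.
- rewrite map_inj_in_uniq ?trees_on_all_uniq // => t t'; exact: tree_of_inj.
move=> [T D]; rewrite mem_filter mem_index_enum andbT /= andbT.
apply/idP/mapP => [/tree_of_surj-/(_ D)//|[t tA [-> _]]].
exact: tree_of_is_tree.
Qed.

End Enumeration.

Local Open Scope ring_scope.
Local Open Scope fps_scope.

(** * Power series *)

Definition eqm (n : nat) (f g : fps) := forall i, (i < n)%N -> fcoef f i = fcoef g i.

Lemma eqmP f g : (forall n, eqm n f g) -> f = g.
Proof. by move=> fg; apply: fpsP => n; apply: (fg n.+1). Qed.

Lemma eqm_refl n f : eqm n f f. Proof. by []. Qed.

Lemma eqm_eq n f g : f = g -> eqm n f g. Proof. by move=> ->. Qed.

Lemma eqm_sym n f g : eqm n f g -> eqm n g f.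
Proof. by move=> fg i /fg. Qed.

Lemma eqm_trans n g f h : eqm n f g -> eqm n g h -> eqm n f h.
Proof. by move=> fg gh i ni; rewrite fg ?gh. Qed.

Lemma eqm_le m n f g : (m <= n)%N -> eqm n f g -> eqm m f g.
Proof. by move=> mn fg i im; apply: fg; apply: leq_trans mn. Qed.

Lemma eqmD n f f' g g' : eqm n f f' -> eqm n g g' -> eqm n (f + g) (f' + g').
Proof. by move=> ff gg i ni; rewrite !fcoefD ff ?gg. Qed.

Lemma eqmN n f f' : eqm n f f' -> eqm n (- f) (- f').
Proof. by move=> ff i ni; rewrite !fcoefN ff. Qed.

Lemma eqmB n f f' g g' : eqm n f f' -> eqm n g g' -> eqm n (f - g) (f' - g').
Proof. by move=> ff gg; apply: eqmD => //; apply: eqmN. Qed.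

Lemma eqmM n f f' g g' : eqm n f f' -> eqm n g g' -> eqm n (f * g) (f' * g').
Proof.
move=> ff gg i ni; rewrite !fcoefM; apply: eq_bigr => j _; rewrite ff ?gg //.
  by apply: leq_ltn_trans ni; apply: leq_subr.
by apply: leq_trans ni; rewrite ltnS -ltnS.
Qed.

Lemma eqmXn n k f f' : eqm n f f' -> eqm n (f ^+ k) (f' ^+ k).
Proof. by move=> ff; elim: k => [|k IHk] //; rewrite !exprS; apply: eqmM. Qed.

Lemma eqm_sum n (I : Type) (r : seq I) (p : pred I) (F F' : I -> fps) :
  (forall i, p i -> eqm n (F i) (F' i)) ->
  eqm n (\sum_(i <- r | p i) F i) (\sum_(i <- r | p i) F' i).
Proof.
by move=> FF i ni; rewrite !fcoef_sum; apply: eq_bigr => k /FF; apply.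
Qed.

Lemma fcoef_XM0 f : fcoef (fpsX * f) 0 = 0.
Proof. by rewrite fcoefM big_ord1 mul0r. Qed.

Lemma fcoef_XMS f n : fcoef (fpsX * f) n.+1 = fcoef f n.
Proof.
rewrite fcoefM big_ord_recl mul0r add0r big_ord_recl /= mul1r subSS subn0.
by rewrite big1 ?addr0 // => i _; rewrite mul0r.
Qed.

Lemma fcoef_Xn k m : fcoef (fpsX ^+ k) m = (m == k)%:R.
Proof.
elim: k m => [|k IHk] m; first by rewrite expr0 fcoef1.
by rewrite exprS; case: m => [|m]; rewrite ?fcoef_XM0 // fcoef_XMS IHk.
Qed.

Lemma fpsX_inj f g : fpsX * f = fpsX * g -> f = g.
Proof. by move=> fg; apply: fpsP => n; rewrite -[LHS]fcoef_XMS -[RHS]fcoef_XMS fg. Qed.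

Lemma eqm_XM n f g : eqm n f g -> eqm n.+1 (fpsX * f) (fpsX * g).
Proof.
by move=> fg [|i] ni; rewrite ?fcoef_XM0 // !fcoef_XMS fg.
Qed.

Lemma fcoef0M f g : fcoef (f * g) 0 = fcoef f 0 * fcoef g 0.
Proof. by rewrite fcoefM big_ord1. Qed.

Lemma fcoef0X f n : fcoef (f ^+ n) 0 = fcoef f 0 ^+ n.
Proof. by elim: n => [|n IHn]; rewrite ?expr0 // !exprS fcoef0M IHn. Qed.

Lemma fcoef_constM a f n : fcoef (fps_const a * f) n = a * fcoef f n.
Proof.
rewrite fcoefM big_ord_recl /= subn0 big1 ?addr0 // => i _.
by rewrite mul0r.
Qed.

Fact fps_const_is_additive : {morph fps_const : a b / a - b}.
Proof.
by move=> a b; apply: fpsP => n; rewrite fcoefD fcoefN /=; case: eqP; rewrite ?subr0.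
Qed.

Fact fps_const_is_multiplicative : {morph fps_const : a b / a * b} * (fps_const 1 = 1).
Proof.
split=> // a b; apply: fpsP => n; rewrite fcoef_constM /=.
by case: eqP; rewrite ?mulr0.
Qed.

HB.instance Definition _ :=
  GRing.isZmodMorphism.Build rat fps fps_const fps_const_is_additive.
HB.instance Definition _ :=
  GRing.isMonoidMorphism.Build rat fps fps_const
    (fps_const_is_multiplicative.2, fps_const_is_multiplicative.1).

Lemma fps_natE n : n%:R = fps_const n%:R :> fps.
Proof. by rewrite rmorph_nat. Qed.

Lemma fps_unitE (f : fps) : (f \is a GRing.unit) = (fcoef f 0 != 0).
Proof. by []. Qed.

(* Sum of the series with coefficients alpha k, which may themselves depend   *)
(* on the variable; meaningful when y has zero constant term.                 *)
Definition gsum (alpha : nat -> fps) (y : fps) : fps :=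
  Fps (fun n => \sum_(k < n.+1) fcoef (alpha k * y ^+ k) n).

Lemma fcoef_gsum alpha y n :
  fcoef (gsum alpha y) n = \sum_(k < n.+1) fcoef (alpha k * y ^+ k) n.
Proof. by []. Qed.

Lemma fcoef_comp f y n :
  fcoef (fps_comp f y) n = \sum_(k < n.+1) fcoef f k * fcoef (y ^+ k) n.
Proof. by []. Qed.

Lemma fcoefMX_small (a y : fps) k n :
  fcoef y 0 = 0 -> (n < k)%N -> fcoef (a * y ^+ k) n = 0.
Proof.
move=> y0 nk; rewrite fcoefM big1 // => i _.
rewrite (@fcoefX_small y) ?mulr0 //; apply: leq_ltn_trans nk.
exact: leq_subr.
Qed.

(** The bridge to polynomials: modulo z^n only the first n coefficients of an infinite sum count, so
    identities such as [gsumM] are inherited from evaluation of polynomials. *)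
Lemma gsum_horner n (p : {poly fps}) alpha y : fcoef y 0 = 0 ->
  (forall k, (k < n)%N -> p`_k = alpha k) -> eqm n (gsum alpha y) p.[y].
Proof.
move=> y0 pE i ni.
rewrite (@horner_coef_wide _ (maxn (size p) n)) ?leq_maxl // fcoef_sum.
have le : (i.+1 <= maxn (size p) n)%N by rewrite leq_max ni orbT.
rewrite [LHS]/= (big_ord_widen _ (fun k => fcoef (alpha k * y ^+ k) i) le).
rewrite big_mkcond; apply: eq_bigr => k _.
case: ifP => [|/negbT] ki; first by rewrite pE // (leq_ltn_trans _ ni).
by rewrite fcoefMX_small // ltnNge -ltnS.
Qed.

Definition conv (R : nzRingType) (a b : nat -> R) (n : nat) : R :=
  \sum_(i < n.+1) a i * b (n - i)%N.

Lemma gsumM a b y : fcoef y 0 = 0 ->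
  gsum (conv a b) y = gsum a y * gsum b y.
Proof.
move=> y0; apply: eqmP => n.
pose p := \poly_(k < n) a k; pose q := \poly_(k < n) b k.
apply: (@eqm_trans _ (p * q).[y]).
  apply: gsum_horner => // k kn; rewrite coefM; apply: eq_bigr => i _.
  rewrite !coef_poly (leq_trans _ kn) ?ltn_ord //.
  by rewrite (leq_ltn_trans _ kn) ?leq_subr.
rewrite hornerM; apply: eqmM; apply: eqm_sym; apply: gsum_horner => // k kn;
by rewrite coef_poly kn.
Qed.

Lemma gsumD a b y : gsum (fun n => a n + b n) y = gsum a y + gsum b y.
Proof.
apply: fpsP => n; rewrite fcoefD !fcoef_gsum -big_split; apply: eq_bigr => i _.
by rewrite mulrDl fcoefD.
Qed.

Lemma gsumZ c a y : fcoef y 0 = 0 -> gsum (fun n => c * a n) y = c * gsum a y.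
Proof.
move=> y0; apply: eqmP => n.
apply: (@eqm_trans _ ((c%:P * \poly_(k < n) a k).[y])).
  by apply: gsum_horner => // k kn; rewrite coefCM coef_poly kn.
rewrite hornerM hornerC; apply: eqmM => //; apply: eqm_sym.
by apply: gsum_horner => // k kn; rewrite coef_poly kn.
Qed.

Lemma eq_gsum a b y : a =1 b -> gsum a y = gsum b y.
Proof.
by move=> ab; apply: fpsP => n /=; apply: eq_bigr => k _; rewrite ab.
Qed.

Lemma gsum_const c y : gsum (fun n => if n == 0%N then c else 0) y = c.
Proof.
apply: fpsP => n; rewrite fcoef_gsum big_ord_recl expr0 mulr1 big1 ?addr0 // => i _.
by rewrite mul0r fcoef0.
Qed.

Lemma gsumS a y : fcoef y 0 = 0 ->
  gsum a y = a 0%N + y * gsum (fun n => a n.+1) y.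
Proof.
move=> y0; apply: eqmP => n.
pose q := \poly_(k < n) a k.+1.
apply: (@eqm_trans _ ((a 0%N)%:P + 'X * q).[y]).
  apply: gsum_horner => // k kn; rewrite coefD coefC coefXM coef_poly.
  by case: k kn => [|k] kn /=; rewrite ?addr0 // add0r ltnW.
rewrite hornerD hornerC hornerM hornerX; apply: eqmD => //; apply: eqmM => //.
by apply: eqm_sym; apply: gsum_horner => // k kn; rewrite coef_poly kn.
Qed.

Lemma fps_compE f y : fps_comp f y = gsum (fun k => fps_const (fcoef f k)) y.
Proof. by apply: fpsP => n; apply: eq_bigr => k _; rewrite fcoef_constM. Qed.

Lemma fcoef_comp0 f y : fcoef (fps_comp f y) 0 = fcoef f 0.
Proof. by rewrite /= big_ord1 mulr1. Qed.

Lemma fps_compD f g y : fps_comp (f + g) y = fps_comp f y + fps_comp g y.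
Proof.
by apply: fpsP => n; rewrite fcoefD !fcoef_comp -big_split; apply: eq_bigr => k _; rewrite mulrDl.
Qed.

Lemma fps_compM f g y : fcoef y 0 = 0 ->
  fps_comp (f * g) y = fps_comp f y * fps_comp g y.
Proof.
move=> y0; rewrite !fps_compE -gsumM //; apply: eq_gsum => k.
by rewrite fcoefM rmorph_sum; apply: eq_bigr => i _; rewrite rmorphM.
Qed.

Lemma fps_comp_const a y : fps_comp (fps_const a) y = fps_const a.
Proof.
rewrite fps_compE -[RHS](gsum_const _ y); apply: eq_gsum => k /=.
by case: eqP; rewrite ?rmorph0.
Qed.

Lemma fps_compXn f k y : fcoef y 0 = 0 ->
  fps_comp (f ^+ k) y = fps_comp f y ^+ k.
Proof.
move=> y0; elim: k => [|k IHk]; first by rewrite !expr0 -(rmorph1 fps_const) fps_comp_const.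
by rewrite !exprS fps_compM // IHk.
Qed.

Lemma fps_compX y : fcoef y 0 = 0 -> fps_comp fpsX y = y.
Proof.
move=> y0; apply: fpsP => -[|n]; rewrite fcoef_comp ?big_ord1 ?mul0r ?y0 //.
rewrite big_ord_recl mul0r add0r big_ord_recl mul1r expr1 big1 ?addr0 // => i _.
by rewrite mul0r.
Qed.

Lemma fps_comp_Xr f : fps_comp f fpsX = f.
Proof.
apply: fpsP => n; rewrite fcoef_comp.
rewrite big_ord_recr fcoef_Xn eqxx mulr1 big1 /= ?add0r // => i _.
by rewrite fcoef_Xn gtn_eqF ?mulr0.
Qed.

Lemma fps_comp0r f : fps_comp f 0 = fps_const (fcoef f 0).
Proof.
apply: fpsP => n; rewrite fcoef_comp big_ord_recl expr0 fcoef1 big1 ?addr0.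
  by rewrite /=; case: eqP; rewrite ?mulr1 ?mulr0.
by move=> i _; rewrite expr0n fcoef0 mulr0.
Qed.

Lemma eqm_comp n f y y' : eqm n y y' -> eqm n (fps_comp f y) (fps_comp f y').
Proof.
by move=> yy i ni; apply: eq_bigr => k _; rewrite (eqmXn _ yy).
Qed.

Lemma eqm_inv n (f g : fps) : eqm n f g -> eqm n f^-1 g^-1.
Proof.
case: n => [|n] fg //; rewrite /GRing.inv /= /fps_inv.
have f0 : fcoef f 0 = fcoef g 0 by apply: fg.
rewrite f0; case: eqP => // _.
by apply: eqmM => //; apply: eqm_comp; apply: eqmB => //; apply: eqmM.
Qed.

Lemma eqm_exp n f g : eqm n f g -> eqm n (fps_exp f) (fps_exp g).
Proof. exact: eqm_comp. Qed.

Lemma eqm_pow n f g a : eqm n f g -> eqm n (f `^ a) (g `^ a).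
Proof. by move=> fg; apply: eqm_comp; apply: eqmB. Qed.

(** * Formal derivatives *)

Definition fps_deriv (f : fps) : fps := Fps (fun n => n.+1%:R * fcoef f n.+1).

Lemma fps_derivD f g : fps_deriv (f + g) = fps_deriv f + fps_deriv g.
Proof. by apply: fpsP => n /=; rewrite mulrDr. Qed.

Lemma fps_derivN f : fps_deriv (- f) = - fps_deriv f.
Proof. by apply: fpsP => n /=; rewrite mulrN. Qed.

Lemma fps_deriv_const a : fps_deriv (fps_const a) = 0.
Proof. by apply: fpsP => n /=; rewrite if_same mulr0. Qed.

Lemma fps_deriv1 : fps_deriv 1 = 0.
Proof. exact: fps_deriv_const. Qed.

Lemma fps_derivX : fps_deriv fpsX = 1.
Proof. by apply: fpsP => -[|n] /=; rewrite ?mulr1 ?mulr0. Qed.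

Lemma eqm_deriv n f g : eqm n.+1 f g -> eqm n (fps_deriv f) (fps_deriv g).
Proof. by move=> fg i ni /=; rewrite fg. Qed.

Lemma fps_deriv_trunc N f n : (n < N)%N ->
  fcoef (fps_deriv f) n = (fps_trunc N f)^`()`_n.
Proof. move=> nN. by rewrite coef_deriv coef_fps_trunc // -mulr_natl. Qed.

Lemma fps_derivM f g : fps_deriv (f * g) = fps_deriv f * g + f * fps_deriv g.
Proof.
apply: fpsP => n; set N := n.+1.
have -> : fcoef (fps_deriv (f * g)) n = ((fps_trunc N f * fps_trunc N g)^`())`_n.
  by rewrite coef_deriv -fcoef_mul_trunc // -mulr_natl.
rewrite derivM coefD fcoefD !coefM !fcoefM; congr (_ + _).
  apply: eq_bigr => i _; rewrite (@fps_deriv_trunc N) ?ltn_ord //.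
  by rewrite coef_fps_trunc // (leq_trans (leq_subr _ _)).
apply: eq_bigr => i _; rewrite coef_fps_trunc ?(ltnW (ltn_ord i)) //.
by rewrite (@fps_deriv_trunc N) // ltnS leq_subr.
Qed.

Lemma fps_derivXn (f : fps) k : fps_deriv (f ^+ k.+1) = k.+1%:R * f ^+ k * fps_deriv f.
Proof.
elim: k => [|k IHk]; first by rewrite !expr1 expr0 !mul1r.
rewrite exprS fps_derivM {}IHk -[in RHS]natr1 !exprS.
by ring.
Qed.

Lemma fps_deriv0_const f : fps_deriv f = 0 -> f = fps_const (fcoef f 0).
Proof.
move=> f'0; apply: fpsP => -[|n] //=.
have /eqP : fcoef (fps_deriv f) n = 0 by rewrite f'0 fcoef0.
by rewrite /= mulf_eq0 pnatr_eq0 => /eqP.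
Qed.

Lemma fps_deriv_inj f g : fcoef f 0 = fcoef g 0 -> fps_deriv f = fps_deriv g -> f = g.
Proof.
move=> fg0 fg; apply/eqP; rewrite -subr_eq0; apply/eqP.
rewrite [LHS]fps_deriv0_const ?fps_derivD ?fps_derivN ?fg ?subrr //.
by rewrite fcoefD fcoefN fg0 subrr rmorph0.
Qed.

Lemma fps_deriv_sum (I : Type) (r : seq I) (p : pred I) (F : I -> fps) :
  fps_deriv (\sum_(i <- r | p i) F i) = \sum_(i <- r | p i) fps_deriv (F i).
Proof.
apply: (big_morph fps_deriv fps_derivD).
by rewrite -[0](rmorph0 fps_const) fps_deriv_const rmorph0.
Qed.

Lemma fps_comp_trunc n f y : fcoef y 0 = 0 ->
  eqm n (fps_comp f y) (\sum_(k < n) fps_const (fcoef f k) * y ^+ k).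
Proof.
move=> y0; rewrite -(horner_poly n (fun k => fps_const (fcoef f k)) y) fps_compE.
apply: gsum_horner => // k kn.
by rewrite coef_poly kn.
Qed.

Lemma fps_deriv_comp f y : fcoef y 0 = 0 ->
  fps_deriv (fps_comp f y) = fps_comp (fps_deriv f) y * fps_deriv y.
Proof.
move=> y0; apply: eqmP => n.
apply: eqm_trans (eqm_deriv (@fps_comp_trunc n.+1 f y y0)) _.
rewrite fps_deriv_sum big_ord_recl expr0 mulr1 fps_deriv_const add0r.
apply: eqm_trans (eqmM (eqm_sym (@fps_comp_trunc n _ y y0)) (@eqm_refl _ _)).
rewrite mulr_suml; apply: eqm_sum => i _.
rewrite lift0 fps_derivM fps_deriv_const mul0r add0r fps_derivXn /=.
rewrite rmorphM rmorph_nat; apply: eqm_eq.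
by rewrite !mulrA (mulrC (fps_const _) i.+1%:R).
Qed.

(** * Exponential, binomial and logarithmic series *)

Definition contractive (E : fps -> fps) :=
  forall n f g, eqm n f g -> eqm n.+1 (E f) (E g).

Lemma contractive_uniq E f g : contractive E -> f = E f -> g = E g -> f = g.
Proof.
move=> cE fE gE; apply: eqmP; elim=> [|n IHn] //.
by rewrite fE gE; apply: cE.
Qed.

(** Each iterate of E from 0 fixes one more coefficient, so the diagonal of the iterates is their
    z-adic limit. *)
Lemma contractive_fix E : contractive E -> exists f, f = E f.
Proof.
move=> cE; pose s n := iter n E 0.
have step n : eqm n (s n) (s n.+1) by elim: n => [|n IHn] //; apply: cE.
have le n k : eqm n (s n) (s (k + n)%N).
  elim: k => [|k IHk] //; apply: eqm_trans IHk _.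
  exact: eqm_le (leq_addl k n) (@step (k + n)%N).
pose f := Fps (fun n => fcoef (s n.+1) n).
have fs n : eqm n f (s n).
  move=> i ni /=; rewrite -[n](subnK ni); symmetry.
  by rewrite (le i.+1 (n - i.+1)%N).
exists f; apply: eqmP => -[|n] //.
apply: eqm_trans (fs n.+1) _; apply: cE; exact: eqm_sym.
Qed.

(** Course-of-values recursion in an arbitrary type: iterating the update on whole sequences makes
    the first k terms stable after k rounds, and the diagonal is the solution. *)
Lemma causal_rec (X : Type) (x0 : X) (step : (nat -> X) -> nat -> X) :
  (forall f g n, (forall i, (i <= n)%N -> f i = g i) -> step f n = step g n) ->
  exists a, a 0%N = x0 /\ forall n, a n.+1 = step a n.
Proof.
move=> causal; pose next f n := if n is n'.+1 then step f n' else x0.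
pose s k := iter k next (fun=> x0).
have st k n : (n <= k)%N -> s k.+1 n = s k n.
  elim: k n => [|k IHk] [|n] //= nk; apply: causal => i ni; apply: IHk.
  exact: leq_trans ni nk.
have le n k : s (k + n)%N n = s n n.
  by elim: k => [|k IHk] //; rewrite addSn st ?leq_addl.
exists (fun n => s n n); split=> // n /=; apply: causal => i ni.
by rewrite -[n](subnK ni) le.
Qed.

(** The quotient y / z has derivative zero, hence is constant. The laws of the exponential and of
    powers are deduced from this by comparing differential equations. *)
Lemma fps_ode_uniq (f g y z : fps) : fcoef f 0 != 0 ->
  f * fps_deriv y = g * y -> f * fps_deriv z = g * z ->
  fcoef y 0 = fcoef z 0 -> fcoef z 0 != 0 -> y = z.
Proof.
move=> f0 fy fz yz0 z0.
have uf : f \is a GRing.unit by rewrite fps_unitE.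
have uz : z \is a GRing.unit by rewrite fps_unitE.
pose w := y / z; have yE : y = w * z by rewrite divrK.
have w'0 : fps_deriv w = 0.
  apply: (mulrI uf); apply: (mulIr uz); rewrite mulr0 mul0r.
  move: fy; rewrite yE fps_derivM mulrDr => fy.
  rewrite -mulrA; apply: (addIr (f * (w * fps_deriv z))); rewrite fy.
  by rewrite (mulrCA f w) fz; ring.
rewrite yE (fps_deriv0_const w'0).
have : fcoef w 0 * fcoef z 0 = 1 * fcoef z 0 by rewrite -fcoef0M -yE mul1r.
by move/(mulIf z0) => ->; rewrite rmorph1 mul1r.
Qed.

Definition exp_series : fps := Fps (fun k => (k`!%:R)^-1).

Lemma exp_series_deriv : fps_deriv exp_series = exp_series.
Proof.
apply: fpsP => n /=; rewrite factS natrM invfM mulrA divff ?mul1r //.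
by rewrite pnatr_eq0.
Qed.

Lemma fcoef_exp0 f : fcoef (fps_exp f) 0 = 1.
Proof. by rewrite fcoef_comp0 /= invr1. Qed.

Lemma fps_exp_deriv f : fcoef f 0 = 0 ->
  fps_deriv (fps_exp f) = fps_exp f * fps_deriv f.
Proof. by move=> f0; rewrite fps_deriv_comp // exp_series_deriv. Qed.

Lemma fps_expD f g : fcoef f 0 = 0 -> fcoef g 0 = 0 ->
  fps_exp (f + g) = fps_exp f * fps_exp g.
Proof.
move=> f0 g0; have fg0 : fcoef (f + g) 0 = 0 by rewrite fcoefD f0 g0.
apply: (@fps_ode_uniq 1 (fps_deriv f + fps_deriv g)).
- by rewrite fcoef1 oner_eq0.
- by rewrite fps_exp_deriv // fps_derivD; ring.
- by rewrite fps_derivM !fps_exp_deriv //; ring.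
- by rewrite fcoef0M !fcoef_exp0 mulr1.
- by rewrite fcoef0M !fcoef_exp0 mulr1 oner_eq0.
Qed.

Lemma fps_exp0 : fps_exp 0 = 1.
Proof. by rewrite /fps_exp fps_comp0r /= invr1 rmorph1. Qed.

Lemma fps_exp_natM n f : fcoef f 0 = 0 -> fps_exp (n%:R * f) = fps_exp f ^+ n.
Proof.
move=> f0; elim: n => [|n IHn]; first by rewrite mul0r fps_exp0 expr0.
have nf0 : fcoef (n%:R * f) 0 = 0 by rewrite fcoef0M f0 mulr0.
by rewrite -natr1 mulrDl mul1r fps_expD // IHn exprSr.
Qed.

Definition binom_series (a : rat) : fps := Fps (rat_binomial a).

Lemma rat_binomial0 a : rat_binomial a 0 = 1.
Proof. by rewrite /rat_binomial big_ord0 divr1. Qed.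

Lemma rat_binomialS a n :
  n.+1%:R * rat_binomial a n.+1 = (a - n%:R) * rat_binomial a n.
Proof.
rewrite /rat_binomial big_ord_recr /= factS natrM invfM.
have : n.+1%:R != 0 :> rat by rewrite pnatr_eq0.
have : n`!%:R != 0 :> rat by rewrite pnatr_eq0 -lt0n fact_gt0.
by move=> n0 f0; field; rewrite nat1r f0 n0.
Qed.

Lemma binom_series_deriv a :
  (1 + fpsX) * fps_deriv (binom_series a) = fps_const a * binom_series a.
Proof.
apply: fpsP => n; rewrite mulrDl mul1r fcoefD fcoef_constM.
case: n => [|n]; first by rewrite fcoef_XM0 addr0 /= rat_binomialS subr0.
by rewrite fcoef_XMS /= rat_binomialS -mulrDl subrK.
Qed.

Lemma fcoef_pow0 f a : fcoef (f `^ a) 0 = 1.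
Proof. by rewrite fcoef_comp0 /= rat_binomial0. Qed.

Lemma fps_pow_deriv f a : fcoef f 0 = 1 ->
  f * fps_deriv (f `^ a) = fps_const a * fps_deriv f * (f `^ a).
Proof.
move=> f0; have f10 : fcoef (f - 1) 0 = 0 by rewrite fcoefD fcoefN fcoef1 f0 subrr.
rewrite fps_deriv_comp // fps_derivD fps_derivN fps_deriv1 subr0.
have -> : f * (fps_comp (fps_deriv (binom_series a)) (f - 1) * fps_deriv f) =
  fps_comp ((1 + fpsX) * fps_deriv (binom_series a)) (f - 1) * fps_deriv f.
  rewrite fps_compM // fps_compD fps_compX // -(rmorph1 fps_const) fps_comp_const.
  by rewrite rmorph1; ring.
by rewrite binom_series_deriv fps_compM // fps_comp_const; rewrite /fps_pow; ring.
Qed.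

(** Characterises f^a by f y' = a f' y and y(0) = 1, which is easier to handle than the binomial
    series. *)
Lemma fps_pow_uniq f a y : fcoef f 0 = 1 -> fcoef y 0 = 1 ->
  f * fps_deriv y = fps_const a * fps_deriv f * y -> y = f `^ a.
Proof.
move=> f0 y0 fy; apply: (@fps_ode_uniq f (fps_const a * fps_deriv f)) => //.
- by rewrite f0 oner_eq0.
- exact: fps_pow_deriv.
- by rewrite y0 fcoef_pow0.
- by rewrite fcoef_pow0 oner_eq0.
Qed.

Lemma fps_powD f a b : fcoef f 0 = 1 -> f `^ a * f `^ b = f `^ (a + b).
Proof.
move=> f0; apply: fps_pow_uniq => //; first by rewrite fcoef0M !fcoef_pow0 mulr1.
rewrite fps_derivM mulrDr mulrA fps_pow_deriv // mulrCA fps_pow_deriv //.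
by rewrite rmorphD; ring.
Qed.

Lemma fps_pow0 f : fcoef f 0 = 1 -> f `^ 0 = 1.
Proof.
move=> f0; symmetry; apply: fps_pow_uniq; rewrite ?fcoef1 //.
by rewrite rmorph0 fps_deriv1; ring.
Qed.

Lemma fps_pow1 f : fcoef f 0 = 1 -> f `^ 1 = f.
Proof.
move=> f0; symmetry; apply: fps_pow_uniq => //.
by rewrite rmorph1; ring.
Qed.

Lemma fps_powMl f g a : fcoef f 0 = 1 -> fcoef g 0 = 1 ->
  (f * g) `^ a = f `^ a * g `^ a.
Proof.
move=> f0 g0; symmetry; apply: fps_pow_uniq.
- by rewrite fcoef0M f0 g0 mulr1.
- by rewrite fcoef0M !fcoef_pow0 mulr1.
rewrite !fps_derivM.
have -> : f * g * (fps_deriv (f `^ a) * g `^ a + f `^ a * fps_deriv (g `^ a)) =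
  f * fps_deriv (f `^ a) * (g * g `^ a) + g * fps_deriv (g `^ a) * (f * f `^ a).
  by ring.
by rewrite !fps_pow_deriv //; ring.
Qed.

Lemma fps_root_uniq d f y : (0 < d)%N -> fcoef y 0 = 1 -> y ^+ d = f ->
  y = f `^ (1 / d%:R).
Proof.
move=> d0 y0 <-; have d0' : d%:R != 0 :> rat by rewrite pnatr_eq0 -lt0n.
apply: fps_pow_uniq => //; first by rewrite fcoef0X y0 expr1n.
case: d d0 d0' => // d _ d0'; rewrite fps_derivXn exprS.
have e : fps_const (1 / d.+1%:R) * d.+1%:R = 1.
  by rewrite fps_natE -rmorphM mul1r mulVf // rmorph1.
have -> : fps_const (1 / d.+1%:R) * (d.+1%:R * y ^+ d * fps_deriv y) * y =
  fps_const (1 / d.+1%:R) * d.+1%:R * (y * y ^+ d * fps_deriv y) by ring.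
by rewrite e mul1r.
Qed.

Lemma fps_powXn f a n : fcoef f 0 = 1 -> (f `^ a) ^+ n = f `^ (a * n%:R).
Proof.
move=> f0; elim: n => [|n IHn]; first by rewrite mulr0 fps_pow0.
by rewrite exprSr IHn fps_powD // -natr1 mulrDr mulr1.
Qed.

Lemma fps_rootK d f : (0 < d)%N -> fcoef f 0 = 1 -> (f `^ (1 / d%:R)) ^+ d = f.
Proof.
move=> d0 f0; rewrite fps_powXn // mul1r mulVf ?fps_pow1 //.
by rewrite pnatr_eq0 -lt0n.
Qed.

Definition ln_series : fps :=
  Fps (fun k => if k == 0%N then 0 else (-1) ^+ k.-1 / k%:R).

Lemma ln_series_deriv : (1 + fpsX) * fps_deriv ln_series = 1.
Proof.
have E k : fcoef (fps_deriv ln_series) k = (-1) ^+ k.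
  by rewrite /= mulrCA divff ?mulr1 // pnatr_eq0.
apply: fpsP => n; rewrite mulrDl mul1r fcoefD fcoef1.
case: n => [|n]; first by rewrite fcoef_XM0 addr0 E expr0.
by rewrite fcoef_XMS !E exprS mulN1r addNr.
Qed.

Lemma fcoef_ln0 f : fcoef (fps_ln f) 0 = 0.
Proof. exact: fcoef_comp0. Qed.

Lemma fps_ln_deriv f : fcoef f 0 = 1 -> f * fps_deriv (fps_ln f) = fps_deriv f.
Proof.
move=> f0; have f10 : fcoef (f - 1) 0 = 0 by rewrite fcoefD fcoefN fcoef1 f0 subrr.
rewrite fps_deriv_comp // fps_derivD fps_derivN fps_deriv1 subr0.
have -> : f * (fps_comp (fps_deriv ln_series) (f - 1) * fps_deriv f) =
  fps_comp ((1 + fpsX) * fps_deriv ln_series) (f - 1) * fps_deriv f.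
  rewrite fps_compM // fps_compD fps_compX // -(rmorph1 fps_const) fps_comp_const.
  by rewrite rmorph1; ring.
by rewrite ln_series_deriv -(rmorph1 fps_const) fps_comp_const rmorph1 mul1r.
Qed.

Lemma fps_ln_uniq f y : fcoef f 0 = 1 -> fcoef y 0 = 0 ->
  f * fps_deriv y = fps_deriv f -> y = fps_ln f.
Proof.
move=> f0 y0 fy; apply: fps_deriv_inj; first by rewrite y0 fcoef_ln0.
have uf : f \is a GRing.unit by rewrite fps_unitE f0 oner_eq0.
by apply: (mulrI uf); rewrite fy fps_ln_deriv.
Qed.

Lemma fps_lnM f g : fcoef f 0 = 1 -> fcoef g 0 = 1 ->
  fps_ln (f * g) = fps_ln f + fps_ln g.
Proof.
move=> f0 g0; symmetry; apply: fps_ln_uniq.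
- by rewrite fcoef0M f0 g0 mulr1.
- by rewrite fcoefD !fcoef_ln0 addr0.
rewrite fps_derivD fps_derivM.
have -> : f * g * (fps_deriv (fps_ln f) + fps_deriv (fps_ln g)) =
  f * fps_deriv (fps_ln f) * g + f * (g * fps_deriv (fps_ln g)) by ring.
by rewrite !fps_ln_deriv.
Qed.

Lemma fps_expK f : fcoef f 0 = 0 -> fps_ln (fps_exp f) = f.
Proof.
move=> f0; symmetry; apply: fps_ln_uniq => //; first exact: fcoef_exp0.
by rewrite fps_exp_deriv.
Qed.

(** * The kernel method *)

Lemma eqm_gsum n a b y : (forall k, (k < n)%N -> a k = b k) ->
  eqm n (gsum a y) (gsum b y).
Proof.
move=> ab i ni; rewrite !fcoef_gsum; apply: eq_bigr => k _; rewrite ab //.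
exact: leq_trans (ltn_ord k) _.
Qed.

Lemma fps_comp_sum (I : Type) (r : seq I) (p : pred I) (F : I -> fps) y :
  fps_comp (\sum_(i <- r | p i) F i) y = \sum_(i <- r | p i) fps_comp (F i) y.
Proof.
apply: (big_morph (fun f => fps_comp f y)) => [f g|]; first exact: fps_compD.
by rewrite -(rmorph0 fps_const) fps_comp_const rmorph0.
Qed.

Lemma gsum_sum (I : Type) (r : seq I) (p : pred I) (F : I -> nat -> fps) y :
  gsum (fun n => \sum_(i <- r | p i) F i n) y = \sum_(i <- r | p i) gsum (F i) y.
Proof.
elim: r => [|i r IHr].
  rewrite big_nil -[RHS](gsum_const 0 y); apply: eq_gsum => n.
  by rewrite big_nil if_same.
rewrite big_cons -IHr; case: ifP => pi; last first.
  by apply: eq_gsum => n; rewrite big_cons pi.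
by rewrite -gsumD; apply: eq_gsum => n; rewrite big_cons pi.
Qed.

Lemma gsumX_const (c : nat -> rat) : gsum (fun n => fps_const (c n)) fpsX = Fps c.
Proof. by rewrite -[RHS]fps_comp_Xr fps_compE. Qed.

(* A sequence [a] of power series in u stands for the bivariate series        *)
(* [\sum_n a n z^n], and [bsubst a U] for its value at u = U(z).              *)
Definition bsubst (a : nat -> fps) (U : fps) : fps :=
  gsum (fun n => fps_comp (a n) U) fpsX.

(** The coefficients in z of the k-th power of the bivariate series with coefficients [a]. *)
Fixpoint cpow (a : nat -> fps) (k : nat) : nat -> fps :=
  if k is k'.+1 then conv a (cpow a k') else fun n => if n == 0%N then 1 else 0.

Lemma cpow_small a k n : a 0%N = 0 -> (n < k)%N -> cpow a k n = 0.
Proof.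
move=> a0; elim: k n => // k IHk n; rewrite ltnS => nk /=.
rewrite /conv big_ord_recl a0 mul0r add0r big1 // => i _.
by rewrite IHk ?mulr0 // lift0; apply: leq_trans nk; have := ltn_ord i; lia.
Qed.

Lemma cpow_causal a b k n : (forall i, (i <= n)%N -> a i = b i) ->
  cpow a k n = cpow b k n.
Proof.
elim: k n => // k IHk n ab /=; apply: eq_bigr => i _.
rewrite ab -1?ltnS // IHk // => j jn; apply: ab.
exact: leq_trans jn (leq_subr _ _).
Qed.

(** The coefficient of z^n in phi(A) for A the bivariate series of [a]. Stopping at k = n is right
    when [a 0] vanishes, since then A^k begins at z^k. *)
Definition phisum (phi : fps) (a : nat -> fps) (n : nat) : fps :=
  \sum_(k < n.+1) fps_const (fcoef phi k) * cpow a k n.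

Lemma phisum_wide N phi a n : a 0%N = 0 -> (n < N)%N ->
  phisum phi a n = \sum_(k < N) fps_const (fcoef phi k) * cpow a k n.
Proof.
move=> a0 nN.
rewrite /phisum (big_ord_widen _ (fun k => fps_const (fcoef phi k) * cpow a k n) nN).
rewrite big_mkcond; apply: eq_bigr => k _; case: ifP => // /negbT.
by rewrite -leqNgt => nk; rewrite cpow_small ?mulr0.
Qed.

Section Substitution.
Variable U : fps.
Hypothesis U0 : fcoef U 0 = 0.

Lemma bsubst_conv a b : bsubst (conv a b) U = bsubst a U * bsubst b U.
Proof.
rewrite /bsubst -gsumM //; apply: eq_gsum => n; rewrite fps_comp_sum.
by apply: eq_bigr => i _; rewrite fps_compM.
Qed.

Lemma bsubstD a b : bsubst (fun n => a n + b n) U = bsubst a U + bsubst b U.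
Proof. by rewrite -gsumD; apply: eq_gsum => n; rewrite fps_compD. Qed.

Lemma bsubstZ f a : bsubst (fun n => f * a n) U = fps_comp f U * bsubst a U.
Proof. by rewrite -gsumZ //; apply: eq_gsum => n; rewrite fps_compM. Qed.

Lemma bsubst_const c : bsubst (fun n => fps_const (c n)) U = Fps c.
Proof.
by rewrite -gsumX_const; apply: eq_gsum => n; rewrite fps_comp_const.
Qed.

Lemma bsubstS a : a 0%N = 0 -> bsubst a U = fpsX * bsubst (fun n => a n.+1) U.
Proof.
move=> a0; rewrite /bsubst gsumS // a0.
by rewrite -(rmorph0 fps_const) fps_comp_const rmorph0 add0r.
Qed.

Lemma fcoef_bsubst0 a : a 0%N = 0 -> fcoef (bsubst a U) 0 = 0.
Proof. by move=> a0; rewrite bsubstS // fcoef_XM0. Qed.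

Lemma bsubst_cpow a k : bsubst (cpow a k) U = bsubst a U ^+ k.
Proof.
elim: k => [|k IHk]; last by rewrite exprS -IHk -bsubst_conv.
rewrite expr0 -(gsum_const 1 fpsX); apply: eq_gsum => n /=.
by case: eqP => _; rewrite -?(rmorph1 fps_const) -?(rmorph0 fps_const) fps_comp_const.
Qed.

Lemma bsubst_phisum phi a : a 0%N = 0 ->
  bsubst (phisum phi a) U = fps_comp phi (bsubst a U).
Proof.
move=> a0; apply: eqmP => n.
apply: eqm_trans (eqm_sym (@fps_comp_trunc n phi _ (fcoef_bsubst0 a0))).
apply: (@eqm_trans _ (bsubst (fun m => \sum_(k < n) fps_const (fcoef phi k) * cpow a k m) U)).
  by apply: eqm_gsum => k kn; rewrite (phisum_wide _ a0 kn).
apply: eqm_eq.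
transitivity (gsum (fun m => \sum_(k < n) fps_comp (fps_const (fcoef phi k) * cpow a k m) U) fpsX).
  by apply: eq_gsum => m; rewrite fps_comp_sum.
rewrite gsum_sum; apply: eq_bigr => k _.
by rewrite -/(bsubst _ _) bsubstZ fps_comp_const bsubst_cpow.
Qed.

Definition bderiv (a : nat -> fps) (n : nat) := fps_deriv (a n).

Lemma bsubst_deriv_conv a b : bsubst (bderiv (conv a b)) U =
  bsubst (bderiv a) U * bsubst b U + bsubst a U * bsubst (bderiv b) U.
Proof.
rewrite -!bsubst_conv -bsubstD; apply: eq_gsum => n; congr fps_comp.
rewrite /bderiv fps_deriv_sum /conv -big_split; apply: eq_bigr => i _.
exact: fps_derivM.
Qed.

Lemma bsubst_deriv_cpow a k : bsubst (bderiv (cpow a k)) U =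
  k%:R * bsubst a U ^+ k.-1 * bsubst (bderiv a) U.
Proof.
elim: k => [|k IHk].
  rewrite !mul0r -[RHS](gsum_const 0 fpsX); apply: eq_gsum => n.
  have -> : bderiv (cpow a 0) n = fps_const 0.
    by rewrite /bderiv /=; case: eqP => _; rewrite -?(rmorph1 fps_const) -?(rmorph0 fps_const) fps_deriv_const rmorph0.
  by rewrite if_same fps_comp_const rmorph0.
rewrite bsubst_deriv_conv {}IHk bsubst_cpow -natr1.
by case: k => [|k] /=; rewrite ?exprS; ring.
Qed.

(** The chain rule for phi(A) along u, evaluated at u = U. It is proved term by term from the power
    rule after truncation modulo z^n. *)
Lemma bsubst_deriv_phisum phi a : a 0%N = 0 ->
  bsubst (bderiv (phisum phi a)) U =
  fps_comp (fps_deriv phi) (bsubst a U) * bsubst (bderiv a) U.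
Proof.
move=> a0; apply: eqmP => n.
apply: eqm_trans (eqmM (eqm_sym (@fps_comp_trunc n _ _ (fcoef_bsubst0 a0))) (@eqm_refl _ _)).
(* One more term than the precision n, because differentiation lowers the exponent of A. *)
apply: (@eqm_trans _ (bsubst (bderiv (fun m => \sum_(k < n.+1) fps_const (fcoef phi k) * cpow a k m)) U)).
  by apply: eqm_gsum => k kn; rewrite /bderiv (phisum_wide _ a0 (leqW kn)).
apply: eqm_eq; rewrite mulr_suml.
transitivity (\sum_(k < n.+1) fps_const (fcoef phi k) * bsubst (bderiv (cpow a k)) U).
  rewrite -[LHS]/(gsum _ _).
  transitivity (gsum (fun m => \sum_(k < n.+1) fps_comp (fps_const (fcoef phi k) * fps_deriv (cpow a k m)) U) fpsX).
    apply: eq_gsum => m; rewrite /bderiv fps_deriv_sum fps_comp_sum.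
    by apply: eq_bigr => k _; rewrite fps_derivM fps_deriv_const mul0r add0r.
  rewrite gsum_sum; apply: eq_bigr => k _.
  by rewrite -/(bsubst _ _) bsubstZ fps_comp_const.
rewrite big_ord_recl bsubst_deriv_cpow !mul0r mulr0 add0r.
apply: eq_bigr => k _; rewrite lift0 bsubst_deriv_cpow /=.
by rewrite rmorphM rmorph_nat; ring.
Qed.

End Substitution.

(** Division by u, since one driver parks at the root of the subtree, after which only surpluses of
    at least [tau] are kept. *)
Definition shift_series (tau : bool) (f : fps) : fps :=
  Fps (fun e => if (e < tau)%N then 0 else fcoef f e.+1).

(* [b n] collects by excess the trees with n nodes that may hang below a node *)
Definition tree_series (W phi : fps) (tau : bool) (b : nat -> fps) : Prop :=
  b 0%N = 0 /\ forall n, b n.+1 = shift_series tau (W * phisum phi b n).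

(** Complete trees with as many drivers as nodes: below and at the root exactly one driver is left
    over for the root itself, whence the coefficient of u. The condition with [tau] is not imposed
    on the root. *)
Definition rooted_series (W phi : fps) (b : nat -> fps) : fps :=
  Fps (fun n => if n is n'.+1 then fcoef (W * phisum phi b n') 1 else 0).

Lemma tree_series_exists W phi tau : exists b, tree_series W phi tau b.
Proof.
apply: (causal_rec 0 (step := fun b n => shift_series tau (W * phisum phi b n))).
move=> f g n fg; congr (shift_series _ (_ * _)); apply: eq_bigr => k _.
by rewrite (cpow_causal _ fg).
Qed.

(** U exists because its equation is contractive. The last two conclusions are the u-derivative of
    the functional equation at u = U and that equation itself at u = U; in the former the derivative
    of B cancels by the choice of U, without any division. *)
Lemma kernel_system W phi (tau : bool) b : fcoef W 0 = 1 -> fcoef phi 0 = 1 ->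
  tree_series W phi tau b -> let P := rooted_series W phi b in
  exists U Phi, [/\ fcoef U 0 = 0, fcoef Phi 0 = 0 ,
    U = fpsX * (fps_comp W U * fps_comp (fps_deriv phi) Phi),
    Phi + tau%:R * P = fpsX * (fps_comp (fps_deriv W) U * fps_comp phi Phi) &
    U * (Phi + tau%:R * P) =
      fpsX * (fps_comp W U * fps_comp phi Phi - (if tau then 1 else fps_comp phi P))].
Proof.
move=> W0 phi0 [b0 bS] P.
pose E U := fpsX * (fps_comp W U * fps_comp (fps_deriv phi) (bsubst b U)).
have [U UE] : exists U, U = E U.
  apply: contractive_fix => n f g fg; apply: eqm_XM; apply: eqmM.
    exact: eqm_comp.
  apply: eqm_comp => i ni; rewrite !fcoef_gsum; apply: eq_bigr => k _.
  by apply: (@eqmM n) => //; apply: eqm_comp.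
have U0 : fcoef U 0 = 0 by rewrite UE fcoef_XM0.
exists U, (bsubst b U); set Phi := bsubst b U.
pose H n := W * phisum phi b n.
have Phi0 : fcoef Phi 0 = 0 by apply: fcoef_bsubst0.
have HS V : fcoef V 0 = 0 -> bsubst H V = fps_comp W V * fps_comp phi (bsubst b V).
  by move=> V0; rewrite bsubstZ // bsubst_phisum.
have PE : P = fpsX * Fps (fun n => fcoef (H n) 1).
  by apply: fpsP => -[|n]; rewrite ?fcoef_XM0 ?fcoef_XMS.
(* The functional equation, coefficient by coefficient in z; here [fpsX] is the variable u. For
   prime functions the shift has removed the coefficient of u in [H n], and the term with [tau] puts
   it back. *)
have HE n : fpsX * (b n.+1 + tau%:R * fps_const (fcoef (H n) 1)) =
    H n - fps_const (fcoef (H n) 0).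
  rewrite bS -/(H n); apply: fpsP => -[|e].
    by rewrite fcoef_XM0 fcoefD fcoefN /= subrr.
  rewrite fcoef_XMS !fcoefD fcoefN fps_natE fcoef_constM /= subr0.
  by case: tau {bS} e => [] [|e] /=; rewrite ?mul1r ?mul0r ?mulr0 ?addr0 ?add0r.
(* The subtracted term is the equation's right-hand side at u = 0. There B reduces to P in general,
   and to 0 for prime functions, whose hanging trees have positive surplus. *)
have CE : Fps (fun n => fcoef (H n) 0) = if tau then 1 else fps_comp phi P.
  transitivity (bsubst H 0).
    by rewrite -gsumX_const; apply: eq_gsum => n; rewrite fps_comp0r.
  rewrite HS ?fcoef0 // fps_comp0r W0 rmorph1 mul1r.
  have -> : bsubst b 0 = if tau then 0 else P.
    rewrite bsubstS // PE.
    have -> : bsubst (fun n => b n.+1) 0 = Fps (fun n => fcoef (b n.+1) 0).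
      by rewrite -gsumX_const; apply: eq_gsum => n; rewrite fps_comp0r.
    case: tau bS {HE} => bS; last first.
      by congr (_ * _); apply: fpsP => n /=; rewrite bS.
    rewrite -[RHS](mulr0 fpsX); congr (_ * _); apply: fpsP => n.
    by rewrite fcoef0 /= bS.
  by case: tau {bS HE} => //; rewrite fps_comp0r phi0 rmorph1.
have QE : bsubst (fun n => b n.+1 + tau%:R * fps_const (fcoef (H n) 1)) U =
    bsubst (fun n => b n.+1) U + tau%:R * Fps (fun n => fcoef (H n) 1).
  rewrite bsubstD; congr (_ + _); rewrite fps_natE bsubstZ // fps_comp_const.
  by rewrite bsubst_const.
have BP : Phi + tau%:R * P = fpsX * bsubst (fun n => b n.+1 + tau%:R * fps_const (fcoef (H n) 1)) U.
  by rewrite QE PE /Phi bsubstS //; ring.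
split=> //; last first.
  rewrite BP mulrCA; congr (_ * _).
  rewrite -{1}(fps_compX U0) -bsubstZ //.
  transitivity (bsubst (fun n => H n + fps_const (- fcoef (H n) 0)) U).
    by apply: eq_gsum => n; rewrite HE rmorphN.
  by rewrite bsubstD bsubst_const HS // -CE.
(* the derivative of the functional equation along u, at u = U *)
have dH : bsubst (bderiv H) U =
    fps_comp (fps_deriv W) U * fps_comp phi Phi +
    fps_comp W U * (fps_comp (fps_deriv phi) Phi * bsubst (bderiv b) U).
  rewrite -bsubst_deriv_phisum // -bsubst_phisum // -!bsubstZ // -bsubstD.
  by apply: eq_gsum => n; rewrite /bderiv fps_derivM.
have dE : fpsX * bsubst (bderiv H) U = Phi + tau%:R * P + U * bsubst (bderiv b) U.
  rewrite [bsubst (bderiv b) U]bsubstS // ?/bderiv ?b0; last first.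
    by rewrite -[in LHS](rmorph0 fps_const) fps_deriv_const.
  rewrite BP mulrCA -mulrDr; congr (_ * _).
  have XZ a : bsubst (fun n => fpsX * a n) U = U * bsubst a U by rewrite bsubstZ // fps_compX.
  rewrite -XZ -bsubstD; apply: eq_gsum => n; congr fps_comp.
  move/(congr1 fps_deriv): (HE n).
  rewrite fps_derivM fps_derivX mul1r !fps_derivD fps_derivN fps_deriv_const subr0 => <-.
  by rewrite fps_natE -rmorphM fps_deriv_const addr0.
apply: (addIr (U * bsubst (bderiv b) U)); rewrite -dE dH mulrDr; congr (_ + _).
have -> : U * bsubst (bderiv b) U = E U * bsubst (bderiv b) U by rewrite -UE.
by rewrite /E -/Phi; ring.
Qed.

(** * The kernel system for each family *)

Lemma fps_geom_compE y : fcoef y 0 = 0 -> (1 - y) * fps_comp fps_geom y = 1.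
Proof. by move=> y0; rewrite mulrC fps_geomM. Qed.

Lemma fps_geom_deriv : fps_deriv fps_geom = fps_geom ^+ 2.
Proof.
apply: fpsP => n; rewrite expr2 fcoefM /=.
by rewrite mulr1 (eq_bigr (fun=> 1)) ?sumr_const ?card_ord // => i _; rewrite mulr1.
Qed.

(** Allows d-th roots to be taken in identities between d-th powers, as all series concerned have
    constant term 1. *)
Lemma fps_root_inj d y z : (0 < d)%N -> fcoef y 0 = 1 -> fcoef z 0 = 1 ->
  y ^+ d = z ^+ d -> y = z.
Proof.
move=> d0 y0 z0 yz; rewrite (fps_root_uniq d0 y0 yz).
by rewrite -(fps_root_uniq d0 z0 erefl).
Qed.

Lemma fps_eq_div (x y z : fps) : fcoef y 0 != 0 -> x * y = z -> x = z / y.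
Proof. by move=> y0 <-; rewrite mulrK. Qed.

(* With Q = U for parking functions and Q = U / (1 - U) for distributions,    *)
(* both kernel systems take this form for suitable M and K.                   *)
Definition kernel_reduced (phi M K Q P : fps) (tau : bool) :=
  exists Phi, [/\ fcoef Phi 0 = 0, Q = fpsX * (M * fps_comp (fps_deriv phi) Phi) &
    if tau then P + Phi = fpsX * (M * fps_comp phi Phi) /\ K * fps_comp phi Phi = 1
    else Phi = fpsX * (M * fps_comp phi Phi) /\ fps_comp phi P = K * fps_comp phi Phi].

Lemma rooted_series0 W phi b : fcoef (rooted_series W phi b) 0 = 0.
Proof. by []. Qed.

(** Since W' = W here, Q = U W'(U) / W(U) is U itself, and K = W(U) - U W'(U) = e^U (1 - U). *)
Lemma kernel_exp phi (tau : bool) b : fcoef phi 0 = 1 -> tree_series exp_series phi tau b ->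
  exists Q, fcoef Q 0 = 0 /\ kernel_reduced phi (fps_exp Q) (fps_exp Q * (1 - Q))
    Q (rooted_series exp_series phi b) tau.
Proof.
move=> phi0 bS; have [|U [Phi]] := kernel_system _ phi0 bS; first by rewrite /= invr1.
rewrite exp_series_deriv -/(fps_exp U); set P := rooted_series _ _ _.
set e := fps_exp U => -[U0 Phi0 UE PhiE UPhi].
exists U; split=> //; exists Phi; split=> //; case: {bS} tau PhiE UPhi.
  rewrite mul1r => PhiE UPhi; split; first by rewrite addrC.
  apply: fpsX_inj; move: UPhi; rewrite PhiE => UPhi.
  have -> : fpsX * (e * (1 - U) * fps_comp phi Phi) =
    fpsX * (e * fps_comp phi Phi) - U * (fpsX * (e * fps_comp phi Phi)) by ring.
  by rewrite UPhi; ring.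
rewrite mul0r addr0 => PhiE UPhi; split=> //; apply: fpsX_inj.
have -> : fpsX * (e * (1 - U) * fps_comp phi Phi) =
    fpsX * (e * fps_comp phi Phi) - U * (fpsX * (e * fps_comp phi Phi)) by ring.
by rewrite -PhiE UPhi mulrBr -PhiE; ring.
Qed.

(** Let w = 1/(1-U). As W'(U) = w^2, the choice Q = U W'(U) / W(U) = U w gives w = 1 + Q, so M =
    (1+Q)^2 and K = w - U w^2 = w (1-Q) = 1 - Q^2. *)
Lemma kernel_geom phi (tau : bool) b : fcoef phi 0 = 1 -> tree_series fps_geom phi tau b ->
  exists Q, fcoef Q 0 = 0 /\ kernel_reduced phi ((1 + Q) ^+ 2) (1 - Q ^+ 2)
    Q (rooted_series fps_geom phi b) tau.
Proof.
move=> phi0 bS; have [//|U [Phi]] := kernel_system _ phi0 bS.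
set P := rooted_series _ _ _ => -[U0 Phi0].
rewrite fps_geom_deriv fps_compXn //; set w := fps_comp _ U => UE PhiE UPhi.
have w1 : w - U * w = 1 by rewrite -(fps_geom_compE U0) -/w; ring.
pose Q := U * w; have wE : w = 1 + Q by rewrite -w1 /Q; ring.
have Q0 : fcoef Q 0 = 0 by rewrite fcoef0M U0 mul0r.
have QE : Q = fpsX * ((1 + Q) ^+ 2 * fps_comp (fps_deriv phi) Phi).
  by rewrite -wE {1}/Q {1}UE; ring.
exists Q; split=> //; exists Phi; split=> //; rewrite -wE.
have uw : w \is a GRing.unit by rewrite fps_unitE wE fcoefD fcoef1 Q0 addr0 oner_eq0.
case: {bS} tau PhiE UPhi.
  rewrite mul1r => PhiE UPhi; split; first by rewrite addrC.
  apply: fpsX_inj; move: UPhi; rewrite PhiE => UPhi.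
  have -> : fpsX * ((1 - Q ^+ 2) * fps_comp phi Phi) =
    fpsX * (w * fps_comp phi Phi) - U * (fpsX * (w ^+ 2 * fps_comp phi Phi)).
    have -> : 1 - Q ^+ 2 = w * (1 - Q) by rewrite wE; ring.
    by rewrite /Q; ring.
  by rewrite UPhi; ring.
rewrite mul0r addr0 => PhiE UPhi; split=> //; apply: fpsX_inj; apply: (mulrI uw).
have -> : w * (fpsX * fps_comp phi P) = w * (fpsX * (w * fps_comp phi Phi)) - w * (U * Phi).
  by rewrite UPhi; ring.
have -> : w * (fpsX * (w * fps_comp phi Phi)) = Phi by rewrite [RHS]PhiE; ring.
have -> : w * (fpsX * ((1 - Q ^+ 2) * fps_comp phi Phi)) =
   (1 - Q) * (fpsX * (w ^+ 2 * fps_comp phi Phi)) by rewrite wE; ring.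
by rewrite -PhiE /Q; ring.
Qed.

Lemma inv_uniq (a x y : fps) : a * x = 1 -> a * y = 1 -> x = y.
Proof. by move=> ax ay; rewrite -[x]mulr1 -ay mulrCA mulrA ax mul1r. Qed.

Lemma exp_series_comp_ln y K : fcoef y 0 = 0 -> fcoef K 0 = 1 ->
  K * fps_exp y = 1 -> y = - fps_ln K.
Proof.
move=> y0 K0 KE; apply/eqP; rewrite -addr_eq0; apply/eqP.
rewrite -[X in X + _](fps_expK y0) -fps_lnM ?fcoef_exp0 //.
by rewrite mulrC KE -fps_exp0 fps_expK ?fcoef0.
Qed.

Section Families.
Variables (M K Q P : fps).
Hypotheses (P0 : fcoef P 0 = 0) (Q0 : fcoef Q 0 = 0) (K0 : fcoef K 0 = 1).

(** With g = 1/(1-Phi) one has phi' = g^2 at Phi, so Q (1-Phi) = z M g = Phi, whence g = 1 + Q; then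
    1/(1-P) = K g. *)
Lemma kernel_ordered_all : kernel_reduced fps_geom M K Q P false ->
  Q = fpsX * (M * (1 + Q) ^+ 2) /\ (1 - P) * (K * (1 + Q)) = 1.
Proof.
case=> Phi [Phi0 QE [PhiE phiP]]; move: QE PhiE phiP.
rewrite fps_geom_deriv fps_compXn //; have := fps_geom_compE Phi0; have := fps_geom_compE P0.
set g := fps_comp _ Phi; set h := fps_comp _ P => hE gE QE PhiE phiP.
have QPhi : Q * (1 - Phi) = Phi.
  by rewrite QE [RHS]PhiE -[RHS]mulr1 -[X in _ = _ * X]gE; ring.
have gQ : g = 1 + Q.
  by apply: inv_uniq gE _; rewrite mulrDr mulr1 (mulrC _ Q) QPhi subrK.
by rewrite -gQ -phiP.
Qed.

(** K phi(Phi) = 1 says K = 1 - Phi. Then Q K = z M phi(Phi) = P + Phi, and Phi = 1 - K is known. *)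
Lemma kernel_ordered_prime : kernel_reduced fps_geom M K Q P true ->
  Q * K ^+ 2 = fpsX * M /\ P = (1 + Q) * K - 1.
Proof.
case=> Phi [Phi0 QE [PhiE phiP]]; move: QE PhiE phiP.
rewrite fps_geom_deriv fps_compXn //; have := fps_geom_compE Phi0.
set g := fps_comp _ Phi => gE QE PhiE Kg.
have KE : K = 1 - Phi by apply: (@inv_uniq g); rewrite mulrC.
have QPhi : Q * K = fpsX * (M * g).
  by rewrite QE -[RHS]mulr1 -[X in _ = _ * X]Kg; ring.
split; first by rewrite expr2 mulrA QPhi -[RHS]mulr1 -[X in _ = _ * X]Kg; ring.
by rewrite mulrDl QPhi -PhiE KE; ring.
Qed.

(** As phi' = phi, the two equations for Q and Phi coincide, so Phi = Q; the logarithm of e^P = K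
    e^Q gives P. *)
Lemma kernel_unordered_all : kernel_reduced exp_series M K Q P false ->
  Q = fpsX * (M * fps_exp Q) /\ P = Q + fps_ln K.
Proof.
case=> Phi [Phi0 QE [PhiE phiP]]; move: QE PhiE phiP; rewrite exp_series_deriv.
rewrite -!/(fps_exp _) => QE PhiE phiP.
have QPhi : Q = Phi by rewrite PhiE.
split; first by rewrite {1}QE -QPhi.
by rewrite -[LHS]fps_expK // phiP fps_lnM ?fcoef_exp0 // -QPhi fps_expK // addrC.
Qed.

(** As phi' = phi, one gets Q = P + Phi, while K e^Phi = 1 gives Phi = -ln K. *)
Lemma kernel_unordered_prime : kernel_reduced exp_series M K Q P true ->
  Q * K = fpsX * M /\ P = Q + fps_ln K.
Proof.
case=> Phi [Phi0 QE [PhiE phiP]]; move: QE PhiE phiP; rewrite exp_series_deriv.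
rewrite -!/(fps_exp _) => QE PhiE KPhi.
split; first by rewrite QE -[RHS]mulr1 -[X in _ = _ * X]KPhi; ring.
by rewrite QE -PhiE [in RHS](exp_series_comp_ln Phi0 K0 KPhi) subrK.
Qed.

Variable d : nat.
Hypothesis d_gt0 : (0 < d)%N.

Let Ud : (d%:R : fps) \is a GRing.unit.
Proof. by rewrite fps_unitE fps_natE /= pnatr_eq0 -lt0n. Qed.

Let kap := K `^ (1 / d%:R).
Let kap0 : fcoef kap 0 = 1. Proof. exact: fcoef_pow0. Qed.
Let kapd : kap ^+ d = K. Proof. exact: fps_rootK. Qed.

Lemma dary_series_comp y : fcoef y 0 = 0 ->
  fps_comp ((1 + fpsX) ^+ d) y = (1 + y) ^+ d.
Proof.
move=> y0; rewrite fps_compXn // fps_compD fps_compX //.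
by rewrite -(rmorph1 fps_const) fps_comp_const.
Qed.

Lemma dary_series_deriv_comp y : fcoef y 0 = 0 ->
  fps_comp (fps_deriv ((1 + fpsX) ^+ d)) y = d%:R * (1 + y) ^+ (d - 1).
Proof.
move=> y0; case: d d_gt0 => // k _; rewrite fps_derivXn subn1 /=.
rewrite fps_derivD fps_derivX fps_deriv1 add0r mulr1 fps_compM // fps_compXn //.
rewrite fps_compD fps_compX // fps_natE -(rmorph1 fps_const) !fps_comp_const.
by [].
Qed.

(** Here phi' = d (1+Phi)^(d-1), so q = Q/d satisfies q (1+Phi) = Phi. Thus r = 1 + Phi is the
    inverse of 1 - q, and the d-th root of (1+P)^d = K r^d gives P. *)
Lemma kernel_dary_all : kernel_reduced ((1 + fpsX) ^+ d) M K Q P false ->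
  let q := Q / d%:R in exists r, [/\ (1 - q) * r = 1,
    q = fpsX * (M * r ^+ (d - 1)) & 1 + P = kap * r].
Proof.
case=> Phi [Phi0 QE [PhiE phiP]] q; move: QE PhiE phiP.
rewrite !dary_series_comp // dary_series_deriv_comp // => QE PhiE phiP.
have qE : q = fpsX * (M * (1 + Phi) ^+ (d - 1)).
  by apply: (mulIr Ud); rewrite divrK // {1}QE; ring.
have rS : (1 + Phi) ^+ d = (1 + Phi) * (1 + Phi) ^+ (d - 1).
  by rewrite -exprS subn1 prednK.
have qr : q * (1 + Phi) = Phi by rewrite qE [RHS]PhiE rS; ring.
exists (1 + Phi); split=> //; first by rewrite mulrBl qr; ring.
apply: (fps_root_inj d_gt0).
- by rewrite fcoefD P0 fcoef1 addr0.
- by rewrite fcoef0M kap0 fcoefD Phi0 fcoef1 mul1r addr0.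
- by rewrite exprMn kapd.
Qed.

(** The d-th root of K (1+Phi)^d = 1 expresses 1 + Phi as 1 / [kap], and q (1+Phi) = P + Phi with q
    = Q/d. *)
Lemma kernel_dary_prime : kernel_reduced ((1 + fpsX) ^+ d) M K Q P true ->
  let q := Q / d%:R in
  q * kap ^+ (d - 1) = fpsX * M /\ (1 - P) * kap = 1 - q.
Proof.
case=> Phi [Phi0 QE [PhiE phiP]] q; move: QE PhiE phiP.
rewrite !dary_series_comp // dary_series_deriv_comp // => QE PhiE phiP.
have qE : q = fpsX * (M * (1 + Phi) ^+ (d - 1)).
  by apply: (mulIr Ud); rewrite divrK // {1}QE; ring.
have rS : (1 + Phi) ^+ d = (1 + Phi) * (1 + Phi) ^+ (d - 1).
  by rewrite -exprS subn1 prednK.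
have qr : q * (1 + Phi) = P + Phi by rewrite qE PhiE rS; ring.
have kr : kap * (1 + Phi) = 1.
  apply: (fps_root_inj d_gt0); rewrite ?fcoef1 //.
    by rewrite fcoef0M kap0 fcoefD Phi0 fcoef1 mul1r addr0.
  by rewrite exprMn kapd phiP expr1n.
split.
  by rewrite qE -[RHS]mulr1 -[X in _ = _ * X](expr1n _ (d - 1)) -[X in _ = _ * X ^+ _]kr exprMn; ring.
have -> : 1 - P = (1 - q) * (1 + Phi).
  rewrite mulrBl qr; ring.
by rewrite -mulrA (mulrC _ kap) kr mulr1.
Qed.

Lemma bundled_series_deriv_comp y : fcoef y 0 = 0 ->
  fps_comp (fps_deriv (fps_geom ^+ d)) y = d%:R * fps_comp fps_geom y ^+ (d + 1).
Proof.
move=> y0; case: d d_gt0 => // k _; rewrite fps_derivXn addn1.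
rewrite fps_geom_deriv -mulrA -exprD addn2 fps_compM // fps_compXn //.
by rewrite fps_natE !fps_comp_const.
Qed.

(** With g = 1/(1-Phi) one has phi' = d g^(d+1), so q (1-Phi) = Phi and g = 1 + q as for ordered
    trees; a d-th root is then taken. *)
Lemma kernel_bundled_all : kernel_reduced (fps_geom ^+ d) M K Q P false ->
  let q := Q / d%:R in
    q = fpsX * (M * (1 + q) ^+ (d + 1)) /\ (1 - P) * (kap * (1 + q)) = 1.
Proof.
case=> Phi [Phi0 QE [PhiE phiP]] q; move: QE PhiE phiP.
rewrite bundled_series_deriv_comp // !fps_compXn //.
have := fps_geom_compE Phi0; have := fps_geom_compE P0.
have g0 : fcoef (fps_comp fps_geom Phi) 0 = 1 by rewrite fcoef_comp0.
have h0 : fcoef (fps_comp fps_geom P) 0 = 1 by rewrite fcoef_comp0.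
set g := fps_comp _ Phi in g0 *; set h := fps_comp _ P in h0 *.
move=> hE gE QE PhiE phiP.
have qE : q = fpsX * (M * g ^+ (d + 1)).
  by apply: (mulIr Ud); rewrite divrK // {1}QE; ring.
have qPhi : q * (1 - Phi) = Phi.
  by rewrite qE addn1 exprS [RHS]PhiE -[RHS]mulr1 -[X in _ = _ * X]gE; ring.
have gQ : g = 1 + q.
  by apply: inv_uniq gE _; rewrite mulrDr mulr1 (mulrC _ q) qPhi subrK.
split; first by rewrite -gQ.
rewrite -gQ (_ : kap * g = h) //; apply: (fps_root_inj d_gt0) => //.
  by rewrite fcoef0M kap0 g0 mulr1.
by rewrite exprMn kapd.
Qed.

(** As for ordered trees, with [kap], the d-th root of K, in place of K: [kap] = 1 - Phi and q [kap]
    = P + Phi. *)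
Lemma kernel_bundled_prime : kernel_reduced (fps_geom ^+ d) M K Q P true ->
  let q := Q / d%:R in
    q * kap ^+ (d + 1) = fpsX * M /\ P = (1 + q) * kap - 1.
Proof.
case=> Phi [Phi0 QE [PhiE phiP]] q; move: QE PhiE phiP.
rewrite bundled_series_deriv_comp // !fps_compXn //.
have := fps_geom_compE Phi0.
have g0 : fcoef (fps_comp fps_geom Phi) 0 = 1 by rewrite fcoef_comp0.
set g := fps_comp _ Phi in g0 * => gE QE PhiE phiP.
have qE : q = fpsX * (M * g ^+ (d + 1)).
  by apply: (mulIr Ud); rewrite divrK // {1}QE; ring.
have kg : kap * g = 1.
  apply: (fps_root_inj d_gt0); rewrite ?fcoef1 //.
    by rewrite fcoef0M kap0 g0 mulr1.
  by rewrite exprMn kapd phiP expr1n.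
have kE : kap = 1 - Phi by apply: (@inv_uniq g); rewrite mulrC.
have qk : q * kap = P + Phi.
  by rewrite qE PhiE addn1 exprS -[RHS]mulr1 -[X in _ = _ * X]kg; ring.
split.
  by rewrite qE -[RHS]mulr1 -[X in _ = _ * X](expr1n _ (d + 1)) -[X in _ = _ * X ^+ _]kg exprMn; ring.
by rewrite mulrDl qk kE; ring.
Qed.

End Families.

(** * Closed forms *)

Lemma given_byI A H E Q : contractive E -> fcoef Q 0 = 0 -> Q = E Q -> A = H Q ->
  given_by A H E.
Proof.
move=> cE Q0 QE AE; exists Q; split=> //; split=> // Q' [_ Q'E].
exact: contractive_uniq cE QE Q'E.
Qed.

Lemma contractive_XM E h : (forall Q, E Q = fpsX * h Q) ->
  (forall n f g, eqm n f g -> eqm n (h f) (h g)) -> contractive E.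
Proof. by move=> EE hE n f g fg; rewrite !EE; apply: eqm_XM; apply: hE. Qed.

Lemma eq_1B (A D : fps) : (1 - A) * D = 1 -> A = 1 - 1 / D.
Proof. by move=> AD; rewrite mulrC in AD; rewrite mul1r (mulr1_eq AD) subKr. Qed.

(** Contractivity is read off the shape of an equation: z times an expression built from operations
    that respect congruence modulo z^n. *)
Ltac eqm_congr := cbv beta; repeat lazymatch goal with
  | |- eqm _ ?a ?a => exact: eqm_refl
  | |- eqm _ (_ * _) (_ * _) => apply: eqmM
  | |- eqm _ (_ + _) (_ + _) => apply: eqmD
  | |- eqm _ (- _) (- _) => apply: eqmN
  | |- eqm _ (_ ^+ _) (_ ^+ _) => apply: eqmXn
  | |- eqm _ (_ ^-1) (_ ^-1) => apply: eqm_inv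
  | |- eqm _ (fps_exp _) (fps_exp _) => apply: eqm_exp
  | |- eqm _ (_ `^ _) (_ `^ _) => apply: eqm_pow
  | |- _ => assumption
  end.
Ltac contract := apply: contractive_XM => [? | ? ? ? ?];
  [ rewrite -?mulrA; first [reflexivity | rewrite mulrCA; reflexivity] | eqm_congr ].

Lemma fcoef_1B0 y : fcoef y 0 = 0 -> fcoef (1 - y) 0 = 1.
Proof. by move=> y0; rewrite fcoefD fcoefN y0 fcoef1 subr0. Qed.

Lemma fcoef_1D0 y : fcoef y 0 = 0 -> fcoef (1 + y) 0 = 1.
Proof. by move=> y0; rewrite fcoefD y0 fcoef1 addr0. Qed.

Lemma fcoef_K_exp Q : fcoef Q 0 = 0 -> fcoef (fps_exp Q * (1 - Q)) 0 = 1.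
Proof. by move=> Q0; rewrite fcoef0M fcoef_exp0 fcoef_1B0 ?mulr1. Qed.

Lemma fcoef_K_geom Q : fcoef Q 0 = 0 -> fcoef (1 - Q ^+ 2) 0 = 1.
Proof. by move=> Q0; rewrite fcoef_1B0 // fcoef0M Q0 mulr0. Qed.

Lemma given_ordered_exp_all b : tree_series exp_series fps_geom false b ->
  given_by (rooted_series exp_series fps_geom b)
            (fun Q => 1 - 1 / ((1 - Q) * (1 + Q) * fps_exp Q))
            (fun Q => fpsX * (1 + Q) ^+ 2 * fps_exp Q).
Proof.
move=> bS; have [//|Q [Q0 red]] := kernel_exp _ bS.
have [QE PE] := kernel_ordered_all (rooted_series0 _ _ _) red.
apply: (given_byI _ Q0); first contract.
by rewrite {1}QE; ring.
by apply: eq_1B; rewrite -[RHS]PE; ring.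
Qed.

Lemma given_ordered_geom_all b : tree_series fps_geom fps_geom false b ->
  given_by (rooted_series fps_geom fps_geom b)
            (fun Q => 1 - 1 / ((1 + Q) ^+ 2 * (1 - Q)))
            (fun Q => fpsX * (1 + Q) ^+ 4).
Proof.
move=> bS; have [//|Q [Q0 red]] := kernel_geom _ bS.
have [QE PE] := kernel_ordered_all (rooted_series0 _ _ _) red.
apply: (given_byI _ Q0); first contract.
  by rewrite {1}QE; ring.
by apply: eq_1B; rewrite -[RHS]PE; ring.
Qed.

Lemma given_ordered_exp_prime b : tree_series exp_series fps_geom true b ->
  given_by (rooted_series exp_series fps_geom b)
            (fun Q => (1 + Q) * (1 - Q) * fps_exp Q - 1)
            (fun Q => fpsX / ((1 - Q) ^+ 2 * fps_exp Q)).
Proof.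
move=> bS; have [//|Q [Q0 red]] := kernel_exp _ bS.
have [QE PE] := kernel_ordered_prime red.
have Ue : fps_exp Q \is a GRing.unit by rewrite fps_unitE fcoef_exp0 oner_eq0.
apply: (given_byI _ Q0); first contract.
  apply: fps_eq_div; first by rewrite fcoef0M fcoef0X fcoef_1B0 ?fcoef_exp0 // expr1n mulr1 oner_eq0.
  by apply: (mulIr Ue); rewrite -[RHS]QE; ring.
by rewrite [LHS]PE; ring.
Qed.

Lemma given_ordered_geom_prime b : tree_series fps_geom fps_geom true b ->
  given_by (rooted_series fps_geom fps_geom b)
            (fun Q => (1 + Q) ^+ 2 * (1 - Q) - 1)
            (fun Q => fpsX / (1 - Q) ^+ 2).
Proof.
move=> bS; have [//|Q [Q0 red]] := kernel_geom _ bS.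
have [QE PE] := kernel_ordered_prime red.
have Ue : (1 + Q) ^+ 2 \is a GRing.unit.
  by rewrite fps_unitE fcoef0X fcoef_1D0 // expr1n oner_eq0.
apply: (given_byI _ Q0); first contract.
  apply: fps_eq_div; first by rewrite fcoef0X fcoef_1B0 // expr1n oner_eq0.
  by apply: (mulIr Ue); rewrite -[RHS]QE; ring.
by rewrite [LHS]PE; ring.
Qed.

Lemma fps_ln_K_exp Q : fcoef Q 0 = 0 ->
  fps_ln (fps_exp Q * (1 - Q)) = Q + fps_ln (1 - Q).
Proof. by move=> Q0; rewrite fps_lnM ?fcoef_exp0 ?fcoef_1B0 // fps_expK. Qed.

Lemma fps_ln_K_geom Q : fcoef Q 0 = 0 ->
  fps_ln (1 - Q ^+ 2) = fps_ln (1 + Q) + fps_ln (1 - Q).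
Proof.
move=> Q0; rewrite -fps_lnM ?fcoef_1B0 ?fcoef_1D0 //; congr fps_ln; ring.
Qed.

Lemma given_unordered_exp_all b : tree_series exp_series exp_series false b ->
  given_by (rooted_series exp_series exp_series b)
            (fun Q => 2%:R * Q + fps_ln (1 - Q))
            (fun Q => fpsX * fps_exp (2%:R * Q)).
Proof.
move=> bS; have [|Q [Q0 red]] := kernel_exp _ bS; first by rewrite /= invr1.
have [QE PE] := kernel_unordered_all (rooted_series0 _ _ _) Q0 (fcoef_K_exp Q0) red.
apply: (given_byI _ Q0); first contract.
  by rewrite {1}QE fps_exp_natM.
by rewrite [LHS]PE fps_ln_K_exp //; ring.
Qed.

Lemma given_unordered_geom_all b : tree_series fps_geom exp_series false b ->
  given_by (rooted_series fps_geom exp_series b)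
            (fun Q => Q + fps_ln (1 + Q) + fps_ln (1 - Q))
            (fun Q => fpsX * (1 + Q) ^+ 2 * fps_exp Q).
Proof.
move=> bS; have [|Q [Q0 red]] := kernel_geom _ bS; first by rewrite /= invr1.
have [QE PE] := kernel_unordered_all (rooted_series0 _ _ _) Q0 (fcoef_K_geom Q0) red.
apply: (given_byI _ Q0); first contract.
  by rewrite {1}QE mulrA.
by rewrite [LHS]PE fps_ln_K_geom // addrA.
Qed.

Lemma given_unordered_exp_prime b : tree_series exp_series exp_series true b ->
  given_by (rooted_series exp_series exp_series b)
            (fun Q => 2%:R * Q + fps_ln (1 - Q))
            (fun Q => fpsX / (1 - Q)).
Proof.
move=> bS; have [|Q [Q0 red]] := kernel_exp _ bS; first by rewrite /= invr1.
have [QE PE] := kernel_unordered_prime (fcoef_K_exp Q0) red.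
have Ue : fps_exp Q \is a GRing.unit by rewrite fps_unitE fcoef_exp0 oner_eq0.
apply: (given_byI _ Q0); first contract.
  apply: fps_eq_div; first by rewrite fcoef_1B0 // oner_eq0.
  by apply: (mulIr Ue); rewrite -[RHS]QE; ring.
by rewrite [LHS]PE fps_ln_K_exp //; ring.
Qed.

Lemma given_unordered_geom_prime b : tree_series fps_geom exp_series true b ->
  given_by (rooted_series fps_geom exp_series b)
            (fun Q => Q + fps_ln (1 + Q) + fps_ln (1 - Q))
            (fun Q => fpsX * (1 + Q) / (1 - Q)).
Proof.
move=> bS; have [|Q [Q0 red]] := kernel_geom _ bS; first by rewrite /= invr1.
have [QE PE] := kernel_unordered_prime (fcoef_K_geom Q0) red.
have Ue : 1 + Q \is a GRing.unit.
  by rewrite fps_unitE fcoef_1D0 // oner_eq0.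
apply: (given_byI _ Q0); first contract.
  apply: fps_eq_div; first by rewrite fcoef_1B0 // oner_eq0.
  apply: (mulIr Ue); transitivity (fpsX * (1 + Q) ^+ 2); last by ring.
  by rewrite -QE; ring.
by rewrite [LHS]PE fps_ln_K_geom // addrA.
Qed.

Section Degree.
Variable d : nat.
Hypothesis d_gt0 : (0 < d)%N.

Let Ud : (d%:R : fps) \is a GRing.unit.
Proof. by rewrite fps_unitE fps_natE /= pnatr_eq0 -lt0n. Qed.

Let fcoef_div0 Q : fcoef Q 0 = 0 -> fcoef (Q / d%:R) 0 = 0.
Proof. by move=> Q0; rewrite fcoef0M Q0 mul0r. Qed.

Let dmul_div (Q : fps) : d%:R * (Q / d%:R) = Q.
Proof. by rewrite mulrC divrK. Qed.

Let d0 : d%:R != 0 :> rat. Proof. by rewrite pnatr_eq0 -lt0n. Qed.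

Let natr_pred : d%:R - 1 = (d - 1)%:R :> rat. Proof. by rewrite natrB. Qed.

Let root_K_exp q : fcoef q 0 = 0 ->
  (fps_exp (d%:R * q) * (1 - d%:R * q)) `^ (1 / d%:R) =
  (1 - d%:R * q) `^ (1 / d%:R) * fps_exp q.
Proof.
move=> q0; have dq0 : fcoef (d%:R * q) 0 = 0 by rewrite fcoef0M q0 mulr0.
rewrite fps_powMl ?fcoef_exp0 ?fcoef_1B0 // mulrC; congr (_ * _).
by symmetry; apply: fps_root_uniq; rewrite ?fcoef_exp0 ?fps_exp_natM.
Qed.

Let root_K_geom Q : fcoef Q 0 = 0 -> (1 - Q ^+ 2) `^ (1 / d%:R) =
  (1 + Q) `^ (1 / d%:R) * (1 - Q) `^ (1 / d%:R).
Proof.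
move=> Q0; rewrite -fps_powMl ?fcoef_1B0 ?fcoef_1D0 //; congr (_ `^ _); ring.
Qed.

Let root_pow f k : fcoef f 0 = 1 -> f `^ (k%:R / d%:R) = f `^ (1 / d%:R) ^+ k.
Proof. by move=> f0; rewrite fps_powXn // mul1r mulrC. Qed.

Let mulKd (q : fps) : d%:R * q / d%:R = q. Proof. by rewrite mulrC mulKr. Qed.

(** For parking functions on d-ary and d-bundled trees the variable of the closed forms is Q/d, with
    Q that of the kernel system; for distributions it is Q itself. *)
Lemma kernel_exp_scaled phi tau b : fcoef phi 0 = 1 -> tree_series exp_series phi tau b ->
  exists q, fcoef q 0 = 0 /\ kernel_reduced phi (fps_exp q ^+ d)
    (fps_exp (d%:R * q) * (1 - d%:R * q)) (d%:R * q) (rooted_series exp_series phi b) tau.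
Proof.
move=> phi0 bS; have [Q [Q0 red]] := kernel_exp phi0 bS.
exists (Q / d%:R); split; first exact: fcoef_div0.
by rewrite -fps_exp_natM ?fcoef_div0 // !dmul_div.
Qed.

Let dary0 : fcoef ((1 + fpsX) ^+ d) 0 = 1.
Proof. by rewrite fcoef0X fcoef_1D0 // expr1n. Qed.

Let bundled0 : fcoef (fps_geom ^+ d) 0 = 1.
Proof. by rewrite fcoef0X expr1n. Qed.

Let fcoef_dM0 q : fcoef q 0 = 0 -> fcoef (d%:R * q) 0 = 0.
Proof. by move=> q0; rewrite fcoef0M q0 mulr0. Qed.

Let fcoef_1B_neq0 q n : fcoef q 0 = 0 -> fcoef ((1 - q) ^+ n) 0 != 0.
Proof. by move=> q0; rewrite fcoef0X fcoef_1B0 // expr1n oner_eq0. Qed.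

Lemma given_dary_exp_all b : tree_series exp_series ((1 + fpsX) ^+ d) false b ->
  given_by (rooted_series exp_series ((1 + fpsX) ^+ d) b)
              (fun Q => (1 - d%:R * Q) `^ (1 / d%:R) * fps_exp Q / (1 - Q) - 1)
              (fun Q => fpsX * (fps_exp (d%:R * Q) / (1 - Q) ^+ (d - 1))).
Proof.
move=> bS; have [q [q0 red]] := kernel_exp_scaled dary0 bS.
have := kernel_dary_all (rooted_series0 _ _ _) (fcoef_K_exp (fcoef_dM0 q0)) d_gt0 red.
rewrite root_K_exp // mulKd => -[r [qr qE PE]].
apply: (given_byI _ q0); first contract.
  rewrite {1}qE; congr (_ * _); apply: fps_eq_div; first exact: fcoef_1B_neq0.
  by rewrite -mulrA -exprMn (mulrC r) qr expr1n mulr1 fps_exp_natM.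
by rewrite (mulr1_eq qr) -PE addrAC subrr add0r.
Qed.

Lemma given_bundled_exp_all b : tree_series exp_series (fps_geom ^+ d) false b ->
  given_by (rooted_series exp_series (fps_geom ^+ d) b)
              (fun Q => 1 - 1 / ((1 - d%:R * Q) `^ (1 / d%:R) * (1 + Q) * fps_exp Q))
              (fun Q => fpsX * (1 + Q) ^+ (d + 1) * fps_exp (d%:R * Q)).
Proof.
move=> bS; have [q [q0 red]] := kernel_exp_scaled bundled0 bS.
have := kernel_bundled_all (rooted_series0 _ _ _) (fcoef_K_exp (fcoef_dM0 q0)) d_gt0 red.
rewrite root_K_exp // mulKd => -[qE PE].
apply: (given_byI _ q0); first contract.
  by rewrite {1}qE fps_exp_natM //; ring.
by apply: eq_1B; rewrite -[RHS]PE; ring.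
Qed.

Lemma given_dary_exp_prime b : tree_series exp_series ((1 + fpsX) ^+ d) true b ->
  given_by (rooted_series exp_series ((1 + fpsX) ^+ d) b)
              (fun Q => 1 - (1 - Q) / ((1 - d%:R * Q) `^ (1 / d%:R) * fps_exp Q))
              (fun Q => fpsX * (fps_exp Q / (1 - d%:R * Q) `^ ((d%:R - 1) / d%:R))).
Proof.
move=> bS; have [q [q0 red]] := kernel_exp_scaled dary0 bS.
have := kernel_dary_prime (fcoef_K_exp (fcoef_dM0 q0)) d_gt0 red.
rewrite root_K_exp // mulKd => -[qE PE].
have Ue : fps_exp q ^+ (d - 1) \is a GRing.unit.
  by rewrite fps_unitE fcoef0X fcoef_exp0 expr1n oner_eq0.
apply: (given_byI _ q0); first contract.
  rewrite mulrA; apply: fps_eq_div; first by rewrite fcoef_pow0 oner_eq0.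
  rewrite natr_pred root_pow ?fcoef_1B0 ?fcoef_dM0 //.
  apply: (mulIr Ue); rewrite -[LHS]mulrA -exprMn qE -[RHS]mulrA.
  by rewrite -exprS subn1 prednK.
rewrite -(fps_eq_div _ PE) ?subKr // fcoef0M fcoef_pow0 fcoef_exp0 mulr1.
by rewrite oner_eq0.
Qed.

Lemma given_bundled_exp_prime b : tree_series exp_series (fps_geom ^+ d) true b ->
  given_by (rooted_series exp_series (fps_geom ^+ d) b)
              (fun Q => (1 - d%:R * Q) `^ (1 / d%:R) * (1 + Q) * fps_exp Q - 1)
              (fun Q => fpsX / ((1 - d%:R * Q) `^ ((d%:R + 1) / d%:R) * fps_exp Q)).
Proof.
move=> bS; have [q [q0 red]] := kernel_exp_scaled bundled0 bS.
have := kernel_bundled_prime (fcoef_K_exp (fcoef_dM0 q0)) d_gt0 red.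
rewrite root_K_exp // mulKd => -[qE PE].
have Ue : fps_exp q ^+ d \is a GRing.unit.
  by rewrite fps_unitE fcoef0X fcoef_exp0 expr1n oner_eq0.
apply: (given_byI _ q0); first contract.
  apply: fps_eq_div; first by rewrite fcoef0M fcoef_pow0 fcoef_exp0 mulr1 oner_eq0.
  rewrite natr1 -addn1 root_pow ?fcoef_1B0 ?fcoef_dM0 //.
  by apply: (mulIr Ue); rewrite -[RHS]qE exprMn addn1 !exprS; ring.
by rewrite [LHS]PE; ring.
Qed.

Lemma given_dary_geom_all b : tree_series fps_geom ((1 + fpsX) ^+ d) false b ->
  given_by (rooted_series fps_geom ((1 + fpsX) ^+ d) b)
              (fun Q => (1 - Q ^+ 2) `^ (1 / d%:R) / (1 - Q / d%:R) - 1)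
              (fun Q => d%:R * fpsX * (1 + Q) ^+ 2 / (1 - Q / d%:R) ^+ (d - 1)).
Proof.
move=> bS; have [Q [Q0 red]] := kernel_geom dary0 bS.
have [r [qr qE PE]] := kernel_dary_all (rooted_series0 _ _ _) (fcoef_K_geom Q0) d_gt0 red.
apply: (given_byI _ Q0); first contract.
  apply: fps_eq_div; first exact: fcoef_1B_neq0 (fcoef_div0 Q0).
  rewrite -{1}(dmul_div Q) {1}qE.
  transitivity (d%:R * fpsX * (1 + Q) ^+ 2 * ((1 - Q / d%:R) * r) ^+ (d - 1)).
    by rewrite exprMn; ring.
  by rewrite qr expr1n mulr1.
by rewrite (mulr1_eq qr) -PE addrAC subrr add0r.
Qed.

Lemma given_bundled_geom_all b : tree_series fps_geom (fps_geom ^+ d) false b ->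
  given_by (rooted_series fps_geom (fps_geom ^+ d) b)
              (fun Q => 1 - 1 / ((1 + Q / d%:R) * (1 - Q ^+ 2) `^ (1 / d%:R)))
              (fun Q => d%:R * fpsX * (1 + Q) ^+ 2 * (1 + Q / d%:R) ^+ (d + 1)).
Proof.
move=> bS; have [Q [Q0 red]] := kernel_geom bundled0 bS.
have [qE PE] := kernel_bundled_all (rooted_series0 _ _ _) (fcoef_K_geom Q0) d_gt0 red.
apply: (given_byI _ Q0); first contract.
  by rewrite -{1}(dmul_div Q) {1}qE; ring.
by apply: eq_1B; rewrite -[RHS]PE; ring.
Qed.

Lemma given_dary_geom_prime b : tree_series fps_geom ((1 + fpsX) ^+ d) true b ->
  given_by (rooted_series fps_geom ((1 + fpsX) ^+ d) b)
              (fun Q => 1 - (1 - Q / d%:R) / (1 - Q ^+ 2) `^ (1 / d%:R))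
              (fun Q => d%:R * fpsX * (1 + Q) `^ ((d%:R + 1) / d%:R)
                          / (1 - Q) `^ ((d%:R - 1) / d%:R)).
Proof.
move=> bS; have [Q [Q0 red]] := kernel_geom dary0 bS.
have [qE PE] := kernel_dary_prime (fcoef_K_geom Q0) d_gt0 red.
have k0 := fcoef_K_geom Q0.
apply: (given_byI _ Q0); first contract.
  apply: fps_eq_div; first by rewrite fcoef_pow0 oner_eq0.
  rewrite natr1 natr_pred !root_pow ?fcoef_1B0 ?fcoef_1D0 //.
  (* Multiplying by (1+Q)^((d-1)/d) turns the root of 1 - Q into one of 1 - Q^2, that is into the
     d-th root of K; on the other side (d+1) + (d-1) = 2d makes the power (1+Q)^2. *)
  have Ua : (1 + Q) `^ (1 / d%:R) ^+ (d - 1) \is a GRing.unit.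
    by rewrite fps_unitE fcoef0X fcoef_pow0 expr1n oner_eq0.
  apply: (mulIr Ua); rewrite -[LHS]mulrA -exprMn (mulrC (_ `^ _)) -root_K_geom //.
  rewrite -{1}(dmul_div Q) -[LHS]mulrA qE -[RHS]mulrA -exprD.
  rewrite -[in LHS](fps_rootK d_gt0 (fcoef_1D0 Q0)) -exprM.
  by rewrite (_ : d.+1 + (d - 1) = d * 2)%N; [ring | lia].
by rewrite -(fps_eq_div _ PE) ?subKr // fcoef_pow0 oner_eq0.
Qed.

Lemma given_bundled_geom_prime b : tree_series fps_geom (fps_geom ^+ d) true b ->
  given_by (rooted_series fps_geom (fps_geom ^+ d) b)
              (fun Q => (1 + Q / d%:R) * (1 - Q ^+ 2) `^ (1 / d%:R) - 1)
              (fun Q => d%:R * fpsX * (1 + Q) `^ ((d%:R - 1) / d%:R)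
                          / (1 - Q) `^ ((d%:R + 1) / d%:R)).
Proof.
move=> bS; have [Q [Q0 red]] := kernel_geom bundled0 bS.
have [qE PE] := kernel_bundled_prime (fcoef_K_geom Q0) d_gt0 red.
apply: (given_byI _ Q0); first contract.
  apply: fps_eq_div; first by rewrite fcoef_pow0 oner_eq0.
  rewrite natr1 natr_pred !root_pow ?fcoef_1B0 ?fcoef_1D0 //.
  (* As in the d-ary case, now with the factor (1+Q)^((d+1)/d). *)
  have Ua : (1 + Q) `^ (1 / d%:R) ^+ (d + 1) \is a GRing.unit.
    by rewrite fps_unitE fcoef0X fcoef_pow0 expr1n oner_eq0.
  apply: (mulIr Ua); rewrite -addn1 -[LHS]mulrA -exprMn (mulrC (_ `^ _)) -root_K_geom //.
  rewrite -{1}(dmul_div Q) -[LHS]mulrA qE -[RHS]mulrA -exprD.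
  rewrite -[in LHS](fps_rootK d_gt0 (fcoef_1D0 Q0)) -exprM.
  by rewrite (_ : (d - 1) + (d + 1) = d * 2)%N; [ring | lia].
exact: PE.
Qed.

End Degree.

(** * Counting forests by excess *)

Fact shift_series_is_additive tau : {morph shift_series tau : f g / f - g}.
Proof.
by move=> f g; apply: fpsP => n; rewrite fcoefD fcoefN /=; case: ifP; rewrite ?subr0.
Qed.

HB.instance Definition _ tau :=
  GRing.isZmodMorphism.Build fps fps (shift_series tau) (shift_series_is_additive tau).

Lemma shift_series_natM tau n f : shift_series tau (n%:R * f) = n%:R * shift_series tau f.
Proof. by rewrite !mulr_natl raddfMn. Qed.

Lemma fcoef_shift tau f e :
  fcoef (shift_series tau f) e = if (e < tau)%N then 0 else fcoef f e.+1.
Proof. by []. Qed.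

Lemma shift_series_monomial tau a k : shift_series tau (fps_const a * fpsX ^+ k) =
  if (tau < k)%N then fps_const a * fpsX ^+ k.-1 else 0.
Proof.
apply: fpsP => e; rewrite fcoef_shift fcoef_constM fcoef_Xn.
case: ltnP => te.
  case: ifP => tk; last by rewrite fcoef0.
  by rewrite fcoef_constM fcoef_Xn; case: eqP => [ek|]; rewrite ?mulr0 //; lia.
case: ifP => tk; first by rewrite fcoef_constM fcoef_Xn; case: k tk.
by rewrite fcoef0; case: eqP => [ek|]; rewrite ?mulr0 //; lia.
Qed.

Lemma sum_subsets_card (R : nmodType) (T : finType) (B : {set T}) (f : nat -> R) :
  \sum_(C : {set T} | C \subset B) f #|C| = \sum_(c < #|B|.+1) f c *+ 'C(#|B|, c).
Proof.
rewrite (partition_big (fun C : {set T} => inord #|C| : 'I_(#|B|.+1)) xpredT) //.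
apply: eq_bigr => c _; rewrite -cards_draws -sumr_const.
have cB (C : {set T}) : C \subset B -> (inord #|C| == c) = (#|C| == c).
  by move=> CB; rewrite -val_eqE /= inordK // ltnS subset_leq_card.
rewrite [RHS](eq_bigl (fun C : {set T} => (C \subset B) && (inord #|C| == c))); last first.
  by move=> C; rewrite inE; case: (boolP (C \subset B)) => //= /cB->.
by apply: eq_bigr => C /andP[CB]; rewrite cB // => /eqP->.
Qed.

Lemma sum_forests_on (R : nmodType) n k (A : {set 'I_n}) (g : forest 'I_n -> R) : A != set0 ->
  \sum_(t <- forests_on k.+1 A) g t =
  \sum_(v in A) \sum_(C : {set 'I_n} | C \subset A :\ v) \sum_(m < n.+1)
    \sum_(l <- forests_on k C) \sum_(r <- forests_on k (A :\ v :\: C)) g (Node v m l r).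
Proof.
move=> A0; rewrite /= (negbTE A0) big_flatten big_map big_enum_cond /= !pair_big_dep /=.
apply: eq_big => [[[v C] m]|[[v C] m] _]; first by rewrite !inE !andbT.
by rewrite big_map big_allpairs.
Qed.

Lemma sum_trees_on_all (R : nmodType) n (g : forest 'I_n -> R) :
  \sum_(t <- trees_on_all n) g t = \sum_v \sum_(m < n.+1)
    \sum_(l <- forests_on n [set~ v]) g (Node v m l Leaf).
Proof.
rewrite /trees_on_all big_flatten big_map big_enum /= pair_big /=.
by apply: eq_bigr => i _; rewrite big_map.
Qed.

Section Weights.
Variables (W phi : fps) (tau : bool).

Fixpoint weight (L : eqType) (t : forest L) : rat :=
  if t is Node v m l r then
    fcoef phi (size (roots l)) * fcoef W m * weight l * weight r
  else 1.

(* The exponent is the excess of drivers over nodes; the shift accounts for   *)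
(* the driver parking at v and cancels the terms violating the constraint.    *)
Fixpoint excess_series (L : eqType) (t : forest L) : fps :=
  if t is Node v m l r then
    shift_series tau (fps_const (fcoef phi (size (roots l))) * fps_const (fcoef W m) * fpsX ^+ m
      * excess_series l) * excess_series r
  else 1.

(** The shifts annihilate exactly the forests violating [excess_ok]; the others contribute one
    monomial. *)
Lemma excess_seriesE (L : eqType) (t : forest L) : excess_series t =
  if excess_ok tau t then fps_const (weight t) * fpsX ^+ (drivers t - size (labels t)) else 0.
Proof.
elim: t => [|v m l IHl r IHr]; first by rewrite /= rmorph1 expr0 mulr1.
rewrite [LHS]/= {}IHl {}IHr.
have -> : excess_ok tau (Node v m l r) =
  [&& (size (labels l)).+1 + tau <= m + drivers l, excess_ok tau l & excess_ok tau r]%N by [].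
case: (boolP (excess_ok tau l)) => okl; last by rewrite mulr0 raddf0 mul0r andbF.
case: (boolP (excess_ok tau r)) => okr; last by rewrite mulr0 !andbF.
have hl := excess_ok_le okl; have hr := excess_ok_le okr.
have -> : fps_const (fcoef phi (size (roots l))) * fps_const (fcoef W m) * fpsX ^+ m
   * (fps_const (weight l) * fpsX ^+ (drivers l - size (labels l))) =
   fps_const (fcoef phi (size (roots l)) * fcoef W m * weight l) * fpsX ^+ (m + (drivers l - size (labels l))).
  by rewrite !rmorphM exprD; ring.
rewrite shift_series_monomial !andbT.
rewrite (_ : (tau < _)%N = ((size (labels l)).+1 + tau <= m + drivers l)%N); last by lia.
case: ifP => h; last by rewrite mul0r.
have -> : (drivers (Node v m l r) - size (labels (Node v m l r)) =
    (m + (drivers l - size (labels l))).-1 + (drivers r - size (labels r)))%N.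
  by rewrite /= size_cat; lia.
have -> : weight (Node v m l r) = fcoef phi (size (roots l)) * fcoef W m * weight l * weight r by [].
by rewrite exprD !rmorphM; ring.
Qed.

Variables (n : nat) (b : nat -> fps).
Let Wn : fps := \sum_(m < n.+1) fps_const (fcoef W m) * fpsX ^+ m.
Hypothesis bS : tree_series Wn phi tau b.

Lemma sum_excess_below k (C : {set 'I_n}) :
  (\sum_(l <- forests_on k C) fps_const (fcoef phi (size (roots l))) * excess_series l =
    #|C|`!%:R * phisum phi b #|C|) ->
  \sum_(m < n.+1) \sum_(l <- forests_on k C)
     shift_series tau (fps_const (fcoef phi (size (roots l))) * fps_const (fcoef W m) * fpsX ^+ m
      * excess_series l) = #|C|`!%:R * b #|C|.+1.
Proof.
move=> E; rewrite bS.2 -shift_series_natM mulrCA -E /Wn mulr_suml raddf_sum.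
apply: eq_bigr => m _; rewrite mulr_sumr raddf_sum; apply: eq_bigr => l _.
by congr shift_series; ring.
Qed.

(** An ordered forest with j trees contributes to the coefficient of z^|A| in B^j. The weight [psi]
    on the number of roots is arbitrary because removing the first tree replaces it by its shift,
    while the forest below the first root needs the weight [phi]. *)
Lemma sum_forests k (A : {set 'I_n}) (psi : nat -> fps) M : (#|A| <= k)%N -> (#|A| < M)%N ->
  \sum_(t <- forests_on k A) psi (size (roots t)) * excess_series t =
  #|A|`!%:R * \sum_(j < M) psi j * cpow b j #|A|.
Proof.
have leaf psi' M' : (0 < M')%N -> \sum_(t <- [:: Leaf : forest 'I_n]) psi' (size (roots t)) * excess_series t =
   0`!%:R * \sum_(j < M') psi' j * cpow b j 0.
  case: M' => // M' _; rewrite big_seq1 big_ord_recl big1 => [|i _].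
    by rewrite addr0 fact0 mul1r.
  by rewrite cpow_small ?mulr0 // bS.1.
elim: k A psi M => [|k IHk] A psi M Ak AM.
  by move: Ak AM; rewrite leqn0 => /eqP-> M0; apply: leaf.
case: (eqVneq A set0) => [A0|A0].
  by rewrite {1}A0 /= eqxx A0 cards0; apply: leaf; apply: leq_ltn_trans AM.
rewrite sum_forests_on //.
have := A0; rewrite -card_gt0; case Aa: #|A| AM Ak => [//|a] AM Ak _.
case: M AM => // M aM; rewrite ltnS in aM; have ak : (a <= k)%N by [].
(* The contribution of a first tree with c + 1 nodes. The sets C of size c below its root cancel the
   factorials, c! (a-c)! binom(a,c) = a!, and the a + 1 choices of the root label restore (a+1)!. *)
pose f c : fps := b c.+1 * \sum_(j < M) psi j.+1 * cpow b j (a - c)%N.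
transitivity (\sum_(v in A) a`!%:R * \sum_(c < a.+1) f c).
  apply: eq_bigr => v vA.
  have cB : #|A :\ v| = a by apply/eqP; rewrite -eqSS -Aa (cardsD1 v A) vA.
  transitivity (\sum_(C : {set 'I_n} | C \subset A :\ v) (#|C|`! * (a - #|C|)`!)%N%:R * f #|C|).
    apply: eq_bigr => C CA; have [Ck Dk] := card_split (leq_trans (leqnn _) (eq_leq Aa)) vA CA.
    have Cle : (#|C| <= a)%N by rewrite -cB subset_leq_card.
    have Dc : #|A :\ v :\: C| = (a - #|C|)%N by rewrite cardsD (setIidPr CA) cB.
    have E1 : \sum_(m < n.+1) \sum_(l <- forests_on k C)
        shift_series tau (fps_const (fcoef phi (size (roots l))) * fps_const (fcoef W m) * fpsX ^+ m
      * excess_series l) = #|C|`!%:R * b #|C|.+1.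
      apply: sum_excess_below; rewrite (IHk _ (fun j => fps_const (fcoef phi j)) #|C|.+1) //.
      exact: leq_trans Cle ak.
    have E2 := IHk (A :\ v :\: C) (fun j => psi j.+1) M.
    rewrite Dc in E2; rewrite natrM /f mulrACA -E1 -E2; last 2 first.
    - exact: leq_trans (leq_subr _ _) ak.
    - exact: leq_ltn_trans (leq_subr _ _) aM.
    rewrite mulr_suml; apply: eq_bigr => m _; rewrite mulr_suml; apply: eq_bigr => l _.
    by rewrite mulr_sumr; apply: eq_bigr => r _ /=; rewrite mulrCA.
  rewrite (sum_subsets_card _ (fun c => (c`! * (a - c)`!)%N%:R * f c)) cB mulr_sumr; apply: eq_bigr => c _.
  by rewrite -mulrnAl -mulrnA mulnC bin_fact // -ltnS.
rewrite sumr_const Aa -[LHS]mulr_natl mulrA -natrM -factS; congr (_ * _).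
rewrite [RHS]big_ord_recl /= mulr0 add0r.
transitivity (\sum_(j < M) \sum_(c < a.+1) psi j.+1 * (b c.+1 * cpow b j (a - c)%N)).
  rewrite exchange_big; apply: eq_bigr => c _; rewrite /f mulr_sumr.
  by apply: eq_bigr => j _; ring.
apply: eq_bigr => j _; rewrite -mulr_sumr /= /conv [in RHS]big_ord_recl bS.1 mul0r add0r.
by congr (_ * _); apply: eq_bigr => c _; rewrite lift0 subSS.
Qed.

(** The root itself is not shifted: the coefficient of u selects the trees where exactly one driver
    is left for it. *)
Lemma sum_trees (v : 'I_n) :
  \sum_(m < n.+1) \sum_(l <- forests_on n [set~ v])
    fcoef (fps_const (fcoef phi (size (roots l))) * fps_const (fcoef W m) * fpsX ^+ m
      * excess_series l) 1 =
  n.-1`!%:R * fcoef (Wn * phisum phi b n.-1) 1.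
Proof.
have cv : #|[set~ v]| = n.-1 by have := cardsC1 v; rewrite card_ord.
have cn : (n.-1 <= n)%N by apply: leq_pred.
have := @sum_forests n [set~ v] (fun j => fps_const (fcoef phi j)) n.-1.+1; rewrite cv => /(_ cn (leqnn _)) E.
rewrite -[_ * _]fcoef_constM -fps_natE mulrCA -E /Wn mulr_suml fcoef_sum.
apply: eq_bigr => m _; rewrite mulr_sumr fcoef_sum; apply: eq_bigr => l _.
by congr (fcoef _ 1); ring.
Qed.

End Weights.

(* Only finitely many driver numbers are enumerated for given n, so W has to  *)
(* be truncated; every node costs one order of precision in u.                *)
Lemma tree_series_eqm W W' phi tau b b' N : eqm N W W' ->
  tree_series W phi tau b -> tree_series W' phi tau b' ->
  forall a, eqm (N - a) (phisum phi b a) (phisum phi b' a).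
Proof.
move=> WW [b0 bS] [b'0 b'S].
have cpowE a : (forall i, (i <= a)%N -> eqm (N - i) (b i) (b' i)) ->
    forall k, eqm (N - a) (cpow b k a) (cpow b' k a).
  move=> bb k; elim: k a bb => // k IHk a bb /=; apply: eqm_sum => i _; apply: eqmM.
    by apply: eqm_le (bb _ _); rewrite ?leq_sub2l // -ltnS.
  apply: eqm_le (IHk _ _); first by rewrite leq_sub2l ?leq_subr.
  by move=> j ji; apply: bb; apply: leq_trans ji (leq_subr _ _).
suff bb a : eqm (N - a) (b a) (b' a).
  by move=> a; apply: eqm_sum => k _; apply: eqmM => //; apply: cpowE.
have [k] := ubnP a; elim: k a => // k IHk [|a] ak; first by rewrite b0 b'0.
rewrite bS b'S => e ea; rewrite !fcoef_shift; case: ifP => // _.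
suff : eqm (N - a) (W * phisum phi b a) (W' * phisum phi b' a) by apply; lia.
apply: eqmM; first by apply: eqm_le WW; apply: leq_subr.
apply: eqm_sum => j _; apply: eqmM => //; apply: cpowE => i ia.
by apply: IHk; lia.
Qed.

Lemma fcoef_rooted_trunc W phi tau b n : (0 < n)%N -> tree_series W phi tau b ->
  exists2 b', tree_series (\sum_(m < n.+1) fps_const (fcoef W m) * fpsX ^+ m) phi tau b' &
    fcoef ((\sum_(m < n.+1) fps_const (fcoef W m) * fpsX ^+ m) * phisum phi b' n.-1) 1 =
    fcoef (rooted_series W phi b) n.
Proof.
case: n => // n _ bS; set Wn := \sum_(m < _) _.
have [b' b'S] := tree_series_exists Wn phi tau; exists b' => //=.
have WW : eqm n.+2 Wn W.
  move=> i ni; rewrite fcoef_sum (bigD1 (Ordinal ni)) // big1 => [|j ji].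
    by apply: etrans (addr0 _) _; rewrite fcoef_constM fcoef_Xn eqxx mulr1.
  rewrite fcoef_constM fcoef_Xn; case: eqP => [ij|_]; last exact: mulr0.
  by case/eqP: ji; apply: val_inj; rewrite /= ij.
(* Truncating W at degree n + 1 keeps precision n + 2; the n nodes below the root use up n orders,
   and the two left determine the coefficient of u. *)
have E : eqm 2 (phisum phi b' n) (phisum phi b n).
  by apply: (@eqm_le 2 (n.+2 - n)); [lia | apply: (tree_series_eqm WW b'S bS)].
by apply: (@eqmM 2) => //; apply: (@eqm_le 2 n.+2).
Qed.

(** * Driver sequences and arrangements of children *)

Lemma big_tuple_cons (R : nmodType) (X : finType) k (g : k.+1.-tuple X -> R) :
  \sum_s g s = \sum_x \sum_(t : k.-tuple X) g [tuple of x :: t].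
Proof.
rewrite pair_big /= (reindex (fun p : X * k.-tuple X => [tuple of p.1 :: p.2])) //.
exists (fun s => (thead s, behead_tuple s)) => [[x t] _|s _] /=.
  by congr (_, _); apply: val_inj.
by rewrite [RHS]tuple_eta.
Qed.

Lemma sum_count_mem (X : finType) (s : seq X) : (\sum_u count_mem u s = size s)%N.
Proof.
elim: s => [|x s IHs] /=; first by rewrite big1.
rewrite big_split /= IHs (bigD1 x) //= eqxx big1 ?addn0 // => u /negbTE ux.
by rewrite eq_sym ux.
Qed.

(** The multinomial coefficient, by induction on the first entry x: it lowers [m x] by one, and the
    sum of [m x] times k! over x is (k+1)!. *)
Lemma card_tuple_count (X : finType) k (m : X -> nat) :
  (#|[set s : k.-tuple X | [forall u, count_mem u s == m u]]| * \prod_u (m u)`! =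
   if \sum_u m u == k then k`! else 0)%N.
Proof.
rewrite -sum1dep_card; elim: k m => [|k IHk] m.
  have [m0|m0] := eqVneq (\sum_u m u)%N 0%N.
    have mE u : m u = 0%N by apply/eqP; move/eqP: m0; rewrite sum_nat_eq0 => /forallP/(_ u).
    rewrite [X in (_ * X)%N]big1 => [|u _]; last by rewrite mE.
    rewrite muln1 (big_pred1 [tuple]) // => s.
    by rewrite (tuple0 s) /= eqxx; apply/forallP => u; rewrite mE.
  rewrite big_pred0 // => s; rewrite (tuple0 s); apply: contraNF m0 => /forallP mE.
  by rewrite big1 // => u _; rewrite -(eqP (mE u)).
rewrite big_mkcond (@big_tuple_cons nat) big_distrl /=.
pose m' x u := (m u - (x == u))%N.
transitivity (\sum_x if \sum_u m u == k.+1 then m x * k`! else 0)%N; last first.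
  case: eqP => [mk|_]; last by rewrite big1.
  by rewrite -[LHS]big_distrl /= mk factS.
apply: eq_bigr => x _; rewrite -big_mkcond /=.
have [mx|mx] := posnP (m x).
  rewrite mx mul0n if_same big_pred0 ?mul0n // => t.
  by apply/forallP => /(_ x); rewrite /= eqxx mx.
have prodE : (\prod_u (m u)`! = m x * \prod_u (m' x u)`!)%N.
  rewrite (bigD1 x) //= [in RHS](bigD1 x) //= /m' eqxx mulnA subn1.
  rewrite -[in LHS](prednK mx) factS prednK //; congr (_ * _)%N.
  by apply: eq_bigr => u /negbTE ux; rewrite eq_sym ux subn0.
have sumE : (\sum_u m u = (\sum_u m' x u).+1)%N.
  rewrite (bigD1 x) //= [in RHS](bigD1 x) //= /m' eqxx -addSn subn1 prednK //; congr (_ + _)%N.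
  by apply: eq_bigr => u /negbTE ux; rewrite eq_sym ux subn0.
rewrite prodE mulnCA sumE eqSS (_ : (if _ then _ else _) = m x * (if (\sum_u m' x u == k)%N then k`! else 0))%N; last first.
  by case: ifP; rewrite ?muln0.
congr (_ * _)%N; rewrite -IHk; congr (_ * _)%N; apply: eq_bigl => t.
apply: eq_forallb => u; rewrite /m' /=; case: (eqVneq x u) => [<-|_]; last by rewrite /= subn0.
by apply/eqP/eqP; lia.
Qed.

(** A multiset has one increasing enumeration, obtained by sorting any list with the given
    multiplicities. *)
Lemma card_sorted_tuple_count n (m : 'I_n -> nat) :
  #|[set s : n.-tuple 'I_n | weakly_increasing s & [forall u, count_mem u s == m u]]| =
  (\sum_u m u == n)%N.
Proof.
have [mn|mn] := eqVneq (\sum_u m u)%N n; last first.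
  apply/eqP; rewrite cards_eq0; apply/eqP/setP => s; rewrite !inE.
  apply: contraNF mn => /andP[_ /forallP sm]; rewrite -[X in _ == X](size_tuple s) -sum_count_mem.
  by apply/eqP; apply: eq_bigr => u _; rewrite (eqP (sm u)).
pose leI : rel 'I_n := relpre val leq.
pose s0 := sort leI (flatten [seq nseq (m u) u | u <- enum 'I_n]).
have cs0 u : count_mem u s0 = m u.
  rewrite (permP (permEl (perm_sort _ _))) count_flatten -map_comp sumnE big_map big_enum /=.
  rewrite (bigD1 u) //= count_nseq /= eqxx mul1n big1 ?addn0 // => v /negbTE vu.
  by rewrite count_nseq /= vu.
have ss0 : size s0 == n.
  by rewrite -sum_count_mem -[X in _ == X]mn; apply/eqP; apply: eq_bigr.
rewrite (_ : [set s | _ & _] = [set Tuple ss0]) ?cards1 //.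
have sortedE (s : seq 'I_n) : sorted leq [seq val i | i <- s] = sorted leI s by rewrite sorted_map.
have leI_total : total leI by move=> u v; apply: leq_total.
apply/setP => s; rewrite !inE /weakly_increasing sortedE.
apply/andP/eqP => [[ss /forallP sm]|->]; last first.
  by split; [exact: sort_sorted | apply/forallP => u; rewrite cs0].
apply: val_inj; apply: (@sorted_eq _ leI) => //=.
- by move=> u v w; apply: leq_trans.
- by move=> u v /anti_leq/val_inj.
- exact: sort_sorted.
by apply/allP => u _ /=; rewrite (eqP (sm u)) cs0.
Qed.

(** That is, [phi] is the exponential generating series of the arrangements by their number of
    children. *)
Definition arrangement_count (F : tree_family) (phi : fps) :=
  forall n (A : {set 'I_n}),
  #|[set a : arrangement F n | uniq (children a) & [set x in children a] == A]|%:R =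
  #|A|`!%:R * fcoef phi #|A| :> rat.

Lemma uniq_set_eq n (A : {set 'I_n}) (s : seq 'I_n) :
  uniq s && ([set x in s] == A) = perm_eq s (enum A).
Proof.
apply/andP/idP => [[us /eqP sA]|sA].
  by apply: uniq_perm; rewrite ?enum_uniq // => x; rewrite mem_enum -sA inE.
split; first by rewrite (perm_uniq sA) enum_uniq.
by apply/eqP/setP => x; rewrite inE (perm_mem sA) mem_enum.
Qed.

Lemma card_bseq_perm n (A : {set 'I_n}) :
  #|[set l : n.-bseq 'I_n | perm_eq l (enum A)]| = #|A|`!.
Proof.
rewrite [#|A|]cardE -(size_permutations (enum_uniq A)) cardE -(size_map val).
apply: perm_size; apply: uniq_perm; rewrite ?permutations_uniq //.
  by rewrite map_inj_uniq ?enum_uniq //; apply: val_inj.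
move=> s; rewrite mem_permutations; apply/mapP/idP => [[l] + ->|sA].
  by rewrite mem_enum inE.
have sn : (size s <= n)%N by rewrite (perm_size sA) -cardE -[X in (_ <= X)%N]card_ord max_card.
by exists (Bseq sn) => //; rewrite mem_enum inE.
Qed.

(** A set of children A has |A|! orderings, so for plane families it suffices to count the
    arrangements that list the children in a prescribed order. *)
Lemma arrangement_count_by_list F phi :
  (forall n (l : n.-bseq 'I_n),
    #|[set a : arrangement F n | children a == l]|%:R = fcoef phi (size l)) ->
  arrangement_count F phi.
Proof.
move=> H n A; rewrite -sum1dep_card natr_sum.
rewrite (partition_big (fun a => insub_bseq n (children a)) (fun l : n.-bseq 'I_n => perm_eq l (enum A))); last first.
  move=> a; rewrite uniq_set_eq => aA.
  rewrite /insub_bseq /insubd insubT //= (perm_size aA) -cardE -[X in (_ <= X)%N]card_ord.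
  exact: max_card.
rewrite -card_bseq_perm -sum1dep_card natr_sum mulr_suml; apply: eq_bigr => l lA.
rewrite mul1r [#|A|]cardE -(perm_size lA) -H -sum1dep_card natr_sum; apply: eq_bigl => a.
apply/andP/eqP => [[]|al].
  rewrite uniq_set_eq => aA /eqP<-; rewrite /insub_bseq /insubd insubT //=.
  by rewrite (perm_size aA) -cardE -[X in (_ <= X)%N]card_ord max_card.
by rewrite uniq_set_eq al lA; split=> //; rewrite /insub_bseq valKd.
Qed.

Lemma arrangement_count_ordered : arrangement_count ordered fps_geom.
Proof.
apply: arrangement_count_by_list => n l.
rewrite (_ : [set a | _] = [set l]) ?cards1 //.
by apply/setP => a; rewrite !inE; apply/eqP/eqP => [/val_inj|->].
Qed.

Lemma arrangement_count_unordered : arrangement_count unordered exp_series.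
Proof.
move=> n A; rewrite (_ : [set a | _ & _] = [set A]) ?cards1.
  by rewrite /= mulfV // pnatr_eq0 -lt0n fact_gt0.
by apply/setP => B; rewrite !inE /= enum_uniq set_enum.
Qed.

Definition ffun_cons (X : Type) d (x : X) (f : {ffun 'I_d -> X}) : {ffun 'I_d.+1 -> X} :=
  [ffun i => if unlift ord0 i is Some j then f j else x].

Lemma big_ffun_cons (R : nmodType) (X : finType) d (g : {ffun 'I_d.+1 -> X} -> R) :
  \sum_f g f = \sum_x \sum_(f : {ffun 'I_d -> X}) g (ffun_cons x f).
Proof.
rewrite pair_big /= (reindex (fun p : X * {ffun 'I_d -> X} => ffun_cons p.1 p.2)) //.
exists (fun f : {ffun 'I_d.+1 -> X} => (f ord0, [ffun i : 'I_d => f (lift ord0 i)])) => [[x f] _|f _] /=.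
  congr (_, _); first by rewrite ffunE unlift_none.
  by apply/ffunP => i; rewrite !ffunE liftK.
apply/ffunP => i; rewrite ffunE; case: unliftP => [j ->|->]; by rewrite ?ffunE.
Qed.

Lemma map_ffun_cons (X : Type) d (x : X) (f : {ffun 'I_d -> X}) :
  [seq ffun_cons x f i | i <- enum 'I_d.+1] = x :: [seq f i | i <- enum 'I_d].
Proof.
rewrite enum_ordSl /= ffunE unlift_none -map_comp; congr cons.
by apply: eq_map => i /=; rewrite ffunE liftK.
Qed.

Lemma map_ffun_cons_bseq n (X : Type) d (x : n.-bseq X) (f : {ffun 'I_d -> n.-bseq X}) :
  [seq (ffun_cons x f i : seq X) | i <- enum 'I_d.+1] = (x : seq X) :: [seq (f i : seq X) | i <- enum 'I_d].
Proof.
by have := congr1 (map (fun y : n.-bseq X => y : seq X)) (map_ffun_cons x f); rewrite /= -!map_comp.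
Qed.

(** Induction on d by the factor 1 + x: the first position is empty or holds the head of the
    list. *)
Lemma arrangement_count_dary d : arrangement_count (dary d) ((1 + fpsX) ^+ d).
Proof.
apply: arrangement_count_by_list => n l /=.
have mapE e (a : {ffun 'I_e -> option 'I_n}) :
    pmap a (enum 'I_e) = pmap id [seq a i | i <- enum 'I_e].
  by elim: (enum _) => //= i s ->.
rewrite -sum1dep_card natr_sum; move: l => [l /= _].
elim: d l => [|d IHd] l.
  rewrite expr0 fcoef1 big_mkcond.
  rewrite (eq_bigr (fun=> (size l == 0)%N%:R)) => [|a _].
    by rewrite sumr_const card_ffun card_ord expn0.
  by rewrite mapE enum_ord0 /= (eq_sym _ l); case: l.
rewrite big_mkcond big_ffun_cons exprS mulrDl mul1r fcoefD -IHd.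
rewrite (bigD1 None) //; congr (_ + _).
  by rewrite -big_mkcond; apply: eq_bigl => f; rewrite !mapE map_ffun_cons.
case: l => [|y l].
  rewrite [size _]/= fcoef_XM0 big1 // => -[y|] // _; rewrite big1 // => f _.
  by rewrite mapE map_ffun_cons.
rewrite [size _]/= fcoef_XMS -IHd (bigD1 (Some y)) // -[RHS]addr0; congr (_ + _).
  by rewrite -big_mkcond; apply: eq_bigl => f; rewrite !mapE map_ffun_cons /= eqseq_cons eqxx.
rewrite big1 // => -[z|] // zy; rewrite big1 // => f _.
rewrite mapE map_ffun_cons /= eqseq_cons ifF //.
by apply/negP => /andP[/eqP zy']; case/andP: zy => _; rewrite zy' eqxx.
Qed.

(** Induction on d: the first position takes a prefix of the list and the others its remainder,
    which is the Cauchy product with 1/(1-x). *)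
Lemma arrangement_count_bundled d : arrangement_count (bundled d) (fps_geom ^+ d).
Proof.
apply: arrangement_count_by_list => n l /=.
rewrite -sum1dep_card natr_sum; move: l => [l /=].
elim: d l => [|d IHd] l ln.
  rewrite expr0 fcoef1 big_mkcond.
  rewrite (eq_bigr (fun=> (size l == 0)%N%:R)) => [|a _].
    by rewrite sumr_const card_ffun card_ord expn0.
  by rewrite enum_ord0 /= (eq_sym _ l); case: l {ln}.
rewrite big_mkcond big_ffun_cons exprS fcoefM.
have lk k : (k <= size l)%N -> (size (take k l) <= n)%N by move=> kl; rewrite size_takel // (leq_trans kl).
pose piece (k : 'I_(size l).+1) : n.-bseq 'I_n := insub_bseq n (take k l).
have pieceE k : piece k = take k l :> seq _ by rewrite /piece /insub_bseq /insubd insubT // lk -1?ltnS.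
pose rest (f : {ffun 'I_d -> n.-bseq 'I_n}) := flatten [seq (f i : seq _) | i <- enum 'I_d].
have splitE (x : n.-bseq 'I_n) f : (x ++ rest f == l)%:R =
    \sum_(k < (size l).+1) ((x == piece k) && (rest f == drop k l))%:R :> rat.
  case: eqP => [xl|xl].
    have kx : (size x < (size l).+1)%N by rewrite -xl size_cat ltnS leq_addr.
    rewrite (bigD1 (Ordinal kx)) // big1 => [|k kNx].
      have tk : take (size x) l = x by rewrite -xl take_size_cat.
      have dk : drop (size x) l = rest f by rewrite -xl drop_size_cat.
      have xk : x = piece (Ordinal kx) by apply: val_inj; rewrite /= pieceE tk.
      have fk : rest f = drop (Ordinal kx) l by rewrite dk.
      by rewrite -xk fk !eqxx; symmetry; apply: addr0.
    have xk : x == piece k = false.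
      apply: contraNF kNx => /eqP xk; apply/eqP/val_inj.
      by rewrite /= xk pieceE size_takel // -ltnS.
    by rewrite xk.
  rewrite big1 // => k _; case: eqP => // xk; case: eqP => //= fk.
  by case: xl; rewrite fk xk pieceE cat_take_drop.
transitivity (\sum_x \sum_f \sum_(k < (size l).+1)
    (((x == piece k) && (rest f == drop k l))%:R : rat)).
  apply: eq_bigr => x _; apply: eq_bigr => f _; rewrite -splitE /rest.
  by rewrite map_ffun_cons_bseq /=; case: eqP.
rewrite (eq_bigr (fun x => \sum_(k < (size l).+1) \sum_f
    (((x == piece k) && (rest f == drop k l))%:R : rat))) => [|x _]; last exact: exchange_big.
rewrite exchange_big; apply: eq_bigr => k _; rewrite mul1r (bigD1 (piece k)) //.
rewrite -[RHS]addr0; congr (_ + _).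
  rewrite -size_drop -IHd; last by rewrite size_drop (leq_trans (leq_subr _ _) ln).
  by rewrite [RHS]big_mkcond; apply: eq_bigr => f _; rewrite eqxx /=; case: eqP.
by rewrite big1 // => x /negbTE xk; rewrite big1 // => f _; rewrite xk.
Qed.

(** * Weighted counts *)

(* The number of sequences with m u drivers at u is c n times a product of    *)
(* weights: n! and 1/m! for functions, 1 and 1 for distributions.             *)
Definition tuple_weight (S : forall n, pred (n.-tuple 'I_n)) (c : nat -> rat) (W : fps) :=
  forall n (m : 'I_n -> nat),
  #|[set s : n.-tuple 'I_n | S n s & [forall u, count_mem u s == m u]]|%:R =
  if (\sum_u m u == n)%N then c n * \prod_u fcoef W (m u) else 0 :> rat.

Lemma tuple_weight_all : tuple_weight (fun _ => predT) (fun n => n`!%:R) exp_series.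
Proof.
move=> n m /=.
have fm0 : (\prod_u (m u)`!)%:R != 0 :> rat.
  by rewrite pnatr_eq0 -lt0n prodn_gt0 // => u; apply: fact_gt0.
apply: (mulIf fm0); rewrite -natrM card_tuple_count.
case: eqP => _; last by rewrite mul0r.
rewrite -mulrA natr_prod -big_split /= big1 ?mulr1 // => u _.
by rewrite mulVf // pnatr_eq0 -lt0n fact_gt0.
Qed.

Lemma tuple_weight_sorted : tuple_weight (@weakly_increasing) (fun=> 1) fps_geom.
Proof.
move=> n m; rewrite card_sorted_tuple_count mul1r.
by case: eqP => // _; rewrite big1.
Qed.

(** The underlying unordered tree, through which different families are compared: it has the same
    child relation. *)
Definition child_sets (F : tree_family) n (T : pretree F n) : pretree unordered n :=
  [ffun v => [set u in children (T v)]].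

Lemma is_child_sets F n (T : pretree F n) : is_child (child_sets T) = is_child T.
Proof.
apply: boolp.funext => v; apply: boolp.funext => u.
by rewrite /is_child /= ffunE mem_enum inE.
Qed.

Lemma is_tree_child_sets F n (T : pretree F n) :
  is_tree T = [forall v, uniq (children (T v))] && is_tree (child_sets T).
Proof.
have uniq_each : uniq (all_children T) -> forall v, uniq (children (T v)).
  move=> uT v; move: uT (mem_enum 'I_n v); rewrite /all_children.
  elim: (enum _) => //= w s IHs; rewrite cat_uniq inE => /and3P[uw _ us] /orP[/eqP->//|].
  exact: IHs.
have memE u : (u \in all_children (child_sets T)) = (u \in all_children T).
  by rewrite !all_children_mem is_child_sets.
have uniqE : (forall v, uniq (children (T v))) -> uniq (all_children (child_sets T)) = uniq (all_children T).
  move=> uT; apply: perm_uniq; rewrite /all_children.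
  elim: (enum _) => //= v s IHs; apply: perm_cat => //.
  apply: uniq_perm; rewrite ?enum_uniq ?uT // => u.
  by rewrite ffunE mem_enum inE.
rewrite /is_tree is_child_sets.
have -> : [exists r, (r \notin all_children (child_sets T)) && [forall v, connect (is_child T) r v]] =
  [exists r, (r \notin all_children T) && [forall v, connect (is_child T) r v]].
  by apply: eq_existsb => r; rewrite memE.
case: forallP => [uT|NuT] /=; first by rewrite uniqE.
by apply/negbTE; apply/negP => /andP[/uniq_each].
Qed.

Definition list_count (F : tree_family) n (g : nat -> rat) (A : {set 'I_n}) : rat :=
  \sum_(a : arrangement F n | uniq (children a) && ([set x in children a] == A))
    g (size (children a)).

Lemma sum_over_child_sets F n (h : rel 'I_n -> rat) (g : nat -> rat) :
  \sum_(T : pretree F n | is_tree T) h (is_child T) * \prod_v g (size (children (T v))) =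
  \sum_(S : pretree unordered n | is_tree S) h (is_child S) * \prod_v list_count F g (S v).
Proof.
pose ok (v : 'I_n) (A : {set 'I_n}) (a : arrangement F n) :=
  uniq (children a) && ([set x in children a] == A).
transitivity (\sum_(S : pretree unordered n | is_tree S) h (is_child S) *
   \sum_(T : pretree F n) \prod_v (if ok v (S v) (T v) then g (size (children (T v))) else 0)).
  rewrite (eq_bigr (fun S : pretree unordered n => \sum_(T : pretree F n) h (is_child S) *
    \prod_v (if ok v (S v) (T v) then g (size (children (T v))) else 0))); last by move=> S _; rewrite mulr_sumr.
  rewrite exchange_big /= [LHS]big_mkcond; apply: eq_bigr => T _.
  rewrite is_tree_child_sets; case: forallP => [uT|uT] /=; last first.
    rewrite big1 // => S _.
    have /existsP[v /negbTE vN] : [exists v, ~~ uniq (children (T v))].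
      by rewrite -negb_forall; apply/forallP.
    by rewrite (bigD1 v) //= /ok vN mul0r mulr0.
  have prodE : \prod_v (if ok v (child_sets T v) (T v) then g (size (children (T v))) else 0) =
      \prod_v g (size (children (T v))).
    by apply: eq_bigr => v _; rewrite /ok uT ffunE eqxx.
  have otherS S : S != child_sets T ->
      h (is_child S) * \prod_v (if ok v (S v) (T v) then g (size (children (T v))) else 0) = 0.
    move=> SN; have /existsP[v vN] : [exists v, S v != child_sets T v].
      by rewrite -negb_forall; apply: contra SN => /forallP ST; apply/eqP/ffunP => v; apply/eqP.
    by rewrite (bigD1 v) //= /ok eq_sym; rewrite ffunE in vN; rewrite (negbTE vN) andbF mul0r mulr0.
  rewrite [RHS]big_mkcond [RHS](bigD1 (child_sets T)) // -[LHS]addr0; congr (_ + _).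
    by rewrite is_child_sets prodE.
  by rewrite big1 // => S SN; case: ifP => // _; apply: otherS.
apply: eq_bigr => S _; congr (_ * _).
rewrite -(bigA_distr_bigA (fun v a => if ok v (S v) a then g (size (children a)) else 0)).
by apply: eq_bigr => v _; rewrite /list_count [RHS]big_mkcond.
Qed.

Lemma list_count1 F phi n (A : {set 'I_n}) : arrangement_count F phi ->
  list_count F (fun=> 1) A = #|A|`!%:R * fcoef phi #|A|.
Proof. by move=> <-; rewrite -sum1dep_card natr_sum. Qed.

Lemma list_count_ordered phi n (A : {set 'I_n}) :
  list_count ordered (fcoef phi) A = #|A|`!%:R * fcoef phi #|A|.
Proof.
rewrite -[#|A|`!%:R]mulr1 -[X in _ * X * _]/(fcoef fps_geom #|A|) -arrangement_count_ordered.
rewrite -sum1dep_card natr_sum mulr_suml; apply: eq_bigr => a.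
by rewrite uniq_set_eq mul1r => aA; rewrite [#|A|]cardE -(perm_size aA).
Qed.

(** Both sides are sums over the underlying unordered trees, where a node with child set A
    contributes |A|! phi_|A|: on the left as its number of arrangements, on the right as |A|!
    orderings of weight phi_|A|. *)
Lemma sum_family_ordered F phi n (h : rel 'I_n -> rat) : arrangement_count F phi ->
  \sum_(T : pretree F n | is_tree T) h (is_child T) =
  \sum_(T : pretree ordered n | is_tree T)
     h (is_child T) * \prod_v fcoef phi (size (children (T v))).
Proof.
move=> Fphi; rewrite (sum_over_child_sets _ h (fcoef phi)).
transitivity (\sum_(T : pretree F n | is_tree T) h (is_child T) * \prod_(v : 'I_n) (1 : rat)).
  by apply: eq_bigr => T _; rewrite big1 ?mulr1.
rewrite (sum_over_child_sets _ h (fun=> 1)); apply: eq_bigr => S _; congr (_ * _).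
by apply: eq_bigr => v _; rewrite (list_count1 _ Fphi) list_count_ordered.
Qed.

Lemma weightE W phi n (t : forest 'I_n) : uniq (labels t) ->
  weight W phi t = \prod_(v <- labels t)
    (fcoef phi (size (children_in t v)) * fcoef W (drivers_at t v)).
Proof.
elim: t => [|v m l IHl r IHr] uq; first by rewrite big_nil.
have [_ _ ul ur _] := uniq_node uq.
rewrite [labels _]/= big_cons big_cat [weight _ _ _]/= IHl // IHr //.
rewrite [children_in _ v]/= [drivers_at _ v]/= eqxx -!mulrA; congr (_ * (_ * (_ * _))).
  by apply: eq_big_seq => x xl; rewrite (children_in_left uq) ?(drivers_at_left uq).
by apply: eq_big_seq => x xr; rewrite (children_in_right uq) ?(drivers_at_right uq).
Qed.

Lemma drivers_all n (t : forest 'I_n) : t \in trees_on_all n ->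
  (\sum_u drivers_at t u)%N = drivers t.
Proof.
move=> tA; have := tA; rewrite mem_trees_on_all => /and4P[uq _ _ _].
by rewrite drivers_sum // (perm_big _ (labels_all tA)) big_enum.
Qed.

(** For the root the condition follows from the total being n; all other nodes have a parent and lie
    in [l], where [excess_ok] imposes [tau] throughout. *)
Lemma enough_drivers_node n tau (v : 'I_n) m l : Node v m l Leaf \in trees_on_all n ->
  let t := Node v m l Leaf in
  enough_drivers (is_child (tree_of t)) tau (drivers_at t) && (\sum_u drivers_at t u == n)%N =
  excess_ok tau l && (m + drivers l == n)%N.
Proof.
move=> tA t; have := tA; rewrite -/t mem_trees_on_all => /and4P[uq /eqP tT _ _].
have et := tree_of_agrees tA; rewrite -/t in et.
have [vl _ ul _ _] := uniq_node uq; have el := agrees_left uq et.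
rewrite drivers_all //= addn0; case: eqP => [mn|]; last by rewrite !andbF.
rewrite !andbT (excess_okP tau ul el).
have perm := perm_children_in uq.
have xl x : (x != v) = (x \in labels l).
  have := in_setT x; rewrite -tT !inE /= cats0; case: eqVneq => [->|_] //=.
  by rewrite (negbTE vl).
have parent x : [exists u, is_child (tree_of t) u x] = (x != v).
  have := perm_uniq perm; rewrite uq -[roots t]/[:: v] cat1s cons_uniq => /esym/andP[vN _].
  have memE : (x \in labels t) = (x == v) || (x \in flatten [seq children_in t w | w <- labels t]).
    by rewrite (perm_mem perm) -[roots t]/[:: v] cat1s inE.
  have labT y : y \in labels t by have := in_setT y; rewrite -tT inE.
  rewrite labT in memE.
  apply/existsP/idP => [[u]|xv].
    rewrite et // => xu; apply: contra vN => /eqP<-.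
    by apply/flatten_mapP; exists u.
  move: memE; rewrite (negbTE xv) => /esym/flatten_mapP[u ut xu].
  by exists u; rewrite et.
have sumE x : x \in labels l -> (\sum_(u in descendants (is_child (tree_of t)) x) drivers_at t u =
   \sum_(u in descendants (is_child (tree_of t)) x) drivers_at l u)%N.
  move=> xl'; apply: eq_bigr => u; rewrite inE => /connectP[q xq uE].
  have ul' : u \in labels l.
    rewrite uE; elim/last_ind: q xq {uE} => //= q w IHq.
    by rewrite rcons_path last_rcons => /andP[/IHq qs]; rewrite el // => /children_in_sub.
  by rewrite (drivers_at_left uq).
apply/forallP/allP => [enough x xl'|enough x].
  by have := enough x; rewrite parent xl xl' andbT sumE.
rewrite parent; case: (eqVneq x v) => [->|xv]; last first.
  by have := enough x; rewrite -xl xv andbT sumE -?xl //; apply.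
have dv : descendants (is_child (tree_of t)) v = setT.
  by apply/setP => y; rewrite (descendants_node uq et) -[_ :: _]/(v :: labels l) inE -xl inE orbN.
rewrite andbF addn0 dv cardsT card_ord.
apply: (@leq_trans (\sum_u drivers_at t u)%N); first by rewrite (drivers_all tA) /= addn0 mn.
by apply: eq_leq; apply: eq_bigl => u; rewrite inE.
Qed.

Section Counting.
Variables (F : tree_family) (phi W : fps) (tau : bool).
Variables (S : forall n, pred (n.-tuple 'I_n)) (c : nat -> rat) (b : nat -> fps).
Hypothesis Fphi : arrangement_count F phi.
Hypothesis SW : tuple_weight S c W.
Hypothesis bS : tree_series W phi tau b.

(** Sequences are grouped by their vector of multiplicities, on which the condition depends. *)
Lemma sum_tuples n (e : rel 'I_n) :
  \sum_(s : n.-tuple 'I_n | S s && enough_drivers e tau (fun u => count_mem u s)) 1 =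
  c n * \sum_(D : {ffun 'I_n -> 'I_n.+1})
    if enough_drivers e tau (fun u => D u) && (\sum_u D u == n)%N
    then \prod_u fcoef W (D u) else 0 :> rat.
Proof.
pose cnt (s : n.-tuple 'I_n) : {ffun 'I_n -> 'I_n.+1} := [ffun u => inord (count_mem u s)].
have cntE s u : cnt s u = count_mem u s :> nat.
  by rewrite ffunE inordK // ltnS -[X in (_ <= X)%N](size_tuple s) count_size.
rewrite (partition_big cnt xpredT) // mulr_sumr; apply: eq_bigr => D _.
have cntD s : (cnt s == D) = [forall u, count_mem u s == D u].
  by apply/eqP/forallP => [<- u|sD]; [rewrite cntE | apply/ffunP => u; apply: val_inj; rewrite /= cntE (eqP (sD u))].
have enoughE s : cnt s == D -> enough_drivers e tau (fun u => count_mem u s) =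
    enough_drivers e tau (fun u => D u).
  move/eqP<-; apply: eq_forallb => v; congr (_ <= _)%N.
  by apply: eq_bigr => u _; rewrite cntE.
transitivity (if enough_drivers e tau (fun u => D u) then
    #|[set s : n.-tuple 'I_n | S s & [forall u, count_mem u s == D u]]|%:R else 0 : rat).
  case: ifP => enD; last first.
    by rewrite big_pred0 // => s; case: (boolP (cnt s == D)) => [/enoughE->|_]; rewrite ?enD ?andbF.
  rewrite -sum1dep_card natr_sum; apply: eq_bigl => s; rewrite -cntD.
  by case: (boolP (cnt s == D)) => [/enoughE->|_]; rewrite ?enD ?andbT ?andbF.
by rewrite SW; case: enough_drivers; case: eqP; rewrite /= ?mulr0.
Qed.

Lemma count_pairs n : (0 < n)%N ->
  #|[set p : pretree F n * n.-tuple 'I_n |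
     (if tau then prime_parking_fun p else parking_fun p) && S p.2]|%:R =
  c n * n`!%:R * fcoef (rooted_series W phi b) n :> rat.
Proof.
move=> n0.
pose X (e : rel 'I_n) (D : 'I_n -> nat) : rat :=
  if enough_drivers e tau D && (\sum_u D u == n)%N then \prod_u fcoef W (D u) else 0.
transitivity (\sum_(T : pretree F n | is_tree T) c n *
    \sum_(D : {ffun 'I_n -> 'I_n.+1}) X (is_child T) (fun u => D u)).
  rewrite -sum1dep_card natr_sum.
  rewrite (eq_bigr (fun T => \sum_(s : n.-tuple 'I_n | S s && enough_drivers (is_child T) tau (fun u => count_mem u s)) 1)); last first.
    by move=> T _; rewrite sum_tuples.
  rewrite pair_big_dep; apply: eq_bigl => -[T s] /=.
  case: (boolP (is_tree T)) => treeT; last first.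
    by rewrite /prime_parking_fun /parking_fun /= (negbTE treeT); case: tau.
  by rewrite parking_counts // andbC.
(* The summand depends on the tree through its child relation only, so the family may be replaced by
   weighted ordered trees. *)
rewrite (sum_family_ordered (fun e => c n * \sum_(D : {ffun 'I_n -> 'I_n.+1}) X e (fun u => D u)) Fphi).
transitivity (c n * \sum_(t <- trees_on_all n)
    (X (is_child (tree_of t)) (drivers_at t) * \prod_v fcoef phi (size (children_in t v)))).
  rewrite (eq_bigr (fun T : pretree ordered n => \sum_(D : {ffun 'I_n -> 'I_n.+1}) c n *
    (X (is_child T) (fun u => D u) * \prod_v fcoef phi (size (children (T v)))))); last first.
    by move=> T _; rewrite mulr_sumr mulr_suml; apply: eq_bigr => D _; rewrite mulrA.
  rewrite (big_trees (fun T D => c n * (X (is_child T) (fun u => D u) * \prod_v fcoef phi (size (children (T v)))))).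
  rewrite mulr_sumr; apply: eq_big_seq => t tA; congr (_ * (_ * _)).
    by congr (X _ _); apply: boolp.funext => u; rewrite drivers_ofE.
  by apply: eq_bigr => v _; rewrite tree_ofE.
rewrite -mulrA; congr (_ * _).
have [b' b'S <-] := fcoef_rooted_trunc n0 bS.
transitivity (\sum_(t <- trees_on_all n) if t is Node v m l _ then
    fcoef (fps_const (fcoef phi (size (roots l))) * fps_const (fcoef W m) * fpsX ^+ m
      * excess_series W phi tau l) 1 else 0).
  apply: eq_big_seq => t tA; have := tA; rewrite mem_trees_on_all => /and4P[uq _ rt _].
  case: t tA uq rt => [|v m l [|? ? ? ?]] // tA uq _.
  rewrite /X enough_drivers_node // excess_seriesE.
  have [vl _ ul _ _] := uniq_node uq.
  case: (boolP (excess_ok tau l)) => okl; last by rewrite mul0r mulr0 fcoef0.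
  have lE : size (labels l) = n.-1.
    by have := perm_size (labels_all tA); rewrite size_enum_ord /= cats0 => nE; rewrite -[in RHS]nE.
  have := excess_ok_le okl; rewrite lE => nl.
  have -> : fps_const (fcoef phi (size (roots l))) * fps_const (fcoef W m) * fpsX ^+ m *
     (fps_const (weight W phi l) * fpsX ^+ (drivers l - n.-1)) =
     fps_const (fcoef phi (size (roots l)) * fcoef W m * weight W phi l) * fpsX ^+ (m + (drivers l - n.-1)).
    by rewrite !rmorphM exprD; ring.
  (* Exponent 1 means that the drivers at the root and below exceed the n - 1 nodes below by one,
     i.e. that there are n drivers. *)
  rewrite fcoef_constM fcoef_Xn (_ : (1 == _)%N = (m + drivers l == n)%N); last by apply/eqP/eqP; lia.
  case: eqP => _; last by rewrite mul0r mulr0.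
  rewrite mulr1 mulrC -big_split /=.
  have := weightE W phi uq; rewrite (perm_big _ (labels_all tA)) big_enum /= mulr1 => <-.
  by [].
(* Each of the n root labels contributes the same amount, and n (n-1)! = n!. *)
rewrite sum_trees_on_all (eq_bigr (fun=> n.-1`!%:R *
  fcoef ((\sum_(m < n.+1) fps_const (fcoef W m) * fpsX ^+ m) * phisum phi b' n.-1) 1)).
  have fE : (n * n.-1`! = n`!)%N by rewrite -[RHS](congr1 factorial (prednK n0)) factS prednK.
  by rewrite sumr_const card_ord -[LHS]mulr_natl mulrA -natrM fE.
by move=> v _; rewrite -(sum_trees b'S v).
Qed.

End Counting.

(** * The four generating functions as rooted series *)

Section FamilySeries.
Variables (F : tree_family) (phi : fps) (b : nat -> fps).
Hypothesis Fphi : arrangement_count F phi.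

Lemma fact_rat_neq0 n : n`!%:R != 0 :> rat.
Proof. by rewrite pnatr_eq0 -lt0n fact_gt0. Qed.

Lemma G_rooted_series : tree_series exp_series phi false b ->
  G F = rooted_series exp_series phi b.
Proof.
move=> bS; apply: fpsP => -[//|n].
have E : #|[set p | @parking_fun F n.+1 p]|%:R =
    n.+1`!%:R * n.+1`!%:R * fcoef (rooted_series exp_series phi b) n.+1 :> rat.
  apply: etrans (count_pairs Fphi tuple_weight_all bS (ltn0Sn n)).
  by congr (_%:R); apply: eq_card => p; rewrite !inE andbT.
rewrite [LHS]/= E.
by rewrite expr2 mulrC mulKf // mulf_neq0 ?fact_rat_neq0.
Qed.

Lemma P_rooted_series : tree_series exp_series phi true b ->
  P F = rooted_series exp_series phi b.
Proof.
move=> bS; apply: fpsP => -[//|n].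
have E : #|[set p | @prime_parking_fun F n.+1 p]|%:R =
    n.+1`!%:R * n.+1`!%:R * fcoef (rooted_series exp_series phi b) n.+1 :> rat.
  apply: etrans (count_pairs Fphi tuple_weight_all bS (ltn0Sn n)).
  by congr (_%:R); apply: eq_card => p; rewrite !inE andbT.
rewrite [LHS]/= E.
by rewrite expr2 mulrC mulKf // mulf_neq0 ?fact_rat_neq0.
Qed.

Lemma Gtilde_rooted_series : tree_series fps_geom phi false b ->
  Gtilde F = rooted_series fps_geom phi b.
Proof.
move=> bS; apply: fpsP => -[//|n].
have E : #|[set p | @parking_dist F n.+1 p]|%:R =
    1 * n.+1`!%:R * fcoef (rooted_series fps_geom phi b) n.+1 :> rat.
  apply: etrans (count_pairs Fphi tuple_weight_sorted bS (ltn0Sn n)).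
  by congr (_%:R); apply: eq_card => p; rewrite !inE.
rewrite [LHS]/= E.
by rewrite mul1r mulrC mulKf // fact_rat_neq0.
Qed.

Lemma Ptilde_rooted_series : tree_series fps_geom phi true b ->
  Ptilde F = rooted_series fps_geom phi b.
Proof.
move=> bS; apply: fpsP => -[//|n].
have E : #|[set p | @prime_parking_dist F n.+1 p]|%:R =
    1 * n.+1`!%:R * fcoef (rooted_series fps_geom phi b) n.+1 :> rat.
  apply: etrans (count_pairs Fphi tuple_weight_sorted bS (ltn0Sn n)).
  by congr (_%:R); apply: eq_card => p; rewrite !inE.
rewrite [LHS]/= E.
by rewrite mul1r mulrC mulKf // fact_rat_neq0.
Qed.

End FamilySeries.

Lemma given_by_rooted (A : fps) W phi tau H E :
  (forall b, tree_series W phi tau b -> A = rooted_series W phi b) ->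
  (forall b, tree_series W phi tau b -> given_by (rooted_series W phi b) H E) ->
  given_by A H E.
Proof.
move=> AE given; have [b bS] := tree_series_exists W phi tau.
by rewrite (AE b bS); apply: given.
Qed.

Theorem theorem2p1 :
  [/\ [/\ given_by (G ordered)
            (fun Q => 1 - 1 / ((1 - Q) * (1 + Q) * fps_exp Q))
            (fun Q => fpsX * (1 + Q) ^+ 2 * fps_exp Q),
          given_by (G unordered)
            (fun Q => 2%:R * Q + fps_ln (1 - Q))
            (fun Q => fpsX * fps_exp (2%:R * Q)),
          (forall d : nat, (1 <= d)%N ->
            given_by (G (dary d))
              (fun Q => (1 - d%:R * Q) `^ (1 / d%:R) * fps_exp Q / (1 - Q) - 1)
              (fun Q => fpsX * (fps_exp (d%:R * Q) / (1 - Q) ^+ (d - 1))))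
        & (forall d : nat, (1 <= d)%N ->
            given_by (G (bundled d))
              (fun Q => 1 - 1 / ((1 - d%:R * Q) `^ (1 / d%:R) * (1 + Q) * fps_exp Q))
              (fun Q => fpsX * (1 + Q) ^+ (d + 1) * fps_exp (d%:R * Q)))],
      [/\ given_by (P ordered)
            (fun Q => (1 + Q) * (1 - Q) * fps_exp Q - 1)
            (fun Q => fpsX / ((1 - Q) ^+ 2 * fps_exp Q)),
          given_by (P unordered)
            (fun Q => 2%:R * Q + fps_ln (1 - Q))
            (fun Q => fpsX / (1 - Q)),
          (forall d : nat, (1 <= d)%N ->
            given_by (P (dary d))
              (fun Q => 1 - (1 - Q) / ((1 - d%:R * Q) `^ (1 / d%:R) * fps_exp Q))
              (fun Q => fpsX * (fps_exp Q / (1 - d%:R * Q) `^ ((d%:R - 1) / d%:R))))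
        & (forall d : nat, (1 <= d)%N ->
            given_by (P (bundled d))
              (fun Q => (1 - d%:R * Q) `^ (1 / d%:R) * (1 + Q) * fps_exp Q - 1)
              (fun Q => fpsX / ((1 - d%:R * Q) `^ ((d%:R + 1) / d%:R) * fps_exp Q)))],
      [/\ given_by (Gtilde ordered)
            (fun Q => 1 - 1 / ((1 + Q) ^+ 2 * (1 - Q)))
            (fun Q => fpsX * (1 + Q) ^+ 4),
          given_by (Gtilde unordered)
            (fun Q => Q + fps_ln (1 + Q) + fps_ln (1 - Q))
            (fun Q => fpsX * (1 + Q) ^+ 2 * fps_exp Q),
          (forall d : nat, (1 <= d)%N ->
            given_by (Gtilde (dary d))
              (fun Q => (1 - Q ^+ 2) `^ (1 / d%:R) / (1 - Q / d%:R) - 1)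
              (fun Q => d%:R * fpsX * (1 + Q) ^+ 2 / (1 - Q / d%:R) ^+ (d - 1)))
        & (forall d : nat, (1 <= d)%N ->
            given_by (Gtilde (bundled d))
              (fun Q => 1 - 1 / ((1 + Q / d%:R) * (1 - Q ^+ 2) `^ (1 / d%:R)))
              (fun Q => d%:R * fpsX * (1 + Q) ^+ 2 * (1 + Q / d%:R) ^+ (d + 1)))]
    & [/\ given_by (Ptilde ordered)
            (fun Q => (1 + Q) ^+ 2 * (1 - Q) - 1)
            (fun Q => fpsX / (1 - Q) ^+ 2),
          given_by (Ptilde unordered)
            (fun Q => Q + fps_ln (1 + Q) + fps_ln (1 - Q))
            (fun Q => fpsX * (1 + Q) / (1 - Q)),
          (forall d : nat, (1 <= d)%N ->
            given_by (Ptilde (dary d))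
              (fun Q => 1 - (1 - Q / d%:R) / (1 - Q ^+ 2) `^ (1 / d%:R))
              (fun Q => d%:R * fpsX * (1 + Q) `^ ((d%:R + 1) / d%:R)
                          / (1 - Q) `^ ((d%:R - 1) / d%:R)))
        & (forall d : nat, (1 <= d)%N ->
            given_by (Ptilde (bundled d))
              (fun Q => (1 + Q / d%:R) * (1 - Q ^+ 2) `^ (1 / d%:R) - 1)
              (fun Q => d%:R * fpsX * (1 + Q) `^ ((d%:R - 1) / d%:R)
                          / (1 - Q) `^ ((d%:R + 1) / d%:R)))]].
Proof.
have ao := arrangement_count_ordered; have au := arrangement_count_unordered.
have ad := arrangement_count_dary; have ab := arrangement_count_bundled.
split; split=> [||d d_gt0|d d_gt0].
- by apply: given_by_rooted => b; [apply: (G_rooted_series ao) | apply: given_ordered_exp_all].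
- by apply: given_by_rooted => b; [apply: (G_rooted_series au) | apply: given_unordered_exp_all].
- by apply: given_by_rooted => b; [apply: (G_rooted_series (ad d)) | apply: (given_dary_exp_all d_gt0)].
- by apply: given_by_rooted => b; [apply: (G_rooted_series (ab d)) | apply: (given_bundled_exp_all d_gt0)].
- by apply: given_by_rooted => b; [apply: (P_rooted_series ao) | apply: given_ordered_exp_prime].
- by apply: given_by_rooted => b; [apply: (P_rooted_series au) | apply: given_unordered_exp_prime].
- by apply: given_by_rooted => b; [apply: (P_rooted_series (ad d)) | apply: (given_dary_exp_prime d_gt0)].
- by apply: given_by_rooted => b; [apply: (P_rooted_series (ab d)) | apply: (given_bundled_exp_prime d_gt0)].
- by apply: given_by_rooted => b; [apply: (Gtilde_rooted_series ao) | apply: given_ordered_geom_all].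
- by apply: given_by_rooted => b; [apply: (Gtilde_rooted_series au) | apply: given_unordered_geom_all].
- by apply: given_by_rooted => b; [apply: (Gtilde_rooted_series (ad d)) | apply: (given_dary_geom_all d_gt0)].
- by apply: given_by_rooted => b; [apply: (Gtilde_rooted_series (ab d)) | apply: (given_bundled_geom_all d_gt0)].
- by apply: given_by_rooted => b; [apply: (Ptilde_rooted_series ao) | apply: given_ordered_geom_prime].
- by apply: given_by_rooted => b; [apply: (Ptilde_rooted_series au) | apply: given_unordered_geom_prime].
- by apply: given_by_rooted => b; [apply: (Ptilde_rooted_series (ad d)) | apply: (given_dary_geom_prime d_gt0)].
- by apply: given_by_rooted => b; [apply: (Ptilde_rooted_series (ab d)) | apply: (given_bundled_geom_prime d_gt0)].
Qed.
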